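(* Let $k\ge 1$ and let $\{(X_n,Y_n);\,n\ge -k+1\}$ be a (time-homogeneous) Markov chain of memory length $k$ on the finite alphabet $A\times B$, with an arbitrary initial distribution for $(X_{-k+1}^0,Y_{-k+1}^0)$ and with an all-positive transition matrix $Q$, that is, $Q(a_k,b_k\mid a_0^{k-1},b_0^{k-1})>0$ for all $a_0^k\in A^{k+1}$, $b_0^k\in B^{k+1}$. Assume that the univariate process $\{Y_n\}$ is also a Markov chain with memory length $k$. Let $m=|A|$ and $\ell=|B|$. Let $\hat I_n^{(k)}(\boldsymbol X\to\boldsymbol Y)$ be the plug-in estimator and $I(\boldsymbol X\to\boldsymbol Y)$ the directed information rate. (i) If the random variables $\{X_n\}$ do have a causal influence on the $\{Y_n\}$, equivalently, if $I(\boldsymbol X\to\boldsymbol Y)>0$, then, as $n\to\infty$, $$\sqrt n\,\big[\hat I_n^{(k)}(\boldsymbol X\to\boldsymbol Y)-I(\boldsymbol X\to\boldsymbol Y)\big]\ \xrightarrow{\ \mathcal D\ }\ N(0,\sigma^2),$$ where $\sigma^2$ is given by the following limit, which exists and is finite: $$\sigma^2=\lim_{n\to\infty}\frac1n\,\mathrm{Var}\left\{\log\left[\prod_{i=1}^n\frac{P_{\bar X_{-k}^0\bar Y_0|\bar Y_{-k}^{-1}}(X_{i-k}^i,Y_i\mid Y_{i-k}^{i-1})}{P_{\bar Y_0|\bar Y_{-k}^{-1}}(Y_i\mid Y_{i-k}^{i-1})\,P_{\bar X_{-k}^0|\bar Y_{-k}^{-1}}(X_{i-k}^i\mid Y_{i-k}^{i-1})}\right]\right\}.$$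 (ii) If the random variables $\{X_n\}$ do not have a causal influence on the $\{Y_n\}$, equivalently, if $I(\boldsymbol X\to\boldsymbol Y)=0$, then, as $n\to\infty$, $$2n\,\hat I_n^{(k)}(\boldsymbol X\to\boldsymbol Y)\ \xrightarrow{\ \mathcal D\ }\ \chi^2\big(\ell^k(m^{k+1}-1)(\ell-1)\big).$$
   Context: Notation: $\log$ is the natural logarithm; $x_i^j=(x_i,\dots,x_j)$; $H(\cdot)$, $H(\cdot|\cdot)$, $I(\cdot;\cdot)$, $I(\cdot;\cdot|\cdot)$ are Shannon entropy, conditional entropy, mutual information and conditional mutual information of finite-valued random variables; $P_{U}$ and $P_{U|V}$ denote the (joint) probability mass function of $U$ and the conditional probability mass function of $U$ given $V$. $\xrightarrow{\mathcal D}$ denotes convergence in distribution, $N(0,\sigma^2)$ the centered normal law with variance $\sigma^2$ (point mass at $0$ if $\sigma^2=0$), and $\chi^2(s)$ the chi-squared law with $s$ degrees of freedom (point mass at $0$ if $s=0$). Markov chain of memory length $k$: the conditional distribution of the next value given the whole past depends only on the last $k$ values (so the true order may be smaller than $k$); for the pair process, $Q(a_k,b_k\mid a_0^{k-1},b_0^{k-1})=\Pr\{X_n=a_k,Y_n=b_k\mid X_{n-k}^{n-1}=a_0^{k-1},Y_{n-k}^{n-1}=b_0^{k-1}\}$. Stationary version: $\{(\bar X_n,\bar Y_n)\}$ is the stationary process (extended to all $n\in\mathbb Z$) with the same transition matrix, where $(\bar X_{-k+1}^0,\bar Y_{-k+1}^0)$ has the unique invariant distribution. Directed information: $I(X_1^n\to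 Y_1^n)=H(Y_1^n)-\sum_{i=1}^n H(Y_i|Y_1^{i-1},X_1^i)$. Directed information rate: $I(\boldsymbol X\to\boldsymbol Y)=\lim_{n\to\infty}\frac1n I(X_1^n\to Y_1^n)$ (the limit exists under the stated assumptions). Causal influence: $\{X_n\}$ has no causal influence on $\{Y_n\}$ if, for each $i\ge 1$, $Y_i$ is conditionally independent of $X_{i-k}^i$ given $Y_{i-k}^{i-1}$; otherwise it has a causal influence. Plug-in estimator: from the sample $(X_{-k+1}^n,Y_{-k+1}^n)$ form the empirical distribution on $A^{k+1}\times B^{k+1}$, $$\hat P_{X_{-k}^0Y_{-k}^0,n}(a_0^k,b_0^k)=\frac1n\sum_{i=1}^n\mathbb I_{\{X_{i-k}^i=a_0^k,\;Y_{i-k}^i=b_0^k\}},$$ and set $\hat I_n^{(k)}(\boldsymbol X\to\boldsymbol Y)=I(\hat Y_0;\hat X_{-k}^0\mid\hat Y_{-k}^{-1})$ where $(\hat X_{-k}^0,\hat Y_{-k}^0)\sim\hat P_{X_{-k}^0Y_{-k}^0,n}$. *)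

(* Defs.v *)
From HB Require Import structures.
From mathcomp Require Import all_boot all_order all_algebra.
From mathcomp Require Import all_classical all_reals all_analysis measurable_realfun.
Import Order.TTheory GRing.Theory Num.Theory.
Import numFieldNormedType.Exports.

Set Implicit Arguments.
Unset Strict Implicit.
Unset Printing Implicit Defensive.

Local Open Scope classical_set_scope.
Local Open Scope ring_scope.

(** The library's [ln] satisfies [ln 0 = 0] and [x / 0 = 0], so that terms of
    zero probability vanish in the sums below. *)

Section Information.
Variable R : realType.

Definition pmf_image (T U : finType) (p : T -> R) (f : T -> U) (u : U) : R :=
  \sum_(t : T | f t == u) p t.

(* the conditional probability [p(u | v)] *)
Definition cond_pmf (U V : finType) (p : U * V -> R) (u : U) (v : V) : R :=
  p (u, v) / pmf_image p snd v.

Definition entropy (U : finType) (p : U -> R) : R :=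
  - \sum_(u : U) p u * ln (p u).

(* [H(U | V)] for the joint pmf [p] of [(U, V)] *)
Definition cond_entropy (U V : finType) (p : U * V -> R) : R :=
  - \sum_(uv : U * V) p uv * ln (cond_pmf p uv.1 uv.2).

(* [p(u, v | w) / (p(u | w) p(v | w))] *)
Definition info_ratio (U V W : finType) (p : U * V * W -> R)
    (u : U) (v : V) (w : W) : R :=
  cond_pmf p (u, v) w /
    (cond_pmf (pmf_image p (fun t => (t.1.1, t.2))) u w *
     cond_pmf (pmf_image p (fun t => (t.1.2, t.2))) v w).

(* [I(U; V | W)] for the joint pmf [p] of [(U, V, W)] *)
Definition cond_mutual_info (U V W : finType) (p : U * V * W -> R) : R :=
  \sum_(t : U * V * W) p t * ln (info_ratio p t.1.1 t.1.2 t.2).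

End Information.

Section Blocks.
Variable T : Type.

(* [(s_i, ..., s_(i+m-1))] *)
Definition segment (s : nat -> T) (i m : nat) : m.-tuple T :=
  [tuple s (i + j)%N | j < m].

Definition block (Omega : Type) (X : nat -> Omega -> T) (i m : nat)
    (w : Omega) : m.-tuple T :=
  segment (fun j => X j w) i m.

Definition front (k : nat) (a : (k.+1).-tuple T) : k.-tuple T :=
  [tuple tnth a (widen_ord (leqnSn k) j) | j < k].

Definition back (k : nat) (a : (k.+1).-tuple T) : k.-tuple T :=
  [tuple tnth a (lift ord0 j) | j < k].

Definition final (k : nat) (a : (k.+1).-tuple T) : T := tnth a ord_max.

End Blocks.

(** The time set [{-k+1, -k+2, ...}] is shifted to [nat]: [X j] is the variable
    at time [j - k + 1].  Hence the initial block
    is [block X 0 k], the variable at time [i.+1] is [X (i + k)], and the window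
    made of it and the [k] preceding ones is [block X i k.+1]. *)

Section Processes.
Context {d : measure_display} {Omega : measurableType d} {R : realType}.
Variable P : probability Omega R.

Definition pmf_of (U : finType) (X : Omega -> U) (u : U) : R :=
  fine (P (X @^-1` [set u])).

Definition finite_rv (U : finType) (X : Omega -> U) : Prop :=
  forall u : U, measurable (X @^-1` [set u]).

Definition cond_prob (U V : finType) (X : Omega -> U) (Y : Omega -> V)
    (u : U) (v : V) : R :=
  cond_pmf (pmf_of (fun w => (X w, Y w))) u v.

Definition cond_indep (U V W : finType) (X : Omega -> U) (Y : Omega -> V)
    (Z : Omega -> W) : Prop :=
  forall u v z, 0 < pmf_of Z z ->
    cond_prob (fun w => (X w, Y w)) Z (u, v) z =
    cond_prob X Z u z * cond_prob Y Z v z.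

(* the next value given the whole past depends only on the last [k] values *)
Definition markov_memory (B : finType) (k : nat) (Y : nat -> Omega -> B) : Prop :=
  forall (n : nat) (y : nat -> B),
    0 < pmf_of (block Y 0 (n + k)) (segment y 0 (n + k)) ->
    cond_prob (Y (n + k)) (block Y 0 (n + k)) (y (n + k)) (segment y 0 (n + k)) =
    cond_prob (Y (n + k)) (block Y n k) (y (n + k)) (segment y n k).

(* [Q a b a' b'] is the probability [Q(a', b' | a, b)] *)
Definition positive_transition_matrix (A B : finType) (k : nat)
    (Q : k.-tuple A -> k.-tuple B -> A -> B -> R) : Prop :=
  (forall a b a' b', 0 < Q a b a' b') /\
  (forall a b, \sum_(a' : A) \sum_(b' : B) Q a b a' b' = 1).

(* the pair process is a time-homogeneous Markov chain of memory length [k]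
   with transition matrix [Q]; its initial distribution is unconstrained *)
Definition markov_chain_with (A B : finType) (k : nat)
    (Q : k.-tuple A -> k.-tuple B -> A -> B -> R)
    (X : nat -> Omega -> A) (Y : nat -> Omega -> B) : Prop :=
  forall (n : nat) (x : nat -> A) (y : nat -> B),
    let past w := (block X 0 (n + k) w, block Y 0 (n + k) w) in
    let past_value := (segment x 0 (n + k), segment y 0 (n + k)) in
    0 < pmf_of past past_value ->
    cond_prob (fun w => (X (n + k) w, Y (n + k) w)) past
      (x (n + k), y (n + k)) past_value =
    Q (segment x n k) (segment y n k) (x (n + k)) (y (n + k)).

Definition no_causal_influence (A B : finType) (k : nat)
    (X : nat -> Omega -> A) (Y : nat -> Omega -> B) : Prop :=
  forall i : nat, cond_indep (Y (i + k)) (block X i k.+1) (block Y i k).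

Definition causal_influence (A B : finType) (k : nat)
    (X : nat -> Omega -> A) (Y : nat -> Omega -> B) : Prop :=
  ~ no_causal_influence k X Y.

(* times 1, ..., n are the indices k, ..., k + n - 1 *)
Definition directed_info (A B : finType) (k : nat)
    (X : nat -> Omega -> A) (Y : nat -> Omega -> B) (n : nat) : R :=
  entropy (pmf_of (block Y k n)) -
  \sum_(i < n) cond_entropy
    (pmf_of (fun w => (Y (i + k)%N w, (block Y k i w, block X k i.+1 w)))).

Definition directed_info_rate (A B : finType) (k : nat)
    (X : nat -> Omega -> A) (Y : nat -> Omega -> B) : R :=
  limn (fun n => directed_info k X Y n / n%:R).

End Processes.

Section Estimator.
Variables (R : realType) (A B : finType) (k : nat).

(* from the law of [(X_{-k}^0, Y_{-k}^0)] to that of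
   [(Y_0, X_{-k}^0, Y_{-k}^{-1})] *)
Definition split_law (p : (k.+1).-tuple A * (k.+1).-tuple B -> R) :
    B * (k.+1).-tuple A * k.-tuple B -> R :=
  pmf_image p (fun ab => (final ab.2, ab.1, front ab.2)).

Definition empirical_pmf (Omega : Type) (X : nat -> Omega -> A)
    (Y : nat -> Omega -> B) (n : nat) (w : Omega)
    (ab : (k.+1).-tuple A * (k.+1).-tuple B) : R :=
  n%:R^-1 *
  \sum_(i < n) ((block X i k.+1 w == ab.1) && (block Y i k.+1 w == ab.2))%:R.

Definition plug_in (Omega : Type) (X : nat -> Omega -> A)
    (Y : nat -> Omega -> B) (n : nat) (w : Omega) : R :=
  cond_mutual_info (split_law (empirical_pmf X Y n w)).

Variable Q : k.-tuple A -> k.-tuple B -> A -> B -> R.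

(* the law of [k + 1] consecutive symbols when the first [k] have law [nu] *)
Definition window_law (nu : k.-tuple A * k.-tuple B -> R)
    (ab : (k.+1).-tuple A * (k.+1).-tuple B) : R :=
  nu (front ab.1, front ab.2) *
  Q (front ab.1) (front ab.2) (final ab.1) (final ab.2).

Definition invariant_distribution (nu : k.-tuple A * k.-tuple B -> R) : Prop :=
  [/\ forall ab, 0 <= nu ab,
      \sum_ab nu ab = 1 &
      forall ab, pmf_image (window_law nu)
        (fun cd => (back cd.1, back cd.2)) ab = nu ab].

(* the logarithm of the product in the asymptotic variance; the conditional laws
   are those of the stationary chain, evaluated along the sample *)
Definition log_likelihood_ratio (nu : k.-tuple A * k.-tuple B -> R)
    (Omega : Type) (X : nat -> Omega -> A) (Y : nat -> Omega -> B)
    (n : nat) (w : Omega) : R :=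
  ln (\prod_(i < n) info_ratio (split_law (window_law nu))
        (Y (i + k)%N w) (block X i k.+1 w) (block Y i k w)).

End Estimator.

Section Laws.
Variable R : realType.

(* convergence of distribution functions at the continuity points of that of
   the limit law [mu] *)
Definition cvg_in_distribution (d : measure_display) (Omega : measurableType d)
    (P : probability Omega R) (Z : nat -> Omega -> R)
    (mu : probability (measurableTypeR R) R) : Prop :=
  forall x : R,
    (fun t : R => mu `]-oo, t]%classic) @ x --> mu `]-oo, x]%classic ->
    P (Z n @^-1` `]-oo, x]%classic) @[n --> \oo] --> mu `]-oo, x]%classic.

(* [normal_prob] is not a point mass when its scale parameter is 0 *)
Definition centered_normal (s2 : R) : probability (measurableTypeR R) R :=
  if s2 == 0 then (\d_(0 : measurableTypeR R) : probability _ _)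
  else (normal_prob (0 : R) (Num.sqrt s2) : probability _ _).

Definition add_square (xy : measurableTypeR R * measurableTypeR R) :
    measurableTypeR R :=
  (xy.1 : R) + (xy.2 : R) ^+ 2.

Lemma measurable_add_square : measurable_fun setT add_square.
Proof.
apply: measurable_funD; first exact: measurable_fst.
by apply: measurable_funX; exact: measurable_snd.
Qed.

HB.instance Definition _ :=
  isMeasurableFun.Build _ _ _ _ add_square measurable_add_square.

(* the law of the sum of the squares of [s] independent standard normals *)
Fixpoint chi_squared (s : nat) : probability (measurableTypeR R) R :=
  if s is s'.+1 then
    distribution (chi_squared s' \x normal_prob (0 : R) (1 : R))%E add_square
  else \d_(0 : measurableTypeR R).

End Laws.

(* Main.v *)
(** Write [p] for the stationary law of the split window and [q] for its empirical law.
    The quantity [I(q) - sum q log (info_ratio p)] equals [KL] of the joint laws plus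
    [KL] of the laws of the conditioning block minus the [KL]s of the two pair laws.  It
    is thus at most of order [|q - p|^2], and half of the same combination of chi-square
    divergences up to order [|q - p|^3], while the mean of [|q - p|^2] is of order
    [1/n].

    Under causal influence the plug-in estimator is therefore, up to [o(n^(-1/2))], the
    average of a function of the chain.  Without it the logarithm of [info_ratio p]
    vanishes, and the chi-square combination is a sum of squares of normalized sums over
    an orthonormal basis of the functions of zero conditional mean given each of the two
    variables and the conditioning block; there are [l^k (m^(k+1) - 1) (l - 1)] of them.

    The central limit theorems use no martingales: if [u] solves the heat equation,
    then [u(1 - i/n, S_i / sqrt n)], corrected by solutions of Poisson equations, changes
    in mean by only [O(n^(-3/2))] at each step, so that the mean of [u(0, S_n / sqrt n)]
    tends to [u(1, 0)].  A smoothed step function gives the normal limit, and a Gaussian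
    function gives the Laplace transform of the chi-squared limit, which determines it
    since [1 - (1 - exp(-c y))^M] approximates an indicator. *)

From HB Require Import structures.
Require Import Defs.
From mathcomp Require Import all_boot all_order all_algebra.
From mathcomp Require Import all_classical all_reals all_analysis measurable_realfun.
From mathcomp Require Import ring lra.
Import Order.TTheory GRing.Theory Num.Theory.
Import numFieldNormedType.Exports.

Set Implicit Arguments.
Unset Strict Implicit.
Unset Printing Implicit Defensive.

Local Open Scope classical_set_scope.
Local Open Scope ring_scope.

(** The initial law is arbitrary, so the sample is not stationary: every limit comes from identities
    between means that hold whatever the initial law, with uniformly bounded errors. The Poisson
    equation, solvable because [k] steps lead from any state to any other, therefore carries the
    proof: it yields the [1/n] bound for the mean of [|q - p|^2], the existence of the limiting
    variance and the correctors of the test functions. At each time all random variables are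
    functions of finitely many symbols, so that means are finite sums and conditioning always bears
    on one new symbol.

    Since [{Y_n}] is Markov, the increments of the directed information from time [k] on are the
    conditional mutual informations of the windows at those times. They converge to that of the
    stationary window, which is thus the rate. It vanishes exactly when [Q] is the product of a
    kernel from the past of [Y] to the new letter of [Y] and of its own marginal in the letter of
    [X]. This property of [Q] alone links absence of causal influence, stated under the actual law,
    to a rate defined by a limit. *)

(** * Finite chains *)

Section FiniteFamilies.
Context {R : realType}.

Lemma finite_upper_bound (I : finType) (f : I -> R) :
  exists2 c, 0 < c & forall i, f i <= c.
Proof.
exists (1 + \sum_i `|f i|).
  by rewrite ltr_wpDr// sumr_ge0.
move=> i; rewrite (bigD1 i)//= (le_trans (ler_norm _))//.
by rewrite addrCA lerDl addr_ge0// sumr_ge0.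
Qed.

Lemma finite_lower_bound (I : finType) (f : I -> R) :
  (forall i, 0 < f i) -> exists2 c, 0 < c & forall i, c <= f i.
Proof.
move=> f0; have [c c0 fc] := finite_upper_bound (fun i => (f i)^-1).
exists c^-1; first by rewrite invr_gt0.
by move=> i; rewrite -[leRHS]invrK lef_pV2 ?posrE// invr_gt0.
Qed.

Lemma cvg_sumr (T I : Type) (F : set_system T) (FF : Filter F) (r : seq I)
    (f : I -> T -> R) (l : I -> R) :
  (forall i, f i x @[x --> F] --> l i) ->
  \sum_(i <- r) f i x @[x --> F] --> \sum_(i <- r) l i.
Proof.
move=> fl; elim: r => [|i r IH].
  by under eq_fun do rewrite big_nil; rewrite big_nil; exact: cvg_cst.
under eq_fun do rewrite big_cons; rewrite big_cons.
exact: cvgD.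
Qed.

(** Finite dimension turns uniqueness into existence, which solves the Poisson equation without
    summing a series. Row vectors act on the left, hence the transposed indices in [M]. *)
Lemma kernel_injective_surjective (I : finType) (a : I -> I -> R) :
  (forall f : I -> R, (forall i, \sum_j a i j * f j = 0) -> forall i, f i = 0) ->
  forall h : I -> R, exists g : I -> R, forall i, \sum_j a i j * g j = h i.
Proof.
move=> inj h.
pose M : 'M[R]_(#|I|) := \matrix_(i, j) a (enum_val j) (enum_val i).
have ME (v : 'rV[R]_(#|I|)) i :
    (v *m M) 0 (enum_rank i) = \sum_j a i j * v 0 (enum_rank j).
  rewrite mxE (reindex enum_rank) /=; last exact: onW_bij (@enum_rank_bij I).
  by apply: eq_bigr => j _; rewrite mxE !enum_rankK mulrC.
have Mfree : row_free M.
  apply/inj_row_free => v vM0; apply/rowP => j; rewrite mxE -(enum_valK j).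
  apply: (inj (fun j => v 0 (enum_rank j))) => i.
  by rewrite -ME vM0 mxE.
pose w : 'rV[R]_(#|I|) := \row_j h (enum_val j).
exists (fun i => (w *m invmx M) 0 (enum_rank i)) => i.
rewrite -ME mulmxKV; last by rewrite -row_free_unit.
by rewrite mxE enum_rankK.
Qed.

End FiniteFamilies.

Section Chain.
Context {R : realType} (Z C : finType).
Variables (q : Z -> C -> R) (s : Z -> C -> Z).

(** The drawn symbol [c] is kept apart from the next state [s z c], so that functionals of the whole
    window [(z, c)] can be summed along the chain. *)
Definition transition (f : Z -> R) (z : Z) : R := \sum_c q z c * f (s z c).

Local Notation K := transition.

Definition stationary_mean (nu : Z -> R) (f : Z -> R) : R := \sum_z nu z * f z.

Hypothesis q0 : forall z c, 0 < q z c.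
Hypothesis q1 : forall z, \sum_c q z c = 1.

Lemma eq_transition f g : f =1 g -> K f =1 K g.
Proof. by move=> fg z; apply: eq_bigr => c _; rewrite fg. Qed.

Lemma le_transition f g : (forall z, f z <= g z) -> forall z, K f z <= K g z.
Proof. by move=> fg z; apply: ler_sum => c _; rewrite ler_wpM2l// ltW. Qed.

Lemma transition_cst a z : K (fun=> a) z = a.
Proof. by rewrite /K -mulr_suml q1 mul1r. Qed.

Lemma transitionD f g z : K (fun z => f z + g z) z = K f z + K g z.
Proof. by rewrite -big_split/=; apply: eq_bigr => c _; rewrite mulrDr. Qed.

Lemma transitionZ a f z : K (fun z => a * f z) z = a * K f z.
Proof. by rewrite mulr_sumr; apply: eq_bigr => c _; rewrite mulrCA. Qed.

Lemma transition_sum (I : finType) (F : I -> Z -> R) z :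
  K (fun z => \sum_i F i z) z = \sum_i K (F i) z.
Proof.
by rewrite exchange_big/=; apply: eq_bigr => c _; rewrite mulr_sumr.
Qed.

Lemma eq_iter_transition n f g : f =1 g -> iter n K f =1 iter n K g.
Proof. by move=> fg; elim: n => //= n IH; exact: eq_transition. Qed.

Lemma iter_transitionD n f g z :
  iter n K (fun z => f z + g z) z = iter n K f z + iter n K g z.
Proof.
elim: n z => //= n IH z; rewrite -transitionD; exact: eq_transition.
Qed.

Lemma iter_transitionZ n a f z :
  iter n K (fun z => a * f z) z = a * iter n K f z.
Proof.
elim: n z => //= n IH z; rewrite -transitionZ; exact: eq_transition.
Qed.

Lemma iter_transition_sum n (I : finType) (F : I -> Z -> R) z :
  iter n K (fun z => \sum_i F i z) z = \sum_i iter n K (F i) z.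
Proof.
elim: n z => //= n IH z; rewrite -transition_sum; exact: eq_transition.
Qed.

Lemma iter_transition_cst n a z : iter n K (fun=> a) z = a.
Proof.
elim: n z => //= n IH z; rewrite -[RHS](transition_cst a z).
exact: eq_transition.
Qed.

Lemma iter_transition_bounds n f a b : (forall z, a <= f z <= b) ->
  forall z, a <= iter n K f z <= b.
Proof.
move=> fab; elim: n => //= n IH z; apply/andP; split.
  by rewrite -[leLHS](transition_cst a z); apply: le_transition => y;
    case/andP: (IH y).
by rewrite -[leRHS](transition_cst b z); apply: le_transition => y;
  case/andP: (IH y).
Qed.

(** Only the path [p] is kept among all paths of its length; each of its steps has probability at
    least [e]. *)
Lemma iter_transition_ge_path (e : R) f : 0 <= e -> (forall z c, e <= q z c) ->
  (forall z, 0 <= f z) -> forall (p : seq C) z,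
  e ^+ size p * f (foldl s z p) <= iter (size p) K f z.
Proof.
move=> e0 eq f0; elim=> [|c p IH] z /=; first by rewrite expr0 mul1r.
have K0 n z' : 0 <= iter n K f z'.
  elim: n z' => //= n IHn z'; apply: sumr_ge0 => c' _.
  by rewrite mulr_ge0// ltW.
rewrite /K (bigD1 c)//= exprS -mulrA.
apply: ler_wpDr; first by apply: sumr_ge0 => c' _; rewrite mulr_ge0// ltW.
apply: ler_pM => //.
by rewrite mulr_ge0// exprn_ge0.
Qed.

Variable N : nat.
Hypothesis mix : forall z z', exists2 p : seq C, size p = N & foldl s z p = z'.
Variable z0 : Z.

(** Doeblin's minorization: after [N] steps every state has probability at least [e], wherever the
    chain started. The minimum with 1 only serves the bound [e <= 1]. *)
Lemma iter_transition_lower : exists2 e, 0 < e <= 1 &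
  forall f, (forall z, 0 <= f z) -> forall z z', e * f z' <= iter N K f z.
Proof.
have [e e0 eq] := finite_lower_bound (fun zc : Z * C => q0 zc.1 zc.2).
pose e' := Num.min e 1.
have e'0 : 0 < e' by rewrite lt_min e0/=.
have e'q z c : e' <= q z c.
  by rewrite (le_trans _ (eq (z, c)))// ge_min lexx.
exists (e' ^+ N).
  by rewrite exprn_gt0//= exprn_ile1 ?ge_min ?lexx ?orbT// ltW.
move=> f f0 z z'; have [p <- <-] := mix z z'.
by apply: iter_transition_ge_path => //; exact: ltW.
Qed.

(** If [f z0] is above the midpoint of [[a, b]], the minorization raises the lower bound by
    [e (b - a) / 2]; otherwise it lowers the upper bound as much. Hence the ratio [1 - e / 2]. *)
Lemma iter_transition_contract : exists2 r, 0 <= r < 1 &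
  forall f a b, (forall z, a <= f z <= b) ->
  exists a' b', [/\ a <= a', b' <= b, b' - a' <= r * (b - a) &
    forall z, a' <= iter N K f z <= b'].
Proof.
have [e /andP[e0 e1] He] := iter_transition_lower.
exists (1 - e / 2).
  by apply/andP; split; lra.
move=> f a b fab.
have ab : a <= b by case/andP: (fab z0); exact: le_trans.
have B := iter_transition_bounds N fab.
have [fz0|fz0] := leP ((a + b) / 2) (f z0).
  exists (a + e * ((b - a) / 2)), b; split=> //.
  - by rewrite lerDl mulr_ge0 ?divr_ge0 ?subr_ge0// ltW.
  - by nra.
  - move=> z; case/andP: (B z) => _ ->; rewrite andbT.
    have /(_ _ z z0)/= := He (fun z => f z + - a).
    rewrite iter_transitionD iter_transition_cst => H.
    have {}H : e * (f z0 - a) <= iter N K f z - a.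
      by apply: H => y; rewrite subr_ge0; case/andP: (fab y).
    rewrite addrC -lerBrDr (le_trans _ H)// ler_wpM2l//; lra.
exists a, (b - e * ((b - a) / 2)); split=> //.
- by rewrite gerBl mulr_ge0 ?divr_ge0 ?subr_ge0// ltW.
- by nra.
- move=> z; case/andP: (B z) => -> _ /=.
  have /(_ _ z z0)/= := He (fun z => b + (-1) * f z).
  rewrite iter_transitionD iter_transition_cst iter_transitionZ => H.
  have {}H : e * (b + (-1) * f z0) <= b + (-1) * iter N K f z.
    by apply: H => y; case/andP: (fab y) => ? ?; lra.
  have H' : e * ((b - a) / 2) <= e * (b + (-1) * f z0).
    by rewrite ler_wpM2l//; lra.
  lra.
Qed.

(** After [n] blocks of [N] steps all later iterates, from all states, lie in one interval of length
    [r ^ n * B]. The limit is the supremum of the eventual lower bounds. *)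
Lemma iter_transition_cvg f :
  exists l : R, forall z, (fun n => iter n K f z) @ \oo --> l.
Proof.
have [r /andP[r0 r1] Hr] := iter_transition_contract.
have [c c0 fc] := finite_upper_bound (fun z => `|f z|).
have [B] : exists B, forall n, exists a b, [/\ b - a <= r ^+ n * B &
    forall j z, a <= iter (n * N + j) K f z <= b].
  exists (c - - c) => n.
  suff [a [b [H1 H2]]] : exists a b, b - a <= r ^+ n * (c - - c) /\
      forall z, a <= iter (n * N) K f z <= b.
    exists a, b; split=> // j z; rewrite addnC iterD.
    exact: iter_transition_bounds.
  elim: n => [|n [a [b [H1 H2]]]].
    exists (- c), c; rewrite expr0 mul1r; split=> // z.
    by rewrite mul0n/= -ler_norml.
  have [a' [b' [_ _ H3 H4]]] := Hr _ _ _ H2.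
  exists a', b'; split; last by move=> z; rewrite mulSn iterD.
  by rewrite (le_trans H3)// exprS -mulrA ler_wpM2l.
move=> HB.
pose S := [set x : R | exists n, forall j z, x <= iter (n + j) K f z].
have S0 : S !=set0.
  have [a [b [_ H]]] := HB 0%N; exists a, (0 * N)%N => j z.
  by have /andP[] := H j z.
have Sb n a b : (forall j z, a <= iter (n * N + j) K f z <= b) ->
    ubound S b.
  move=> H x [m Hm].
  have := Hm (n * N)%N z0; rewrite addnC => /le_trans; apply.
  by have /andP[] := H m z0.
exists (sup S) => z.
have Bound n j : `|sup S - iter (n * N + j) K f z| <= r ^+ n * B.
  have [a [b [H1 H2]]] := HB n.
  have supb : sup S <= b by apply: ge_sup => //; exact: Sb H2.
  have asup : a <= sup S.
    apply: ub_le_sup; first by exists b; exact: Sb H2.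
    by exists (n * N)%N => i y; have /andP[] := H2 i y.
  have /andP[h1 h2] := H2 j z.
  by rewrite (le_trans _ H1)// ler_norml; apply/andP; split; lra.
apply/cvgrPdist_le => e e0.
have : (fun n => r ^+ n * B) @ \oo --> 0 * B.
  by apply: cvgMr_tmp; apply: cvg_expr; rewrite ger0_norm.
rewrite mul0r => /cvgrPdist_le/(_ _ e0)[n _ /(_ n (leqnn _))].
rewrite sub0r normrN => Hn.
exists (n * N)%N => // m /= nm.
rewrite -(subnKC nm) (le_trans (Bound n _))//.
exact: le_trans (ler_norm _) Hn.
Qed.

(** [nu] consists of the limits of the iterates of indicators, and invariance follows by shifting
    the index. Positivity comes from integrating the minorization against [nu]. *)
Lemma chain_ergodic : exists nu : Z -> R,
  [/\ forall z, 0 < nu z, \sum_z nu z = 1,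
      forall f, stationary_mean nu (K f) = stationary_mean nu f &
      forall f z, (fun n => iter n K f z) @ \oo --> stationary_mean nu f].
Proof.
pose d (z y : Z) : R := (y == z)%:R.
have [nu Hnu] := choice (fun z => iter_transition_cvg (d z)).
have fE f y : f y = \sum_z f z * d z y.
  rewrite (bigD1 y)//= /d eqxx mulr1 big1 ?addr0// => z.
  by rewrite eq_sym => /negPf ->; rewrite mulr0.
have cvg f z : (fun n => iter n K f z) @ \oo --> stationary_mean nu f.
  have -> : (fun n => iter n K f z) =
      (fun n => \sum_y f y * iter n K (d y) z).
    apply/funext => n; rewrite (eq_iter_transition _ (fE f)).
    rewrite iter_transition_sum; apply: eq_bigr => y _.
    exact: iter_transitionZ.
  have -> : stationary_mean nu f = \sum_y f y * nu y.
    by apply: eq_bigr => y _; rewrite mulrC.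
  apply: cvg_sumr => y; apply: cvgMl_tmp; exact: Hnu.
have inv f : stationary_mean nu (K f) = stationary_mean nu f.
  have := cvg (K f) z0; have := cvg f z0.
  rewrite -cvg_shiftS => H1 H2.
  have E : (fun n => iter n K (K f) z0) = (fun n => iter n.+1 K f z0).
    by apply/funext => n; rewrite iterSr.
  rewrite E in H2.
  by rewrite -(cvg_lim (@Rhausdorff R) H1) -(cvg_lim (@Rhausdorff R) H2).
have nu1 : \sum_z nu z = 1.
  have := cvg (fun=> 1) z0.
  under eq_fun do rewrite iter_transition_cst.
  move=> /(cvg_unique (@norm_hausdorff _ _) (@cvg_cst _ _ _ _ _)) ->.
  by apply: eq_bigr => z _; rewrite mulr1.
exists nu; split=> // z.
have [e /andP[e0 e1] He] := iter_transition_lower.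
apply: lt_le_trans e0 _.
have nuK n : stationary_mean nu (iter n K (d z)) = nu z.
  elim: n => [|n IH] /=; last by rewrite inv.
  rewrite /stationary_mean (bigD1 z)//= /d eqxx mulr1 big1 ?addr0// => y.
  by move=> /negPf ->; rewrite mulr0.
have nu0 y : 0 <= nu y.
  rewrite -(cvg_lim (@Rhausdorff R) (Hnu y z0)).
  apply: limr_ge; first exact: cvgP (Hnu y z0).
  near=> n; suff /andP[] : 0 <= iter n K (d y) z0 <= 1 by [].
  by apply: iter_transition_bounds => x; rewrite /d; case: eqP => _ /=;
    rewrite ?lexx ?ler01.
rewrite -(nuK N) -[leLHS]mul1r -nu1 mulr_suml.
apply: ler_sum => y _; rewrite ler_wpM2l//.
have dzz : d z z = 1 by rewrite /d eqxx.
have := He (d z) _ y z; rewrite dzz mulr1; apply => x.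
by rewrite /d ler0n.
Unshelve. all: by end_near. Qed.

(** [a] is the matrix of [f |-> f - K f + nu(f)]. It is injective: integrating [a f = 0] against
    [nu] gives [nu(f) = 0], then [f = K f], so [f] equals the limit [nu(f)] of its iterates. A
    solution of [a g = h] has [nu(g) = nu(h)], hence solves the Poisson equation. *)
Lemma poisson_equation (nu : Z -> R) : \sum_z nu z = 1 ->
  (forall f, stationary_mean nu (K f) = stationary_mean nu f) ->
  (forall f z, (fun n => iter n K f z) @ \oo --> stationary_mean nu f) ->
  forall h, exists g, forall z, g z - K g z = h z - stationary_mean nu h.
Proof.
move=> nu1 inv cvg h.
pose a z y := (z == y)%:R - \sum_(c | s z c == y) q z c + nu y.
have aE f z : \sum_y a z y * f y = f z - K f z + stationary_mean nu f.
  under eq_bigr do rewrite mulrDl mulrBl.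
  rewrite big_split/= sumrB; congr (_ - _ + _).
    rewrite (bigD1 z)//= eqxx mul1r big1 ?addr0// => y.
    by rewrite eq_sym => /negPf ->; rewrite mul0r.
  under eq_bigr do rewrite mulr_suml.
  rewrite (exchange_big_dep xpredT)//=; apply: eq_bigr => c _.
  by rewrite (big_pred1 (s z c))// => y; rewrite eq_sym.
have meanE g : stationary_mean nu
    (fun z => g z - K g z + stationary_mean nu g) = stationary_mean nu g.
  rewrite /stationary_mean; under eq_bigr do rewrite mulrDr mulrBr.
  rewrite big_split/= sumrB -/(stationary_mean nu g).
  rewrite -/(stationary_mean nu (K g)) inv subrr add0r.
  by rewrite -mulr_suml nu1 mul1r.
have [g Hg] : exists g : Z -> R, forall z, \sum_y a z y * g y = h z.
  apply: kernel_injective_surjective => f.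
  move=> af0; have f0 z : f z - K f z + stationary_mean nu f = 0.
    by rewrite -aE.
  have m0 : stationary_mean nu f = 0.
    rewrite -meanE /stationary_mean big1// => z _.
    by rewrite [X in _ * X]f0 mulr0.
  have fK z : K f z = f z.
    by have := f0 z; rewrite m0 addr0 => /eqP; rewrite subr_eq0 => /eqP.
  move=> z; rewrite -m0.
  have := cvg f z.
  have -> : (fun n => iter n K f z) = (fun=> f z).
    apply/funext => n; elim: n z => //= n IH z.
    by rewrite (eq_transition IH) fK.
  by move=> /(cvg_unique (@norm_hausdorff _ _) (@cvg_cst _ _ _ _ _)).
exists g => z.
have gE z' : h z' = g z' - K g z' + stationary_mean nu g by rewrite -Hg aE.
have -> : stationary_mean nu h = stationary_mean nu g.
  by rewrite -[RHS]meanE; apply: eq_bigr => y _; rewrite gE.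
by rewrite gE addrK.
Qed.

End Chain.

(** * Windows and finite-valued random variables *)

Section Windows.
Context {T : finType} {k : nat}.
Implicit Types (t : k.-tuple T) (c : T).

Definition extend t c : k.+1.-tuple T := [tuple of rcons t c].

Definition shift t c : k.-tuple T := back (extend t c).

Lemma front_extend t c : front (extend t c) = t.
Proof.
apply: eq_from_tnth => j; rewrite tnth_mktuple (tnth_nth c)/=.
by rewrite nth_rcons size_tuple ltn_ord -tnth_nth.
Qed.

Lemma final_extend t c : final (extend t c) = c.
Proof. by rewrite /final (tnth_nth c)/= nth_rcons size_tuple ltnn eqxx. Qed.

Lemma extend_front_final (a : k.+1.-tuple T) : extend (front a) (final a) = a.
Proof.
apply: eq_from_tnth => j; rewrite (tnth_nth (final a))/= nth_rcons.
rewrite (size_tuple (front a)); case: ltngtP => [jk|kj|jk].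
- rewrite -[j in RHS](_ : widen_ord (leqnSn k) (Ordinal jk) = j); last first.
    exact: val_inj.
  by rewrite -(tnth_mktuple (fun i => tnth a (widen_ord (leqnSn k) i)))
    (tnth_nth (final a)).
- by have := ltn_ord j; rewrite ltnS leqNgt kj.
- by rewrite /final; congr tnth; exact: val_inj.
Qed.

Lemma shiftE t c : shift t c = behead (rcons t c) :> seq T.
Proof.
apply: (@eq_from_nth _ c).
  by rewrite size_tuple size_behead size_rcons size_tuple.
rewrite size_tuple => i ik; rewrite nth_behead.
rewrite (_ : i = Ordinal ik)// -tnth_nth tnth_mktuple (tnth_nth c)/=.
by [].
Qed.

Lemma foldl_shiftE t (p : seq T) : foldl shift t p = drop (size p) (t ++ p) :> seq T.
Proof.
elim: p t => [|c p IH] t /=; first by rewrite cats0 drop0.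
rewrite IH shiftE -drop1 -cat_rcons.
by case: (rcons t c) (size_rcons t c) => //= x r _; rewrite drop0.
Qed.

Lemma foldl_shift_full t t' : foldl shift t t' = t'.
Proof.
apply: val_inj; rewrite /= foldl_shiftE size_tuple.
by rewrite -[X in drop X](size_tuple t) drop_size_cat.
Qed.

Lemma block_extend (Omega : Type) (X : nat -> Omega -> T) i w :
  block X i k.+1 w = extend (block X i k w) (X (i + k)%N w).
Proof.
rewrite -[LHS]extend_front_final; congr extend.
- by apply: eq_from_tnth => j; rewrite !tnth_mktuple.
- by rewrite /final tnth_mktuple.
Qed.

Lemma block_shift (Omega : Type) (X : nat -> Omega -> T) i w :
  block X i.+1 k w = shift (block X i k w) (X (i + k)%N w).
Proof.
rewrite /shift -block_extend; apply: eq_from_tnth => j.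
by rewrite !tnth_mktuple lift0 addSnnS.
Qed.

Lemma block_segment (Omega : Type) (X : nat -> Omega -> T) x0 a i m N w :
  (i + m <= N)%N ->
  block X (a + i) m w = segment (nth x0 (block X a N w)) i m.
Proof.
move=> imN; apply: eq_from_tnth => j; rewrite !tnth_mktuple.
have ijN : (i + j < N)%N by apply: leq_trans imN; rewrite ltn_add2l.
rewrite (_ : (i + j)%N = Ordinal ijN :> nat)// -tnth_nth tnth_mktuple.
by rewrite addnA.
Qed.

End Windows.

(** Feeding the [k] letters of the target erases the starting state. The number of steps is the same
    for all pairs, so no period can occur. *)
Lemma shift_mixing (A B : finType) (k : nat)
    (s := fun (z : k.-tuple A * k.-tuple B) (c : A * B) =>
            (shift z.1 c.1, shift z.2 c.2)) z z' :
  exists2 p : seq (A * B), size p = k & foldl s z p = z'.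
Proof.
have foldlE p : forall y, foldl s y p =
    (foldl shift y.1 (unzip1 p), foldl shift y.2 (unzip2 p)).
  by elim: p => [[]//|c p IH] y /=; rewrite IH.
exists (zip z'.1 z'.2); first by rewrite size_zip !size_tuple minnn.
rewrite foldlE unzip1_zip ?unzip2_zip ?size_tuple//.
by rewrite !foldl_shift_full -surjective_pairing.
Qed.

Section FiniteValued.
Context {d : measure_display} {Omega : measurableType d} {R : realType}.
Variable P : probability Omega R.

Definition mean (F : Omega -> R) : R := fine 'E_P[F]%E.

(** Factoring through a finite type, rather than having a finite range, makes the class stable under
    any pointwise operation and its means finite sums. *)
Definition simple_rv (F : Omega -> R) : Prop :=
  exists (U : finType) (V : Omega -> U) (f : U -> R),
    finite_rv V /\ F = f \o V.

Lemma finite_rv_comp (U V : finType) (X : Omega -> U) (f : U -> V) :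
  finite_rv X -> finite_rv (f \o X).
Proof.
move=> mX v.
rewrite (_ : _ @^-1` _ = \bigcup_(u in [set u | f u = v]) (X @^-1` [set u])).
  by apply: fin_bigcup_measurable => // u _; exact: mX.
apply/seteqP; split=> w /=; first by move=> ?; exists (X w).
by case=> u /= <- ->.
Qed.

Lemma finite_rv_pair (U V : finType) (X : Omega -> U) (Y : Omega -> V) :
  finite_rv X -> finite_rv Y -> finite_rv (fun w => (X w, Y w)).
Proof.
move=> mX mY [u v].
rewrite (_ : _ @^-1` _ = (X @^-1` [set u]) `&` (Y @^-1` [set v])).
  exact: measurableI.
by apply/seteqP; split=> w /= => [[-> ->]|[-> ->]].
Qed.

Lemma finite_rv_block (U : finType) (X : nat -> Omega -> U) i m :
  (forall n, finite_rv (X n)) -> finite_rv (block X i m).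
Proof.
move=> mX t.
rewrite (_ : _ @^-1` _ = \bigcap_(j in [set: 'I_m])
    (X (i + j)%N @^-1` [set tnth t j])).
  apply: fin_bigcap_measurable => // j _; exact: mX.
apply/seteqP; split=> w /=; first by move=> <- j _ /=; rewrite tnth_mktuple.
by move=> H; apply: eq_from_tnth => j; rewrite tnth_mktuple; exact: H.
Qed.

Section Pmf.
Context {U : finType} {V : Omega -> U}.
Hypothesis mV : finite_rv V.

Lemma pmf_of_ge0 u : 0 <= pmf_of P V u.
Proof. exact: fine_ge0. Qed.

Lemma pmf_of_fin_num u : P (V @^-1` [set u]) = (pmf_of P V u)%:E.
Proof. by rewrite fineK// fin_num_measure//; exact: mV. Qed.

Lemma comp_indicE (f : U -> R) :
  f \o V = (fun w => \sum_u f u * \1_(V @^-1` [set u]) w).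
Proof.
apply/funext => w /=; rewrite (bigD1 (V w))//= indicE mem_set// mulr1.
rewrite big1 ?addr0// => u /eqP uV.
by rewrite indicE memNset ?mulr0//= => /esym.
Qed.

Lemma integrable_comp (f : U -> R) : P.-integrable setT (EFin \o (f \o V)).
Proof.
rewrite comp_indicE (_ : _ \o _ =
    (fun w => \sum_u (f u)%:E * (\1_(V @^-1` [set u]) w)%:E)%E); last first.
  by apply/funext => w /=; rewrite -sumEFin.
apply: integrable_sum => // u _; apply: integrableZl => //.
apply: integrable_indic; exact: mV.
Qed.

Lemma expectation_comp (f : U -> R) :
  'E_P[f \o V]%E = (\sum_u pmf_of P V u * f u)%:E.
Proof.
rewrite unlock comp_indicE.
rewrite (eq_integral (fun w => \sum_u (f u)%:E * (\1_(V @^-1` [set u]) w)%:E)%E).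
  rewrite integral_sum//; last first.
    by move=> u; apply: integrableZl => //; apply: integrable_indic; exact: mV.
  rewrite -sumEFin; apply: eq_bigr => u _.
  rewrite integralZl//; last by apply: integrable_indic; exact: mV.
  rewrite (integral_indic P measurableT (mV u)) setIT.
  by rewrite EFinM muleC; congr (_ * _)%E; exact: pmf_of_fin_num.
by move=> w _; rewrite -sumEFin.
Qed.

Lemma mean_comp (f : U -> R) : mean (f \o V) = \sum_u pmf_of P V u * f u.
Proof. by rewrite /mean expectation_comp. Qed.

Lemma pmf_of_sum1 : \sum_u pmf_of P V u = 1.
Proof.
have := expectation_comp (fun=> 1).
rewrite (_ : _ \o _ = cst 1)// expectation_cst => -[->].
by apply: eq_bigr => u _; rewrite mulr1.
Qed.

Lemma pmf_of_mean u : pmf_of P V u = mean (fun w => (V w == u)%:R).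
Proof.
have := mean_comp (fun v => (v == u)%:R).
rewrite (_ : _ \o _ = (fun w => (V w == u)%:R))// => ->.
by rewrite (bigD1 u)//= eqxx mulr1 big1 ?addr0// => v /negPf ->; rewrite mulr0.
Qed.


End Pmf.

Lemma pmf_of_comp (U W : finType) (V : Omega -> U) (f : U -> W) :
  finite_rv V ->
  pmf_of P (f \o V) =1 pmf_image (pmf_of P V) f.
Proof.
move=> mV u; rewrite pmf_of_mean; last exact: finite_rv_comp.
rewrite (mean_comp mV (fun t => (f t == u)%:R)) /pmf_image [RHS]big_mkcond/=.
by apply: eq_bigr => t _; case: ifP => _; rewrite ?mulr1 ?mulr0.
Qed.

Lemma simple_map2 (h : R -> R -> R) F G : simple_rv F -> simple_rv G ->
  simple_rv (fun w => h (F w) (G w)).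
Proof.
move=> [U [V [f [mV ->]]]] [U' [V' [f' [mV' ->]]]].
exists (U * U')%type, (fun w => (V w, V' w)), (fun u => h (f u.1) (f' u.2)).
by split; [exact: finite_rv_pair|].
Qed.

Lemma simple_map (h : R -> R) F : simple_rv F -> simple_rv (h \o F).
Proof. by move=> sF; exact: (simple_map2 (fun x _ => h x) sF sF). Qed.

Lemma simple_cst c : simple_rv (fun=> c).
Proof.
exists unit, (fun=> tt), (fun=> c); split=> // u.
by rewrite (_ : _ @^-1` _ = setT)//; apply/seteqP; split=> // w _ /=; case: u.
Qed.

Lemma simpleD F G : simple_rv F -> simple_rv G ->
  simple_rv (fun w => F w + G w).
Proof. exact: simple_map2. Qed.

Lemma simpleM F G : simple_rv F -> simple_rv G ->
  simple_rv (fun w => F w * G w).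
Proof. exact: simple_map2. Qed.

Lemma simpleZ a F : simple_rv F -> simple_rv (fun w => a * F w).
Proof. exact: (@simple_map (fun x => a * x)). Qed.

Lemma simple_sum (I : Type) (r : seq I) (F : I -> Omega -> R) :
  (forall i, simple_rv (F i)) -> simple_rv (fun w => \sum_(i <- r) F i w).
Proof.
move=> sF; elim: r => [|i r IH].
  by under eq_fun do rewrite big_nil; exact: simple_cst.
by under eq_fun do rewrite big_cons; exact: simpleD.
Qed.

Lemma simple_integrable F : simple_rv F -> P.-integrable setT (EFin \o F).
Proof. by move=> [U [V [f [mV ->]]]]; exact: integrable_comp. Qed.

Lemma simple_expectation F : simple_rv F -> 'E_P[F]%E = (mean F)%:E.
Proof.
by move=> [U [V [f [mV ->]]]]; rewrite /mean expectation_comp.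
Qed.

Lemma meanD F G : simple_rv F -> simple_rv G ->
  mean (fun w => F w + G w) = mean F + mean G.
Proof.
move=> sF sG; rewrite /mean unlock.
under eq_integral do rewrite EFinD.
rewrite integralD//; try exact: simple_integrable.
have := simple_expectation sF; have := simple_expectation sG.
by rewrite unlock => -> ->.
Qed.

Lemma meanZ a F : simple_rv F -> mean (fun w => a * F w) = a * mean F.
Proof.
move=> sF; rewrite /mean unlock.
under eq_integral do rewrite EFinM.
rewrite integralZl//; last exact: simple_integrable.
have := simple_expectation sF.
by rewrite unlock => ->.
Qed.

Lemma mean_cst c : mean (fun=> c) = c.
Proof. by rewrite /mean expectation_cst. Qed.

Lemma mean_sum (I : Type) (r : seq I) (F : I -> Omega -> R) :
  (forall i, simple_rv (F i)) ->
  mean (fun w => \sum_(i <- r) F i w) = \sum_(i <- r) mean (F i).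
Proof.
move=> sF; elim: r => [|i r IH].
  by under eq_fun do rewrite big_nil; rewrite mean_cst big_nil.
under eq_fun do rewrite big_cons; rewrite meanD//; last exact: simple_sum.
by rewrite IH big_cons.
Qed.

Lemma le_mean F G : simple_rv F -> simple_rv G ->
  (forall w, F w <= G w) -> mean F <= mean G.
Proof.
move=> sF sG FG; rewrite -lee_fin -!simple_expectation// unlock.
apply: le_integral => //; try exact: simple_integrable.
by move=> w _; rewrite lee_fin.
Qed.

Lemma mean_ge0 F : simple_rv F -> (forall w, 0 <= F w) -> 0 <= mean F.
Proof.
by move=> sF F0; rewrite -(mean_cst 0); apply: le_mean => //; exact: simple_cst.
Qed.

Lemma norm_mean_le F c : simple_rv F -> (forall w, `|F w| <= c) ->
  `|mean F| <= c.
Proof.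
move=> sF Fc; rewrite ler_norml -(mean_cst (- c)) -[X in _ && (_ <= X)](mean_cst c).
apply/andP; split; apply: le_mean => //; try exact: simple_cst.
- by move=> w; have := Fc w; rewrite ler_norml => /andP[].
- by move=> w; have := Fc w; rewrite ler_norml => /andP[].
Qed.

Lemma simple_measurable F : simple_rv F -> measurable_fun setT F.
Proof.
by move=> /simple_integrable/integrableP[/measurable_EFinP].
Qed.

Lemma simple_le_prob F x : simple_rv F ->
  P (F @^-1` `]-oo, x]) = (mean (fun w => (F w <= x)%R%:R))%:E.
Proof.
move=> sF.
have mA : measurable (F @^-1` `]-oo, x]).
  by rewrite -[X in measurable X]setTI; exact: simple_measurable.
rewrite -expectation_indic// -simple_expectation; last first.
  exact: (@simple_map (fun y => (y <= x)%R%:R)).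
congr 'E_P[_]%E; apply/funext => w; rewrite indicE; congr ((nat_of_bool _)%:R).
by apply/idP/idP => [/set_mem|?]; [|apply/mem_set]; rewrite /= in_itv.
Qed.

Lemma simple_variance F : simple_rv F ->
  'V_P[F]%E = (mean (fun w => F w * F w) - mean F * mean F)%:E.
Proof.
move=> sF.
have L G : simple_rv G -> G \in Lfun P 1.
  move=> sG; rewrite inE; apply/Lfun1_integrable; exact: simple_integrable.
rewrite /variance covarianceE ?L//; last exact: simpleM.
have -> : (F * F)%R = (fun w => F w * F w) by [].
by rewrite !simple_expectation//; exact: simpleM.
Qed.

End FiniteValued.

Section Process.
Context {d : measure_display} {Omega : measurableType d} {R : realType}.
Variables (P : probability Omega R) (A B : finType) (k : nat).
Variables (X : nat -> Omega -> A) (Y : nat -> Omega -> B).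
Variable Q : k.-tuple A -> k.-tuple B -> A -> B -> R.
Hypothesis mX : forall n, finite_rv (X n).
Hypothesis mY : forall n, finite_rv (Y n).
Hypothesis PQ : markov_chain_with P Q X Y.

Local Notation Z := (k.-tuple A * k.-tuple B)%type.
Local Notation C := (A * B)%type.

Definition state (n : nat) (w : Omega) : Z := (block X n k w, block Y n k w).

Definition symbol (n : nat) (w : Omega) : C := (X (n + k) w, Y (n + k) w).

Definition step (z : Z) (c : C) : Z := (shift z.1 c.1, shift z.2 c.2).

Definition rate (z : Z) (c : C) : R := Q z.1 z.2 c.1 c.2.

Lemma stateS n w : state n.+1 w = step (state n w) (symbol n w).
Proof. by rewrite /state !block_shift. Qed.

Lemma finite_rv_state n : finite_rv (state n).
Proof. by apply: finite_rv_pair; exact: finite_rv_block. Qed.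

Lemma finite_rv_symbol n : finite_rv (symbol n).
Proof. exact: finite_rv_pair. Qed.

(* measurability with respect to the variables before the index [n + k] *)
Definition adapted (U : Type) (n : nat) (F : Omega -> U) : Prop :=
  forall w w', (forall j, (j < n + k)%N -> X j w = X j w' /\ Y j w = Y j w') ->
  F w = F w'.

Let past n w := (block X 0 (n + k) w, block Y 0 (n + k) w).

Lemma past_eq n w w' : past n w = past n w' ->
  forall j, (j < n + k)%N -> X j w = X j w' /\ Y j w = Y j w'.
Proof.
move=> e j jn; split.
- by have := congr1 (fun t => tnth t.1 (Ordinal jn)) e; rewrite !tnth_mktuple.
- by have := congr1 (fun t => tnth t.2 (Ordinal jn)) e; rewrite !tnth_mktuple.
Qed.

Lemma finite_rv_past n : finite_rv (past n).
Proof. by apply: finite_rv_pair; exact: finite_rv_block. Qed.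

(** [u0] is the value of the factor at past tuples that no outcome realizes. *)
Lemma adapted_factor (U : Type) (u0 : U) n (F : Omega -> U) :
  adapted n F -> exists f, forall w, F w = f (past n w).
Proof.
move=> aF.
have H t : exists u, forall w, past n w = t -> F w = u.
  have [[w0 <-]|no] := pselect (exists w0, past n w0 = t).
    by exists (F w0) => w /past_eq; exact: aF.
  by exists u0 => w wt; case: no; exists w.
have [f Hf] := choice H.
by exists f => w; exact: Hf.
Qed.

Lemma adapted_simple n (F : Omega -> R) : adapted n F -> simple_rv F.
Proof.
move=> /(adapted_factor 0)[f Ff].
exists _, (past n), f; split; first exact: finite_rv_past.
by apply/funext.
Qed.

Lemma adapted_state n : adapted n (state n).
Proof.
move=> w w' H; congr pair; apply: eq_from_tnth => j;
  by rewrite !tnth_mktuple; have [] := H (n + j)%N; rewrite ?ltn_add2l.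
Qed.

Lemma adaptedW (U : Type) n n' (F : Omega -> U) : (n <= n')%N ->
  adapted n F -> adapted n' F.
Proof.
move=> nn aF w w' H; apply: aF => j jn; apply: H.
by rewrite (leq_trans jn)// leq_add2r.
Qed.

Lemma adapted_symbol n : adapted n.+1 (symbol n).
Proof.
by move=> w w' H; have [] := H (n + k)%N; rewrite /symbol ?addSn// => -> ->.
Qed.

Lemma pmf_past_symbol n c t w : past n w = t ->
  pmf_of P (fun w => (symbol n w, past n w)) (c, t) =
  pmf_of P (past n) t * rate (state n w) c.
Proof.
move=> wt.
have mW : finite_rv (fun w => (symbol n w, past n w)).
  by apply: finite_rv_pair; [exact: finite_rv_symbol|exact: finite_rv_past].
(* The Markov hypothesis speaks of deterministic sequences: take the path of [w] up to the present,
   continued by the symbol [c]. *)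
pose x j := if j == (n + k)%N then c.1 else X j w.
pose y j := if j == (n + k)%N then c.2 else Y j w.
have xE i m : (i + m <= n + k)%N -> segment x i m = block X i m w.
  move=> im; apply: eq_from_tnth => j; rewrite !tnth_mktuple /x ifF//.
  by apply/negbTE; rewrite neq_ltn (leq_trans _ im)// ltn_add2l.
have yE i m : (i + m <= n + k)%N -> segment y i m = block Y i m w.
  move=> im; apply: eq_from_tnth => j; rewrite !tnth_mktuple /y ifF//.
  by apply/negbTE; rewrite neq_ltn (leq_trans _ im)// ltn_add2l.
have := @PQ n x y; rewrite /= !xE ?yE ?add0n//.
rewrite /x /y eqxx -/(past n w) wt => H.
have imE : pmf_image (pmf_of P (fun w => (symbol n w, past n w))) snd t =
    pmf_of P (past n) t by rewrite -(pmf_of_comp P snd mW).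
have := pmf_of_ge0 P (V:=past n) t; rewrite le_eqVlt => /orP[/eqP p0|p0].
  (* The Markov hypothesis is silent on pasts of probability zero, but there the joint probability
     is zero as well. *)
  rewrite -p0 mul0r; apply/eqP; rewrite eq_le pmf_of_ge0// andbT.
  rewrite [leRHS]p0 -imE /pmf_image (bigD1 (c, t))//= lerDl sumr_ge0// => *.
  exact: pmf_of_ge0.
have := H p0; rewrite /cond_prob /cond_pmf -/(past n) => E.
rewrite /rate /state -E -/(symbol n).
rewrite (_ : pmf_image _ _ _ = pmf_of P (past n) t); last exact: imE.
by rewrite mulrC divfK ?gt_eqF//; case: (c).
Qed.

(** The Markov property in integrated form: the new symbol is averaged out with the past frozen. It
    stands for conditional expectations throughout. *)
Lemma mean_one_step n (F : Omega -> C -> R) :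
  (forall c, adapted n (F^~ c)) ->
  mean P (fun w => F w (symbol n w)) =
  mean P (fun w => \sum_c rate (state n w) c * F w c).
Proof.
move=> aF.
have mW : finite_rv (fun w => (symbol n w, past n w)).
  by apply: finite_rv_pair; [exact: finite_rv_symbol|exact: finite_rv_past].
have [f Ff] : exists f : _ -> C -> R, forall w c, F w c = f (past n w) c.
  have [f Ff] := choice (fun c => adapted_factor 0 (aF c)).
  by exists (fun t c => f c t).
have aG : adapted n (fun w => \sum_c rate (state n w) c * F w c).
  by move=> w w' H; rewrite (adapted_state H); apply: eq_bigr => c _;
    rewrite (aF c _ _ H).
have [g Gg] := adapted_factor 0 aG.
rewrite (_ : (fun w => F w (symbol n w)) =
  (fun u => f u.2 u.1) \o (fun w => (symbol n w, past n w))); last first.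
  by apply/funext => w /=; rewrite Ff.
rewrite (_ : (fun w => \sum_c _) = g \o past n); last exact/funext.
rewrite !mean_comp//; last exact: finite_rv_past.
rewrite (eq_bigr (fun p => pmf_of P (fun w => (symbol n w, past n w)) (p.1, p.2)
  * f p.2 p.1)); last by case.
rewrite -(pair_bigA _ (fun c t =>
  pmf_of P (fun w => (symbol n w, past n w)) (c, t) * f t c))/=.
rewrite exchange_big/=; apply: eq_bigr => t _.
have [[w wt]|no] := pselect (exists w, past n w = t).
  rewrite -wt -Gg mulr_sumr; apply: eq_bigr => c _.
  by rewrite wt (pmf_past_symbol c wt) Ff wt mulrA.
have p0 : pmf_of P (past n) t = 0.
  rewrite /pmf_of (_ : _ @^-1` _ = set0) ?measure0//.
  by apply/seteqP; split=> // w /= wt; apply: no; exists w.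
rewrite p0 mul0r big1// => c _.
rewrite /pmf_of (_ : _ @^-1` _ = set0) ?measure0 ?mul0r//.
by apply/seteqP; split=> // w /= /(congr1 snd) wt; apply: no; exists w.
Qed.

End Process.

(** * Calculus of functions of finitely many variables *)

Section Derivatives.
Context {R : realType}.
Implicit Types (f g : R -> R) (t a b : R).

Lemma derive_add f g t a b : is_derive t 1 f a -> is_derive t 1 g b ->
  is_derive t 1 (fun t => f t + g t) (a + b).
Proof. exact: is_deriveD. Qed.

Lemma derive_sub f g t a b : is_derive t 1 f a -> is_derive t 1 g b ->
  is_derive t 1 (fun t => f t - g t) (a - b).
Proof. exact: is_deriveB. Qed.

Lemma derive_mul f g t a b : is_derive t 1 f a -> is_derive t 1 g b ->
  is_derive t 1 (fun t => f t * g t) (a * g t + f t * b).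
Proof.
move=> fa gb; have := is_deriveM fa gb; rewrite /GRing.scale/=.
by rewrite addrC [g t * a]mulrC.
Qed.

Lemma derive_cst (c : R) t : is_derive t 1 (fun _ : R => c) 0.
Proof. exact: is_derive_cst. Qed.

Lemma derive_var t : is_derive t 1 (fun t : R => t) 1.
Proof. exact: is_derive_id. Qed.

Lemma derive_scale c f t a : is_derive t 1 f a ->
  is_derive t 1 (fun t => c * f t) (c * a).
Proof.
by move=> fa; have := derive_mul (derive_cst c t) fa; rewrite mul0r add0r.
Qed.

Lemma derive_sum (I : Type) (r : seq I) (f : I -> R -> R) t (a : I -> R) :
  (forall i, is_derive t 1 (f i) (a i)) ->
  is_derive t 1 (fun t => \sum_(i <- r) f i t) (\sum_(i <- r) a i).
Proof.
move=> fa; elim: r => [|i r IH].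
  rewrite big_nil; under eq_fun do rewrite big_nil; exact: derive_cst.
rewrite big_cons; under eq_fun do rewrite big_cons; exact: derive_add.
Qed.

Lemma derive_comp f g t a b : is_derive (g t) 1 f a -> is_derive t 1 g b ->
  is_derive t 1 (fun t => f (g t)) (a * b).
Proof. exact: is_derive1_comp. Qed.

Lemma derive_eq f t a b : is_derive t 1 f a -> a = b -> is_derive t 1 f b.
Proof. by move=> fa <-. Qed.

Lemma mean_value_bound (f df : R -> R) (a b M : R) : a <= b ->
  (forall t, a <= t <= b -> is_derive t 1 f (df t)) ->
  (forall t, a <= t <= b -> `|df t| <= M) -> `|f b - f a| <= M * (b - a).
Proof.
rewrite le_eqVlt => /orP[/eqP <- _ _|ab fd dfM].
  by rewrite !subrr normr0 mulr0.
have [t||t /andP[]] := @MVT _ f df a b ab.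
- by rewrite in_itv/= => /andP[ta tb]; apply: fd; rewrite !ltW.
- apply: derivable_within_continuous => t; rewrite in_itv/= => tr.
  by have [] := fd t tr.
- rewrite !bnd_simp => ta tb ->.
  rewrite normrM (gtr0_norm (x := b - a)) ?subr_gt0//.
  rewrite ler_wpM2r ?subr_ge0 ?(ltW ab)//.
  by apply: dfM; rewrite !ltW.
Qed.

End Derivatives.

Section Taylor.
Context {R : realType}.
Variable I : finType.
Implicit Types (x h : I -> R) (F : (I -> R) -> R).

Definition along x h (t : R) : I -> R := fun i => x i + t * h i.

Lemma along0 x h : along x h 0 = x.
Proof. by apply/funext => i; rewrite /along mul0r addr0. Qed.

(** Differentiability along lines is all that Taylor's formula needs, and it requires no norm on
    [I -> R]. *)
Definition has_gradient (D : (I -> R) -> Prop) F (DF : I -> (I -> R) -> R) :=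
  forall x h t, D (along x h t) ->
    is_derive t 1 (fun t => F (along x h t)) (\sum_i h i * DF i (along x h t)).

Section Bounds.
Variables (D : (I -> R) -> Prop) (B : R).
Hypothesis B0 : 0 <= B.

Let sum_le (h c : I -> R) M : 0 <= M -> (forall i, `|c i| <= M) ->
  `|\sum_i h i * c i| <= (\sum_i `|h i|) * M.
Proof.
move=> M0 cM; rewrite (le_trans (ler_norm_sum _ _ _))// mulr_suml.
by apply: ler_sum => i _; rewrite normrM ler_wpM2l.
Qed.

Lemma taylor1 F DF x h r : has_gradient D F DF ->
  (forall i y, D y -> `|DF i y| <= B) ->
  0 <= r -> (forall t, 0 <= t <= r -> D (along x h t)) ->
  `|F (along x h r) - F x| <= r * ((\sum_i `|h i|) * B).
Proof.
move=> FD DB r0 Dxh.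
rewrite -[in X in _ - X](along0 x h) [leRHS]mulrC.
apply: (le_trans (@mean_value_bound _ (fun t => F (along x h t))
  (fun t => \sum_i h i * DF i (along x h t)) 0 r ((\sum_i `|h i|) * B) r0 _ _)); last by rewrite subr0.
  by move=> t tr; apply: FD; exact: Dxh.
by move=> t tr; apply: sum_le => // i; apply: DB; exact: Dxh.
Qed.

(** The derivative of the remainder along the line is a combination of lower-order remainders of the
    partial derivatives, so the mean value bound raises the order by one; likewise for [taylor3].
    The factorials are given up. *)
Lemma taylor2 F DF D2F x h r : has_gradient D F DF ->
  (forall i, has_gradient D (DF i) (D2F i)) ->
  (forall i j y, D y -> `|D2F i j y| <= B) ->
  0 <= r -> (forall t, 0 <= t <= r -> D (along x h t)) ->
  `|F (along x h r) - F x - r * \sum_i h i * DF i x| <=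
  r ^+ 2 * ((\sum_i `|h i|) ^+ 2 * B).
Proof.
move=> FD FD2 DB r0 Dxh; set H := \sum_i `|_|.
have H0 : 0 <= H by apply: sumr_ge0 => i _.
pose f t := F (along x h t) - F x - t * \sum_i h i * DF i x.
have := @mean_value_bound _ f
  (fun t => \sum_i h i * (DF i (along x h t) - DF i x)) 0 r (H * (r * (H * B))) r0.
rewrite /f along0 subrr mul0r !subr0.
rewrite (_ : H * _ * r = r ^+ 2 * (H ^+ 2 * B)); last by ring.
apply=> t tr.
- have Ft := FD _ _ _ (Dxh _ tr).
  have d1 : is_derive t 1 (fun t => t * (\sum_i h i * DF i x))
      (\sum_i h i * DF i x).
    apply: derive_eq (derive_mul (derive_var _) (derive_cst _ _)) _.
    by rewrite mulr0 addr0 mul1r.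
  apply: derive_eq (derive_sub (derive_sub Ft (derive_cst _ _)) d1) _.
  rewrite subr0 -sumrB.
  by apply: eq_bigr => i _; rewrite mulrBr.
- apply: sum_le; first by rewrite !mulr_ge0.
  move=> i; case/andP: tr => t0 tr.
  apply: le_trans (taylor1 (FD2 i) (DB i) t0 _) _.
    by move=> u /andP[u0 ut]; apply: Dxh; rewrite u0 (le_trans ut).
  by rewrite ler_wpM2r// mulr_ge0.
Qed.

Lemma taylor3 F DF D2F D3F x h r : has_gradient D F DF ->
  (forall i, has_gradient D (DF i) (D2F i)) ->
  (forall i j, has_gradient D (D2F i j) (D3F i j)) ->
  (forall i j l y, D y -> `|D3F i j l y| <= B) ->
  0 <= r -> (forall t, 0 <= t <= r -> D (along x h t)) ->
  `|F (along x h r) - F x - r * (\sum_i h i * DF i x)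
     - r ^+ 2 / 2 * (\sum_i h i * \sum_j h j * D2F i j x)| <=
  r ^+ 3 * ((\sum_i `|h i|) ^+ 3 * B).
Proof.
move=> FD FD2 FD3 DB r0 Dxh; set H := \sum_i `|_|.
have H0 : 0 <= H by apply: sumr_ge0 => i _.
pose f t := F (along x h t) - F x - t * (\sum_i h i * DF i x)
  - t ^+ 2 / 2 * (\sum_i h i * \sum_j h j * D2F i j x).
have := @mean_value_bound _ f
  (fun t => \sum_i h i * (DF i (along x h t) - DF i x
     - t * \sum_j h j * D2F i j x)) 0 r (H * (r ^+ 2 * (H ^+ 2 * B))) r0.
rewrite /f along0 subrr expr0n/= !mul0r !subr0.
rewrite (_ : H * _ * r = r ^+ 3 * (H ^+ 3 * B)); last by ring.
apply=> t tr.
- have Ft := FD _ _ _ (Dxh _ tr).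
  have d1 : is_derive t 1 (fun t => t * (\sum_i h i * DF i x))
      (\sum_i h i * DF i x).
    apply: derive_eq (derive_mul (derive_var _) (derive_cst _ _)) _.
    by rewrite mulr0 addr0 mul1r.
  have d2 (S : R) : is_derive t 1 (fun t => t ^+ 2 / 2 * S) (t * S).
    apply: derive_eq (derive_mul (derive_mul (derive_mul (derive_var _)
      (derive_var _)) (derive_cst _ _)) (derive_cst _ _)) _.
    by rewrite !mulr0 !addr0 mul1r mulr1 -mulr2n -[t *+ 2]mulr_natr mulfK.
  apply: derive_eq (derive_sub (derive_sub (derive_sub Ft (derive_cst _ _)) d1)
    (d2 _)) _.
  rewrite subr0 mulr_sumr -!sumrB.
  by apply: eq_bigr => i _; rewrite !mulrBr mulrCA.
- apply: sum_le; first by rewrite !mulr_ge0// exprn_ge0.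
  move=> i; case/andP: tr => t0 tr.
  apply: le_trans (taylor2 (FD2 i) (FD3 i) (DB i) t0 _) _.
    by move=> u /andP[u0 ut]; apply: Dxh; rewrite u0 (le_trans ut).
  by rewrite ler_wpM2r// ?mulr_ge0 ?exprn_ge0// lerXn2r// nnegrE.
Qed.

End Bounds.
End Taylor.

Section HeatFunction.
Context {R : realType} (J : finType).

(* [t] is the time left until the end of a random walk with covariance [S]; the
   witnesses are the derivatives of [u] in space ([D]) and, after [D1] and [D2], in
   time ([T]), all bounded by [B] *)
Definition heat_function (S : J * J -> R) (u : R -> (J -> R) -> R) : Prop :=
  exists (D1 : J -> R -> (J -> R) -> R) (D2 : J -> J -> R -> (J -> R) -> R)
    (D3 : J -> J -> J -> R -> (J -> R) -> R)
    (T1 : J -> R -> (J -> R) -> R) (T2 : J -> J -> R -> (J -> R) -> R) (B : R),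
  let unit_time t := 0 <= t <= 1 in
  let total (_ : J -> R) := True in
  [/\ 0 <= B,
     forall t, unit_time t ->
       [/\ has_gradient total (u t) (fun j => D1 j t),
           forall j, has_gradient total (D1 j t) (fun l => D2 j l t) &
           forall j l, has_gradient total (D2 j l t) (fun m => D3 j l m t)],
     forall t y, unit_time t ->
       [/\ is_derive t 1 (u ^~ y) (\sum_p S p / 2 * D2 p.1 p.2 t y),
           forall j, is_derive t 1 (D1 j ^~ y) (T1 j t y) &
           forall j l, is_derive t 1 (D2 j l ^~ y) (T2 j l t y)] &
     forall t y, unit_time t -> forall j l m,
       [/\ `|D1 j t y| <= B, `|D2 j l t y| <= B, `|D3 j l m t y| <= B,
           `|T1 j t y| <= B & `|T2 j l t y| <= B]].

End HeatFunction.

Section PerturbedTestFunction.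
Context {R : realType} (Z C J : finType).
Variables (q : Z -> C -> R) (s : Z -> C -> Z).
Hypothesis q0 : forall z c, 0 < q z c.
Hypothesis q1 : forall z, \sum_c q z c = 1.
Variables (phi : J -> Z -> C -> R) (S : J * J -> R).
Variables (g : J -> Z -> R) (G : J * J -> Z -> R).
(** The left-hand sides collect what one step puts in front of [D1] at order [r] and of [D2] at
    order [r ^ 2]. The step moves [y] by [r * phi] inside [u] and inside the [g] term, whence the
    product of [g] at the new state and [phi]. *)
Hypothesis gP : forall j z, \sum_c q z c * (phi j z c + g j (s z c)) = g j z.
Hypothesis GP : forall p z, \sum_c q z c *
  (phi p.1 z c * phi p.2 z c / 2 + g p.1 (s z c) * phi p.2 z c + G p (s z c)) =
  G p z + S p / 2.
Variables (u : R -> (J -> R) -> R).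
Variables (D1 : J -> R -> (J -> R) -> R) (D2 : J -> J -> R -> (J -> R) -> R).

(* The correctors [g] and [G], solutions of Poisson equations, replace the
   state-dependent drift and covariance by 0 and [S] up to an error of order [r ^ 3]. *)
Definition perturbed (r t : R) (z : Z) (y : J -> R) : R :=
  u t y + r * (\sum_j g j z * D1 j t y)
        + r ^+ 2 * (\sum_p G p z * D2 p.1 p.2 t y).

Lemma average_sum (I : finType) (a : C -> I -> R) (D : I -> R) z :
  \sum_c q z c * (\sum_i a c i * D i) = \sum_i (\sum_c q z c * a c i) * D i.
Proof.
under eq_bigr do rewrite mulr_sumr.
rewrite exchange_big/=; apply: eq_bigr => i _; rewrite mulr_suml.
by apply: eq_bigr => c _; rewrite mulrA.
Qed.

Lemma average_le (a : C -> R) M z : (forall c, `|a c| <= M) ->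
  `|\sum_c q z c * a c| <= M.
Proof.
move=> aM; rewrite (le_trans (ler_norm_sum _ _ _))//.
rewrite -[leRHS]mul1r -(q1 z) mulr_suml; apply: ler_sum => c _.
by rewrite normrM gtr0_norm// ler_wpM2l// ltW.
Qed.

(** The averaged second-order expansion exceeds the old value by [r ^ 2] times the heat operator
    applied to [u]. By the heat equation this is the effect of having [r ^ 2] more time left. *)
Lemma average_perturbed_main r t z y :
  \sum_c q z c *
    (u t y + r * (\sum_j (phi j z c + g j (s z c)) * D1 j t y)
     + r ^+ 2 * (\sum_p (phi p.1 z c * phi p.2 z c / 2 +
         g p.1 (s z c) * phi p.2 z c + G p (s z c)) * D2 p.1 p.2 t y)) =
  perturbed r t z y + r ^+ 2 * \sum_p S p / 2 * D2 p.1 p.2 t y.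
Proof.
under eq_bigr do rewrite !mulrDr.
rewrite !big_split/= -mulr_suml q1 mul1r /perturbed -!addrA; congr (_ + _).
under eq_bigr do rewrite mulrCA.
rewrite -mulr_sumr average_sum/=; under eq_bigr do rewrite gP.
congr (_ + _).
under eq_bigr do rewrite mulrCA.
rewrite -mulr_sumr average_sum/=; under eq_bigr do rewrite GP mulrDl.
by rewrite big_split/= mulrDr.
Qed.

End PerturbedTestFunction.

Section GeneratorBound.
Context {R : realType} (Z C J : finType).
Variables (q : Z -> C -> R) (s : Z -> C -> Z).
Hypothesis q0 : forall z c, 0 < q z c.
Hypothesis q1 : forall z, \sum_c q z c = 1.
Variables (phi : J -> Z -> C -> R) (S : J * J -> R).
Variables (g : J -> Z -> R) (G : J * J -> Z -> R).
Hypothesis gP : forall j z, \sum_c q z c * (phi j z c + g j (s z c)) = g j z.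
Hypothesis GP : forall p z, \sum_c q z c *
  (phi p.1 z c * phi p.2 z c / 2 + g p.1 (s z c) * phi p.2 z c + G p (s z c)) =
  G p z + S p / 2.

Lemma norm_sum_le (I : finType) (a b : I -> R) M N : 
  (forall i, `|a i| <= M) -> (forall i, `|b i| <= N) ->
  `|\sum_i a i * b i| <= #|I|%:R * (M * N).
Proof.
move=> aM bN; rewrite (le_trans (ler_norm_sum _ _ _))//.
rewrite mulr_natl -sumr_const; apply: ler_sum => i _.
by rewrite normrM ler_pM.
Qed.

(** A step of size [r] that uses up the time [r ^ 2] preserves the mean of the perturbed function up
    to [r ^ 3]. The other bound lets [u] replace it at both ends of the walk. *)
Lemma perturbed_generator_bound u : heat_function S u ->
  exists (D1 : J -> R -> (J -> R) -> R) (D2 : J -> J -> R -> (J -> R) -> R) (K : R),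
  [/\ 0 <= K,
    (forall r t z y, 0 <= r <= 1 -> 0 <= t <= 1 ->
       `|perturbed g G u D1 D2 r t z y - u t y| <= K * r) &
    (forall r t z y, 0 <= r -> 0 <= t -> t + r ^+ 2 <= 1 ->
    `|\sum_c q z c * perturbed g G u D1 D2 r t (s z c)
        (along y (fun j => phi j z c) r)
      - perturbed g G u D1 D2 r (t + r ^+ 2) z y| <= K * r ^+ 3)].
Proof.
move=> [D1 [D2 [D3 [T1 [T2 [B [B0 grad time bnd]]]]]]].
have [L L0 phiL] := finite_upper_bound (fun zc : Z * C => \sum_j `|phi j zc.1 zc.2|).
have [Mg Mg0 gM] := finite_upper_bound (fun jz : J * Z => `|g jz.1 jz.2|).
have [MG MG0 GM] := finite_upper_bound (fun pz : (J * J) * Z => `|G pz.1 pz.2|).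
have [MS MS0 SM] := finite_upper_bound (fun p : J * J => `|S p / 2|).
pose nJ : R := #|J|%:R; pose nJJ : R := #|{: J * J}|%:R.
have nJ0 : 0 <= nJ by rewrite ler0n.
have nJJ0 : 0 <= nJJ by rewrite ler0n.
pose K1 := nJ * (Mg * B) + nJJ * (MG * B).
pose K2 := L ^+ 3 * B + nJ * (Mg * (L ^+ 2 * B)) + nJJ * (MG * (L * B))
  + nJJ * (MS * B) + nJ * (Mg * B) + nJJ * (MG * B).
have K10 : 0 <= K1 by rewrite addr_ge0 ?mulr_ge0// ltW.
have K20 : 0 <= K2 by rewrite !addr_ge0 ?mulr_ge0 ?exprn_ge0// ltW.
exists D1, D2, (K1 + K2); split; first exact: addr_ge0.
  move=> r t z y /andP[r0 r1] t01.
  rewrite /perturbed [X in `|X|](_ : _ = r * (\sum_j g j z * D1 j t y) +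
    r ^+ 2 * (\sum_p G p z * D2 p.1 p.2 t y)); last by ring.
  rewrite (le_trans (ler_normD _ _))// mulrDl ler_wpDr ?mulr_ge0// /K1 mulrDl.
  apply: lerD; rewrite normrM ger0_norm ?exprn_ge0//.
    rewrite mulrC ler_wpM2r//; apply: norm_sum_le => j; first exact: gM (j, z).
    by have [] := bnd t y t01 j j j.
  apply: (@le_trans _ _ (r * (nJJ * (MG * B)))); last by rewrite mulrC.
  apply: ler_pM; rewrite ?exprn_ge0//.
    by rewrite expr2 ler_piMl.
  apply: norm_sum_le => p; first exact: GM (p, z).
  by have [] := bnd t y t01 p.1 p.2 p.2.
move=> r t z y r0 t0 tr1.
have t01 : 0 <= t <= 1 by rewrite t0 (le_trans _ tr1)// lerDl exprn_ge0.
have tr01 : 0 <= t + r ^+ 2 <= 1 by rewrite tr1 addr_ge0 ?exprn_ge0.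
have trt : t <= t + r ^+ 2 by rewrite lerDl exprn_ge0.
have tin v : t <= v <= t + r ^+ 2 -> 0 <= v <= 1.
  by move=> /andP[tv vt]; rewrite (le_trans t0 tv) (le_trans vt tr1).
have [G1 G2 G3] := grad t t01.
pose h c j := phi j z c.
have hL c : \sum_j `|h c j| <= L by exact: phiL (z, c).
have h0 c : 0 <= \sum_j `|h c j| by apply: sumr_ge0.
(* [e1], [e2], [e3] are spatial remainders of orders 3, 2, 1, weighted by 1, [r], [r ^ 2]. The
   remainders [e4], [e5], [e6] come from the change [r ^ 2] of time: [e4] is of order [r ^ 4], the
   others of order [r ^ 2] with weights [r] and [r ^ 2]. *)
pose e1 c := u t (along y (h c) r) - (u t y + r * (\sum_j h c j * D1 j t y) +
  r ^+ 2 / 2 * (\sum_p h c p.1 * h c p.2 * D2 p.1 p.2 t y)).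
pose e2 c j := D1 j t (along y (h c) r) -
  (D1 j t y + r * (\sum_l h c l * D2 j l t y)).
pose e3 c p := D2 p.1 p.2 t (along y (h c) r) - D2 p.1 p.2 t y.
pose e4 := u (t + r ^+ 2) y - (u t y + r ^+ 2 * \sum_p S p / 2 * D2 p.1 p.2 t y).
pose e5 j := D1 j (t + r ^+ 2) y - D1 j t y.
pose e6 p := D2 p.1 p.2 (t + r ^+ 2) y - D2 p.1 p.2 t y.
have E1 c : `|e1 c| <= r ^+ 3 * (L ^+ 3 * B).
  have := taylor3 B0 (x := y) (h := h c) G1 G2 G3
    (fun i j l x _ => let: And5 _ _ H _ _ := bnd t x t01 i j l in H) r0
    (fun _ _ => I).
  rewrite (_ : \sum_i h c i * \sum_j h c j * D2 i j t y =
      \sum_p h c p.1 * h c p.2 * D2 p.1 p.2 t y); last first.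
    rewrite -(pair_bigA _ (fun i j => h c i * h c j * D2 i j t y))/=.
    by apply: eq_bigr => i _; rewrite mulr_sumr; apply: eq_bigr => j _; rewrite mulrA.
  rewrite /e1 !opprD !addrA => /le_trans; apply.
  rewrite ler_wpM2l ?exprn_ge0// ler_wpM2r// lerXn2r// nnegrE//.
  exact: ltW.
have E2 c j : `|e2 c j| <= r ^+ 2 * (L ^+ 2 * B).
  have := taylor2 B0 (x := y) (h := h c) (G2 j) (G3 j)
    (fun i l x _ => let: And5 _ _ H _ _ := bnd t x t01 j i l in H) r0
    (fun _ _ => I).
  rewrite /e2 !opprD !addrA => /le_trans; apply.
  rewrite ler_wpM2l ?exprn_ge0// ler_wpM2r// lerXn2r// nnegrE//.
  exact: ltW.
have E3 c p : `|e3 c p| <= r * (L * B).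
  have := taylor1 B0 (x := y) (h := h c) (G3 p.1 p.2)
    (fun i x _ => let: And5 _ _ H _ _ := bnd t x t01 p.1 p.2 i in H) r0
    (fun _ _ => I).
  by move=> /le_trans; apply; rewrite ler_wpM2l// ler_wpM2r.
have E5 j : `|e5 j| <= r ^+ 2 * B.
  have := @mean_value_bound _ (D1 j ^~ y) (T1 j ^~ y) _ _ B trt
    (fun v vt => let: And3 _ H _ := time v y (tin v vt) in H j)
    (fun v vt => let: And5 _ _ _ H _ := bnd v y (tin v vt) j j j in H).
  by rewrite [t + _ - t]addrC addKr mulrC.
have E6' v p : t <= v <= t + r ^+ 2 -> `|D2 p.1 p.2 v y - D2 p.1 p.2 t y| <= r ^+ 2 * B.
  move=> /andP[tv vt].
  have tin' w : t <= w <= v -> 0 <= w <= 1.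
    by move=> /andP[tw wv]; apply: tin; rewrite tw (le_trans wv).
  have := @mean_value_bound _ (D2 p.1 p.2 ^~ y) (T2 p.1 p.2 ^~ y) _ _ B tv
    (fun w wt => let: And3 _ _ H := time w y (tin' w wt) in H p.1 p.2)
    (fun w wt => let: And5 _ _ _ _ H := bnd w y (tin' w wt) p.1 p.2 p.2 in H).
  by move=> /le_trans; apply; rewrite mulrC ler_wpM2r// lerBlDl.
have E6 p : `|e6 p| <= r ^+ 2 * B by apply: E6'; rewrite trt lexx.
have E4 : `|e4| <= r ^+ 4 * (nJJ * (MS * B)).
  pose f v := u v y - v * \sum_p S p / 2 * D2 p.1 p.2 t y.
  have := @mean_value_bound _ f (fun v => \sum_p S p / 2 *
    (D2 p.1 p.2 v y - D2 p.1 p.2 t y)) t (t + r ^+ 2)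
    (nJJ * (MS * (r ^+ 2 * B))) trt.
  rewrite /f [t + _ - t]addrC addKr (_ : _ - _ = e4); last by rewrite /e4; ring.
  rewrite (_ : nJJ * _ * _ = r ^+ 4 * (nJJ * (MS * B))); last by ring.
  apply=> v vt.
    have [H _ _] := time v y (tin v vt).
    apply: derive_eq (derive_sub H (derive_mul (derive_var _) (derive_cst _ _))) _.
    by rewrite mul1r mulr0 addr0 -sumrB; apply: eq_bigr => p _; rewrite mulrBr.
  by apply: norm_sum_le => // p; exact: E6'.
have -> : \sum_c q z c * perturbed g G u D1 D2 r t (s z c)
        (along y (fun j => phi j z c) r) =
    perturbed g G u D1 D2 r t z y + r ^+ 2 * \sum_p S p / 2 * D2 p.1 p.2 t y +
    \sum_c q z c * (e1 c + r * (\sum_j g j (s z c) * e2 c j) +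
      r ^+ 2 * \sum_p G p (s z c) * e3 c p).
  rewrite -(average_perturbed_main q1 gP GP) -big_split/=.
  apply: eq_bigr => c _; rewrite -mulrDr; congr (_ * _).
  rewrite /perturbed -/(h c).
  have -> : u t (along y (h c) r) = u t y + r * (\sum_j h c j * D1 j t y) +
     r ^+ 2 / 2 * (\sum_p h c p.1 * h c p.2 * D2 p.1 p.2 t y) + e1 c.
    by rewrite /e1; ring.
  have -> : \sum_j g j (s z c) * D1 j t (along y (h c) r) =
      \sum_j g j (s z c) * D1 j t y
      + r * (\sum_p g p.1 (s z c) * h c p.2 * D2 p.1 p.2 t y)
      + \sum_j g j (s z c) * e2 c j.
    rewrite -(pair_bigA _ (fun i j => g i (s z c) * h c j * D2 i j t y))/=.
    rewrite mulr_sumr -!big_split/=; apply: eq_bigr => j _.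
    have -> : \sum_l g j (s z c) * h c l * D2 j l t y =
       g j (s z c) * \sum_l h c l * D2 j l t y.
      by rewrite mulr_sumr; apply: eq_bigr => l _; rewrite mulrA.
    by rewrite /e2; ring.
  have -> : \sum_p G p (s z c) * D2 p.1 p.2 t (along y (h c) r) =
      \sum_p G p (s z c) * D2 p.1 p.2 t y + \sum_p G p (s z c) * e3 c p.
    by rewrite -big_split/=; apply: eq_bigr => p _; rewrite /e3; ring.
  have -> : \sum_j (phi j z c + g j (s z c)) * D1 j t y =
      \sum_j h c j * D1 j t y + \sum_j g j (s z c) * D1 j t y.
    by rewrite -big_split/=; apply: eq_bigr => j _; rewrite /h; ring.
  have -> : \sum_p (phi p.1 z c * phi p.2 z c / 2 + g p.1 (s z c) * phi p.2 z c
        + G p (s z c)) * D2 p.1 p.2 t y =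
      2^-1 * (\sum_p h c p.1 * h c p.2 * D2 p.1 p.2 t y) +
      \sum_p g p.1 (s z c) * h c p.2 * D2 p.1 p.2 t y +
      \sum_p G p (s z c) * D2 p.1 p.2 t y.
    rewrite mulr_sumr -!big_split/=; apply: eq_bigr => p _; rewrite /h; ring.
  by ring.
have -> : perturbed g G u D1 D2 r (t + r ^+ 2) z y =
    perturbed g G u D1 D2 r t z y + r ^+ 2 * \sum_p S p / 2 * D2 p.1 p.2 t y +
    (e4 + r * (\sum_j g j z * e5 j) + r ^+ 2 * \sum_p G p z * e6 p).
  rewrite /perturbed.
  have -> : \sum_j g j z * D1 j (t + r ^+ 2) y =
     \sum_j g j z * D1 j t y + \sum_j g j z * e5 j.
    by rewrite -big_split/=; apply: eq_bigr => j _; rewrite /e5; ring.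
  have -> : \sum_p G p z * D2 p.1 p.2 (t + r ^+ 2) y =
     \sum_p G p z * D2 p.1 p.2 t y + \sum_p G p z * e6 p.
    by rewrite -big_split/=; apply: eq_bigr => p _; rewrite /e6; ring.
  by rewrite /e4; ring.
rewrite [X in `|X|](_ : _ = \sum_c q z c * (e1 c + r * (\sum_j g j (s z c) * e2 c j) +
      r ^+ 2 * \sum_p G p (s z c) * e3 c p) -
   (e4 + r * (\sum_j g j z * e5 j) + r ^+ 2 * \sum_p G p z * e6 p)); last by ring.
(* This lets the terms of order [r ^ 4] be absorbed by [r ^ 3]. *)
have r1 : r <= 1.
  rewrite -(@ler_pXn2r _ 2%N) ?nnegrE// expr1n.
  by rewrite (le_trans _ tr1)// lerDr.
have B1 : `|\sum_c q z c * (e1 c + r * (\sum_j g j (s z c) * e2 c j) +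
      r ^+ 2 * \sum_p G p (s z c) * e3 c p)| <=
   r ^+ 3 * (L ^+ 3 * B) + r * (nJ * (Mg * (r ^+ 2 * (L ^+ 2 * B)))) +
   r ^+ 2 * (nJJ * (MG * (r * (L * B)))).
  apply: average_le => // c.
  rewrite (le_trans (ler_normD _ _))// lerD//.
    rewrite (le_trans (ler_normD _ _))// lerD//.
    rewrite normrM (ger0_norm r0) ler_wpM2l//.
    by apply: norm_sum_le => // j; exact: gM (j, s z c).
  rewrite normrM ger0_norm ?exprn_ge0// ler_wpM2l ?exprn_ge0//.
  by apply: norm_sum_le => // p; exact: GM (p, s z c).
have B2 : `|e4 + r * (\sum_j g j z * e5 j) + r ^+ 2 * \sum_p G p z * e6 p| <=
   r ^+ 4 * (nJJ * (MS * B)) + r * (nJ * (Mg * (r ^+ 2 * B))) +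
   r ^+ 2 * (nJJ * (MG * (r ^+ 2 * B))).
  rewrite (le_trans (ler_normD _ _))// lerD//.
    rewrite (le_trans (ler_normD _ _))// lerD//.
    rewrite normrM (ger0_norm r0) ler_wpM2l//.
    by apply: norm_sum_le => // j; exact: gM (j, z).
  rewrite normrM ger0_norm ?exprn_ge0// ler_wpM2l ?exprn_ge0//.
  by apply: norm_sum_le => // p; exact: GM (p, z).
have r43 : r ^+ 4 <= r ^+ 3 by rewrite exprS ler_piMl// exprn_ge0.
have {}B2 : `|e4 + r * (\sum_j g j z * e5 j) + r ^+ 2 * \sum_p G p z * e6 p| <=
   r ^+ 3 * (nJJ * (MS * B)) + r ^+ 3 * (nJ * (Mg * B)) +
   r ^+ 3 * (nJJ * (MG * B)).
  rewrite (le_trans B2)//.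
  have c1 : 0 <= nJJ * (MS * B) by rewrite !mulr_ge0// ltW.
  have c2 : 0 <= nJJ * (MG * B) by rewrite !mulr_ge0// ltW.
  apply: lerD; first apply: lerD.
  - by rewrite ler_wpM2r.
  - by rewrite le_eqVlt; apply/orP; left; apply/eqP; ring.
  - by rewrite (_ : r ^+ 2 * _ = r ^+ 4 * (nJJ * (MG * B))) ?ler_wpM2r//; ring.
rewrite (le_trans (ler_normB _ _))// (le_trans (lerD B1 B2))//.
apply: (@le_trans _ _ (K2 * r ^+ 3)); last by rewrite ler_wpM2r ?exprn_ge0// lerDr.
by rewrite le_eqVlt /K2; apply/orP; left; apply/eqP; ring.
Qed.

End GeneratorBound.

(** * Limit theorems by perturbed test functions *)

Lemma cvg_of_sqrt_bound (R : realType) (a : nat -> R) (l K : R) : 0 <= K ->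
  (forall n, (0 < n)%N -> `|a n - l| <= K * (Num.sqrt n%:R)^-1) ->
  a @ \oo --> l.
Proof.
move=> K0 bound; apply/cvgrPdist_le => e e0.
have [N NE] : exists N : nat, (K / e) ^+ 2 <= N%:R.
  exists (Num.truncn ((K / e) ^+ 2)).+1.
  by rewrite ltW// truncnS_gt.
near=> n.
rewrite distrC (le_trans (bound n _))//; first by near: n; exact: nbhs_infty_gt.
have n0 : 0 < (n%:R : R) by rewrite ltr0n; near: n; exact: nbhs_infty_gt.
rewrite ler_pdivrMr ?sqrtr_gt0// -ler_pdivrMl//.
rewrite -(@ler_pXn2r _ 2%N) ?nnegrE ?sqrtr_ge0//; last first.
  by rewrite !mulr_ge0// ?invr_ge0 ltW.
rewrite sqr_sqrtr; last exact: ltW.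
rewrite [e^-1 * _]mulrC; apply: le_trans NE _; rewrite ler_nat.
by near: n; exact: nbhs_infty_ge.
Unshelve. all: by end_near. Qed.

Section LimitTheorems.
Context {d : measure_display} {Omega : measurableType d} {R : realType}.
Variables (P : probability Omega R) (A B : finType) (k : nat).
Variables (X : nat -> Omega -> A) (Y : nat -> Omega -> B).
Variable Q : k.-tuple A -> k.-tuple B -> A -> B -> R.
Hypothesis mX : forall n, finite_rv (X n).
Hypothesis mY : forall n, finite_rv (Y n).
Hypothesis PQ : markov_chain_with P Q X Y.
Hypothesis Qpos : positive_transition_matrix Q.

Local Notation Z := (k.-tuple A * k.-tuple B)%type.
Local Notation C := (A * B)%type.
Local Notation q := (rate Q).
Local Notation s := (@step A B k).
Local Notation st := (state k X Y).
Local Notation sy := (symbol k X Y).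

Lemma rate_gt0 z c : 0 < q z c.
Proof. by case: Qpos => Q0 _; exact: Q0. Qed.

Lemma rate_sum1 z : \sum_c q z c = 1.
Proof.
case: Qpos => _ /(_ z.1 z.2); rewrite (pair_bigA _ (fun a b => Q z.1 z.2 a b)).
by [].
Qed.

Lemma mean_dist_le F G c : simple_rv F -> simple_rv G ->
  (forall w, `|F w - G w| <= c) -> `|mean P F - mean P G| <= c.
Proof.
move=> sF sG FG.
have -> : mean P F - mean P G = mean P (fun w => F w + (-1) * G w).
  by rewrite meanD// ?meanZ ?mulN1r//; exact: simpleZ.
apply: norm_mean_le => [|w]; first by apply: simpleD => //; exact: simpleZ.
by rewrite mulN1r.
Qed.

Definition partial_sum (psi : Z -> C -> R) (n : nat) (w : Omega) : R :=
  \sum_(i < n) psi (st i w) (sy i w).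

Lemma partial_sumS psi n w :
  partial_sum psi n.+1 w = partial_sum psi n w + psi (st n w) (sy n w).
Proof. by rewrite /partial_sum big_ord_recr. Qed.

Lemma adapted_partial_sum psi n : adapted k X Y n (partial_sum psi n).
Proof.
move=> w w' H; apply: eq_bigr => i _.
rewrite (adaptedW (ltnW (ltn_ord i)) (adapted_state (n := i)) H).
by rewrite (adaptedW (ltn_ord i) (adapted_symbol (n := i)) H).
Qed.

Lemma adapted_functional (U J : Type) (phi : J -> Z -> C -> R)
    (f : Z -> (J -> R) -> U) n :
  adapted k X Y n (fun w => f (st n w) (fun j => partial_sum (phi j) n w)).
Proof.
move=> w w' H; rewrite (adapted_state H); congr (f _ _).
by apply/funext => j; exact: adapted_partial_sum.
Qed.

Lemma simple_functional (J : Type) (phi : J -> Z -> C -> R)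
    (f : Z -> (J -> R) -> R) n :
  simple_rv (fun w => f (st n w) (fun j => partial_sum (phi j) n w)).
Proof. by apply: (adapted_simple mX mY (n := n)); exact: adapted_functional. Qed.

Lemma mean_functionalS (J : Type) (phi : J -> Z -> C -> R)
    (f : Z -> (J -> R) -> R) n :
  mean P (fun w => f (st n.+1 w) (fun j => partial_sum (phi j) n.+1 w)) =
  mean P (fun w => \sum_c q (st n w) c *
    f (s (st n w) c) (fun j => partial_sum (phi j) n w + phi j (st n w) c)).
Proof.
rewrite -(mean_one_step mX mY PQ (F := fun w c => f (s (st n w) c)
  (fun j => partial_sum (phi j) n w + phi j (st n w) c))).
  congr mean; apply/funext => w; rewrite stateS; congr (f _ _).
  by apply/funext => j; rewrite partial_sumS.
move=> c; exact: (@adapted_functional _ J phi (fun z y => f (s z c)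
  (fun j => y j + phi j z c))).
Qed.

Lemma functional_clt (J : finType) (phi : J -> Z -> C -> R) (S : J * J -> R)
    (g : J -> Z -> R) (G : J * J -> Z -> R) (u : R -> (J -> R) -> R)
    (y0 : J -> R) :
  (forall j z, \sum_c q z c * (phi j z c + g j (s z c)) = g j z) ->
  (forall p z, \sum_c q z c * (phi p.1 z c * phi p.2 z c / 2 +
     g p.1 (s z c) * phi p.2 z c + G p (s z c)) = G p z + S p / 2) ->
  heat_function S u ->
  (fun n => mean P (fun w =>
    u 0 (along y0 (fun j => partial_sum (phi j) n w) (Num.sqrt n%:R)^-1)))
    @ \oo --> u 1 y0.
Proof.
move=> gP GP hu.
have [D1 [D2 [K [K0 K1 K2]]]] :=
  perturbed_generator_bound rate_gt0 rate_sum1 gP GP hu.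
pose r n : R := (Num.sqrt n%:R)^-1.
have rn n : (0 < n)%N -> r n ^+ 2 = n%:R^-1.
  by move=> n0; rewrite /r exprVn sqr_sqrtr.
have r0 n : 0 <= r n by rewrite invr_ge0 sqrtr_ge0.
have r1 n : (0 < n)%N -> r n <= 1.
  move=> n0; rewrite -(@ler_pXn2r _ 2%N) ?nnegrE// expr1n rn//.
  by rewrite invf_le1 ?ltr0n// ler1n.
(* One [K * r n] is the sum of [n] one-step errors [K * r n ^ 3]; the other two remove the
   correctors at times 0 and [n]. *)
have bound n : (0 < n)%N -> `|mean P (fun w =>
    u 0 (along y0 (fun j => partial_sum (phi j) n w) (r n))) - u 1 y0| <= 3 * K * r n.
  move=> n0.
  pose f i (z : Z) (y : J -> R) := perturbed g G u D1 D2 (r n)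
    (1 - i%:R * r n ^+ 2) z (along y0 y (r n)).
  pose a i := mean P (fun w => f i (st i w) (fun j => partial_sum (phi j) i w)).
  have iin i : (i <= n)%N -> 0 <= 1 - i%:R * r n ^+ 2 <= 1.
    move=> ni; rewrite rn// subr_ge0 ler_pdivrMr ?ltr0n// mul1r ler_nat ni/=.
    by rewrite gerBl divr_ge0.
  have sf i : simple_rv (fun w => f i (st i w) (fun j => partial_sum (phi j) i w)).
    exact: simple_functional.
  have aS i : (i < n)%N -> `|a i.+1 - a i| <= K * r n ^+ 3.
    move=> ni; rewrite /a mean_functionalS; apply: mean_dist_le => //.
      apply: (simple_functional phi (fun z y => \sum_c q z c *
        f i.+1 (s z c) (fun j => y j + phi j z c))).
    move=> w; rewrite /f.
    have /andP[t0 _] := iin _ ni.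
    have E : 1 - i.+1%:R * r n ^+ 2 + r n ^+ 2 = 1 - i%:R * r n ^+ 2.
      by rewrite -natr1; ring.
    have /andP[_ t1] := iin _ (ltnW ni).
    have := K2 (r n) (1 - i.+1%:R * r n ^+ 2) (st i w)
      (along y0 (fun j => partial_sum (phi j) i w) (r n)) (r0 n) t0.
    rewrite E => /(_ t1); congr (`|_ - _| <= _).
    apply: eq_bigr => c _; congr (_ * perturbed _ _ _ _ _ _ _ _ _).
    by apply/funext => j; rewrite /along; ring.
  have a0 i : (i <= n)%N -> `|a i - a 0%N| <= K * r n ^+ 3 * i%:R.
    elim: i => [|i IH] ni; first by rewrite subrr normr0 mulr0.
    rewrite -(subrKA (a i)) (le_trans (ler_normD _ _))//.
    rewrite -natr1 mulrDr mulr1 addrC lerD ?IH ?aS//; exact: ltnW.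
  have r01 : 0 <= r n <= 1 by rewrite r0 r1.
  have {}a0 : `|a n - a 0%N| <= K * r n.
    rewrite (le_trans (a0 n (leqnn _)))// -mulrA ler_wpM2l//.
    by rewrite exprS -mulrA rn// mulVf ?mulr1// pnatr_eq0 -lt0n.
  have an : `|mean P (fun w => u 0 (along y0 (fun j => partial_sum (phi j) n w) (r n)))
      - a n| <= K * r n.
    apply: mean_dist_le; [|exact: sf|] => [|w].
      exact: (simple_functional phi (fun z y => u 0 (along y0 y (r n)))).
    rewrite distrC /f (_ : 1 - _ = 0) ?K1//; first by rewrite lexx ler01.
    by rewrite rn// mulfV ?subrr// pnatr_eq0 -lt0n.
  have au : `|a 0%N - u 1 y0| <= K * r n.
    rewrite -[u 1 y0](mean_cst P); apply: mean_dist_le => [||w].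
    - exact: sf.
    - exact: simple_cst.
    rewrite /f mul0r subr0.
    rewrite (_ : along y0 _ _ = y0); last first.
      by apply/funext => j; rewrite /along /partial_sum big_ord0 mulr0 addr0.
    by apply: K1 => //; rewrite ler01 lexx.
  rewrite (_ : _ - _ = (mean P (fun w => u 0 (along y0
    (fun j => partial_sum (phi j) n w) (r n))) - a n) + (a n - a 0%N) +
    (a 0%N - u 1 y0)); last by ring.
  rewrite (le_trans (ler_normD _ _))//.
  rewrite (_ : 3 * K * r n = K * r n + K * r n + K * r n); last by ring.
  by rewrite lerD// (le_trans (ler_normD _ _))// lerD.
apply: (@cvg_of_sqrt_bound _ _ _ (3 * K)); last exact: bound.
by rewrite mulr_ge0.
Qed.


Definition window_mean (nu : Z -> R) (psi : Z -> C -> R) : R :=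
  \sum_z nu z * \sum_c q z c * psi z c.

Lemma poisson_corrector (nu : Z -> R) (psi : Z -> C -> R) :
  \sum_z nu z = 1 ->
  (forall f, stationary_mean nu (transition q s f) = stationary_mean nu f) ->
  (forall f z, (fun n => iter n (transition q s) f z) @ \oo -->
     stationary_mean nu f) ->
  exists g : Z -> R, forall z,
    \sum_c q z c * (psi z c + g (s z c)) = g z + window_mean nu psi.
Proof.
move=> nu1 inv cvg.
have [g Hg] := poisson_equation nu1 inv cvg (fun z => \sum_c q z c * psi z c).
exists g => z; under eq_bigr do rewrite mulrDr.
rewrite big_split/= -/(transition q s g z).
have := Hg z; rewrite /stationary_mean -/(window_mean nu psi) => H.
apply/eqP; rewrite -subr_eq0; apply/eqP; move: H.
set a := \sum_(_ <- _) _; move=> H; lra.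
Qed.

Lemma simple_partial_sum psi n : simple_rv (partial_sum psi n).
Proof. exact: (adapted_simple mX mY (@adapted_partial_sum psi n)). Qed.

(** * First and second moments of centered sums along the chain *)

Section Moments.
Variables (psi : Z -> C -> R) (g : Z -> R) (G : Z -> R) (v : R).
Hypothesis gP : forall z, \sum_c q z c * (psi z c + g (s z c)) = g z.
Hypothesis GP : forall z, \sum_c q z c *
  (psi z c ^+ 2 + 2 * g (s z c) * psi z c + G (s z c)) = G z + v.

Local Notation Sn := (partial_sum psi).

(** The corrected sum [Sn n + g] has constant mean, and [g] is bounded. *)
Lemma mean_partial_sum_bound : exists K, forall n, `|mean P (Sn n)| <= K.
Proof.
have [M M0 gM] := finite_upper_bound (fun z => `|g z|).
exists (2 * M) => n.
have H i : mean P (fun w => Sn i w + g (st i w)) = mean P (fun w => g (st 0%N w)).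
  elim: i => [|i IH].
    by congr mean; apply/funext => w; rewrite /partial_sum big_ord0 add0r.
  rewrite -IH (mean_functionalS (fun _ : unit => psi) (fun z y => y tt + g z)).
  congr mean; apply/funext => w.
  under eq_bigr do rewrite -addrA mulrDr.
  by rewrite big_split/= -mulr_suml rate_sum1 mul1r gP.
have sg i : simple_rv (fun w => g (st i w)).
  exact: (simple_functional (fun _ : unit => psi) (fun z _ => g z)).
have := H n; rewrite meanD//; last exact: simple_partial_sum.
move=> /(canRL (addrK _)) ->.
rewrite (le_trans (ler_normB _ _))// mulr2n mulrDl mul1r lerD//;
  by apply: norm_mean_le.
Qed.

(** With these correctors the mean grows by exactly [v] at each step: the cross term [2 S (psi + g)]
    averages to [2 S g] by [gP], and what remains is [GP]. *)
Lemma second_moment_identity n :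
  mean P (fun w => Sn n w ^+ 2 + 2 * g (st n w) * Sn n w + G (st n w)) =
  mean P (fun w => G (st 0%N w)) + n%:R * v.
Proof.
elim: n => [|n IH].
  rewrite mul0r addr0; congr mean; apply/funext => w.
  by rewrite /partial_sum big_ord0 expr0n/= mulr0 !add0r.
rewrite (mean_functionalS (fun _ : unit => psi)
  (fun z y => y tt ^+ 2 + 2 * g z * y tt + G z)).
rewrite -(natr1 n) mulrDl mul1r addrA -IH -[X in _ + X](mean_cst P).
rewrite -meanD; last 2 first.
- exact: (simple_functional (fun _ : unit => psi)
   (fun z y => y tt ^+ 2 + 2 * g z * y tt + G z)).
- exact: simple_cst.
congr mean; apply/funext => w.
have E c : q (st n w) c * ((Sn n w + psi (st n w) c) ^+ 2 +
      2 * g (s (st n w) c) * (Sn n w + psi (st n w) c) + G (s (st n w) c)) =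
    q (st n w) c * Sn n w ^+ 2 +
    (2 * Sn n w * (q (st n w) c * (psi (st n w) c + g (s (st n w) c))) +
    q (st n w) c * (psi (st n w) c ^+ 2 +
      2 * g (s (st n w) c) * psi (st n w) c + G (s (st n w) c))) by ring.
rewrite (eq_bigr _ (fun c _ => E c)) !big_split/= -mulr_suml rate_sum1 mul1r.
rewrite -mulr_sumr gP GP; ring.
Qed.

Lemma simple_sq n : simple_rv (fun w => Sn n w ^+ 2).
Proof. exact: (simple_map (fun x => x ^+ 2) (simple_partial_sum psi n)). Qed.

Lemma simple_st (f : Z -> R) n : simple_rv (fun w => f (st n w)).
Proof. exact: (simple_functional (fun _ : unit => psi) (fun z _ => f z)). Qed.

(** The cross term [2 g S] is controlled by [2 |S| <= S ^ 2 / t + t]. The parameter [t] stays free: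
    a constant gives linear growth, [sqrt n] gives the limit. *)
Lemma second_moment_bounds : exists K, 0 <= K /\ forall n t, 0 < t ->
  `|mean P (fun w => Sn n w ^+ 2) - n%:R * v| <=
   K + K * (mean P (fun w => Sn n w ^+ 2) / t + t).
Proof.
have [M M0 gM] := finite_upper_bound (fun z => `|g z|).
have [N N0 GN] := finite_upper_bound (fun z => `|G z|).
have sgS n : simple_rv (fun w => 2 * g (st n w) * Sn n w).
  exact: (simple_functional (fun _ : unit => psi) (fun z y => 2 * g z * y tt)).
exists (M + 2 * N); split; first by lra.
move=> n t t0.
have := second_moment_identity n.
rewrite meanD; [|apply: simpleD; [exact: simple_sq|exact: sgS]|exact: simple_st].
rewrite meanD; [|exact: simple_sq|exact: sgS] => H.
rewrite (_ : _ - _ = mean P (fun w => G (st 0%N w)) - mean P (fun w => G (st n w))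
  - mean P (fun w => 2 * g (st n w) * Sn n w)); last first.
  apply/eqP; rewrite subr_eq; apply/eqP; move: H; lra.
rewrite (le_trans (ler_normB _ _))//.
have G1 : `|mean P (fun w => G (st 0%N w)) - mean P (fun w => G (st n w))| <= 2 * N.
  rewrite (le_trans (ler_normB _ _))// mulr2n mulrDl mul1r.
  by apply: lerD; apply: norm_mean_le => // *; exact: simple_st.
have G2 : `|mean P (fun w => 2 * g (st n w) * Sn n w)| <=
    M * (mean P (fun w => Sn n w ^+ 2) / t + t).
  have sB : simple_rv (fun w => M * t^-1 * Sn n w ^+ 2 + M * t).
    apply: simpleD; [apply: simpleZ; exact: simple_sq|exact: simple_cst].
  have -> : M * (mean P (fun w => Sn n w ^+ 2) / t + t) =
      mean P (fun w => M * t^-1 * Sn n w ^+ 2 + M * t).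
    rewrite meanD; [|by apply: simpleZ; exact: simple_sq|exact: simple_cst].
    by rewrite mean_cst meanZ; [ring|exact: simple_sq].
  have key w : `|2 * g (st n w) * Sn n w| <= M * t^-1 * Sn n w ^+ 2 + M * t.
    rewrite !normrM (ger0_norm (x := 2))//.
    have -> : M * t^-1 * Sn n w ^+ 2 + M * t = M * (t^-1 * `|Sn n w| ^+ 2 + t).
      by rewrite real_normK ?num_real//; ring.
    rewrite mulrAC [leLHS]mulrC ler_pM// ?mulr_ge0//.
    have : 0 <= t^-1 * (`|Sn n w| - t) ^+ 2.
      by rewrite mulr_ge0 ?sqr_ge0// invr_ge0 ltW.
    have -> : t^-1 * (`|Sn n w| - t) ^+ 2 =
      t^-1 * `|Sn n w| ^+ 2 + t - 2 * `|Sn n w| by field; rewrite gt_eqF.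
    by rewrite subr_ge0.
  rewrite ler_norml; apply/andP; split.
    rewrite -mulN1r -meanZ//; apply: le_mean => //; first exact: simpleZ.
    by move=> w; have := key w; rewrite ler_norml mulN1r => /andP[].
  apply: le_mean => // w.
  by have := key w; rewrite ler_norml => /andP[].
have m0 : 0 <= mean P (fun w => Sn n w ^+ 2) / t + t.
  rewrite addr_ge0 ?(ltW t0)// divr_ge0 ?(ltW t0)//.
  by apply: mean_ge0; [exact: simple_sq|move=> w; exact: sqr_ge0].
rewrite (le_trans (lerD G1 G2))// lerD//; first by lra.
by rewrite ler_wpM2r//; lra.
Qed.

Lemma second_moment_le : exists K, 0 <= K /\
  forall n, mean P (fun w => Sn n w ^+ 2) <= K * n.+1%:R.
Proof.
have [K [K0 HK]] := second_moment_bounds.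
(* With [t = 2 K + 1] the second moment reappears on the right with a factor below [1/2] and is
   absorbed on the left. *)
exists (2 * (K + K * (2 * K + 1) + `|v|)); split.
  by rewrite mulr_ge0// !addr_ge0// mulr_ge0//; lra.
move=> n; have t0 : 0 < 2 * K + 1 by lra.
have := HK n _ t0; set m := mean P _ => H.
have m0 : 0 <= m.
  by apply: mean_ge0; [exact: simple_sq|move=> w; exact: sqr_ge0].
have H1 : K * (m / (2 * K + 1)) <= m / 2.
  rewrite mulrA ler_pdivrMr// mulrAC ler_pdivlMr//.
  nra.
have {}H : m - n%:R * v <= K + K * (m / (2 * K + 1) + (2 * K + 1)).
  exact: le_trans (ler_norm _) H.
have nv : n%:R * v <= n%:R * `|v| by rewrite ler_wpM2l// ler_norm.
rewrite -natr1.
have n0 : 0 <= (n%:R : R) by rewrite ler0n.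
have v0 : 0 <= `|v| by [].
move: H; rewrite mulrDr; nra.
Qed.

Lemma second_moment_cvg :
  (fun n => n%:R^-1 * mean P (fun w => Sn n w ^+ 2)) @ \oo --> v.
Proof.
have [K [K0 HK]] := second_moment_bounds.
have [L [L0 HL]] := second_moment_le.
have bound n : (0 < n)%N -> `|n%:R^-1 * mean P (fun w => Sn n w ^+ 2) - v| <=
    (K + K * (2 * L + 1)) * (Num.sqrt n%:R)^-1.
  move=> n0; have nR : 0 < (n%:R : R) by rewrite ltr0n.
  (* As the second moment is [O(n)], the choice [t = sqrt n] makes both [m / t] and [t] of order
     [sqrt n], negligible against [n]. *)
  pose t : R := Num.sqrt n%:R.
  have t0 : 0 < t by rewrite sqrtr_gt0.
  have tt : t ^+ 2 = n%:R by rewrite sqr_sqrtr// ltW.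
  have t1 : 1 <= t.
    by rewrite -(@ler_pXn2r _ 2%N) ?nnegrE ?(ltW t0)// expr1n tt ler1n.
  have -> : n%:R^-1 * mean P (fun w => Sn n w ^+ 2) - v =
      n%:R^-1 * (mean P (fun w => Sn n w ^+ 2) - n%:R * v).
    by rewrite mulrBr mulKf// gt_eqF.
  rewrite normrM ger0_norm ?invr_ge0 ?(ltW nR)// mulrC ler_pdivrMr//.
  rewrite (le_trans (HK n t t0))// -/t -tt.
  rewrite (_ : _ * t^-1 * t ^+ 2 = (K + K * (2 * L + 1)) * t); last first.
    by field; rewrite gt_eqF.
  have ms : mean P (fun w => Sn n w ^+ 2) / t <= 2 * L * t.
    rewrite ler_pdivrMr// (le_trans (HL n))//.
    rewrite -[2 * L * t * t]mulrA -expr2 tt -(natr1 n).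
    have : 1 <= (n%:R : R) by rewrite ler1n.
    by nra.
  rewrite mulrDl lerD//; first by rewrite ler_peMr.
  rewrite -mulrA ler_wpM2l// mulrDl mul1r lerD//.
apply: cvg_of_sqrt_bound bound.
by rewrite addr_ge0// mulr_ge0//; lra.
Qed.

End Moments.

End LimitTheorems.

(** * Gaussian solutions of the heat equation *)

Section GaussianPolynomials.
Context {R : realType} (J : finType).
Variables (c0 kappa : R).
Implicit Types (t a : R) (y : J -> R) (F G : R -> (J -> R) -> R).
Hypotheses (c00 : 0 < c0) (kappa0 : 0 <= kappa).

(** The inverse standard deviation of a Gaussian of variance [c0] after diffusing for time [t]. A
    positive [c0] keeps all derivatives bounded down to [t = 0], even for [kappa = 0]. *)
Definition inv_scale (t : R) : R := (Num.sqrt (c0 + kappa * t))^-1.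

Definition gaussian (t : R) (y : J -> R) : R :=
  expR (- (inv_scale t ^+ 2 / 2 * \sum_j y j ^+ 2)).

(** This class is closed under space and time derivatives, and its members are bounded for times in
    [[0, 1]]. An induction thus supplies every derivative bound asked of a heat function, with no
    explicit third derivatives. *)
Inductive gauss_poly : (R -> (J -> R) -> R) -> Prop :=
| gauss_poly_exp : gauss_poly gaussian
| gauss_poly_coord j F : gauss_poly F -> gauss_poly (fun t y => y j * F t y)
| gauss_poly_inv F : gauss_poly F -> gauss_poly (fun t y => inv_scale t * F t y)
| gauss_poly_add F G : gauss_poly F -> gauss_poly G ->
    gauss_poly (fun t y => F t y + G t y)
| gauss_poly_scale a F : gauss_poly F -> gauss_poly (fun t y => a * F t y).

Lemma gauss_poly_eq F G : gauss_poly F -> (forall t y, F t y = G t y) ->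
  gauss_poly G.
Proof.
by move=> gF FG; rewrite (_ : G = F)//; apply/funext => t; apply/funext => y.
Qed.

Lemma gauss_poly0 : gauss_poly (fun _ _ => 0).
Proof.
apply: gauss_poly_eq (gauss_poly_scale 0 gauss_poly_exp) _ => t y.
by rewrite mul0r.
Qed.

Lemma gauss_poly_sum (I : Type) (r : seq I) (F : I -> R -> (J -> R) -> R) :
  (forall i, gauss_poly (F i)) -> gauss_poly (fun t y => \sum_(i <- r) F i t y).
Proof.
move=> gF; elim: r => [|i r IH].
  by apply: gauss_poly_eq gauss_poly0 _ => t y; rewrite big_nil.
by apply: gauss_poly_eq (gauss_poly_add (gF i) IH) _ => t y; rewrite big_cons.
Qed.

Lemma scale_gt0 t : 0 <= t <= 1 -> 0 < c0 + kappa * t.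
Proof. by move=> /andP[t0 _]; rewrite ltr_wpDr// mulr_ge0. Qed.

Lemma inv_scale_gt0 t : 0 <= t <= 1 -> 0 < inv_scale t.
Proof. by move=> t01; rewrite invr_gt0 sqrtr_gt0 scale_gt0. Qed.

Lemma inv_scale_sqr t : 0 <= t <= 1 -> inv_scale t ^+ 2 = (c0 + kappa * t)^-1.
Proof. by move=> t01; rewrite exprVn sqr_sqrtr// ltW// scale_gt0. Qed.

Lemma derive_inv_scale t : 0 <= t <= 1 ->
  is_derive t 1 inv_scale (- (kappa / 2 * inv_scale t ^+ 3)).
Proof.
move=> t01; have c := scale_gt0 t01.
have dl : is_derive t 1 (fun t => c0 + kappa * t) kappa.
  apply: derive_eq (derive_add (derive_cst _ _) (derive_scale _ (derive_var _))) _.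
  by rewrite mulr1 add0r.
have ds := @derive_comp _ Num.sqrt (fun t => c0 + kappa * t) _ _ _
  (is_derive1_sqrt c) dl.
have dv := @is_deriveV _ (fun t => Num.sqrt (c0 + kappa * t)) _ _ _ _ ds.
apply: derive_eq (dv _) _.
  by rewrite /= gt_eqF// sqrtr_gt0.
rewrite /= /inv_scale /GRing.scale/=; field.
by rewrite gt_eqF// sqrtr_gt0.
Qed.

Lemma gauss_poly_dominated F : gauss_poly F -> exists (C : R) (N : nat),
  0 <= C /\ forall t y, 0 <= t <= 1 ->
  `|F t y| <= C * (1 + \sum_j y j ^+ 2) ^+ N * gaussian t y.
Proof.
have q0 (y : J -> R) : 0 <= \sum_j y j ^+ 2.
  by apply: sumr_ge0 => j _; exact: sqr_ge0.
have q1 (y : J -> R) : 1 <= 1 + \sum_j y j ^+ 2 by rewrite lerDl.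
have g0 t y : 0 <= gaussian t y by exact: expR_ge0.
elim=> {F} [|j F gF [C [N [C0 H]]]|F gF [C [N [C0 H]]]
  |F G gF [C [N [C0 H]]] gG [C' [N' [C'0 H']]]|a F gF [C [N [C0 H]]]].
- exists 1, 0%N; split=> // t y _.
  by rewrite ger0_norm// expr0 !mul1r.
- exists C, N.+1; split=> // t y t01; rewrite normrM exprS.
  have -> : C * ((1 + \sum_j y j ^+ 2) * (1 + \sum_j y j ^+ 2) ^+ N) * gaussian t y =
    (1 + \sum_j y j ^+ 2) * (C * (1 + \sum_j y j ^+ 2) ^+ N * gaussian t y) by ring.
  apply: ler_pM => //; last exact: H.
  apply: (@le_trans _ _ (1 + y j ^+ 2)).
    rewrite -[y j ^+ 2]real_normK ?num_real//.
    have : 0 <= (`|y j| - 2^-1) ^+ 2 by exact: sqr_ge0.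
    by nra.
  rewrite lerD2l (bigD1 j)//= lerDl sumr_ge0// => i _; exact: sqr_ge0.
- exists ((Num.sqrt c0)^-1 * C), N; split=> [|t y t01].
    by rewrite mulr_ge0// invr_ge0 sqrtr_ge0.
  rewrite normrM -!mulrA; apply: ler_pM => //; last by rewrite mulrA H.
  rewrite gtr0_norm ?inv_scale_gt0//.
  rewrite lef_pV2 ?posrE ?sqrtr_gt0 ?scale_gt0//.
  by rewrite ler_wsqrtr// lerDl mulr_ge0//; case/andP: t01.
- exists (C + C'), (N + N')%N; split=> [|t y t01]; first exact: addr_ge0.
  rewrite (le_trans (ler_normD _ _))// !mulrDl; apply: lerD.
    apply: le_trans (H t y t01) _; rewrite ler_wpM2r// ler_wpM2l//.
    by rewrite ler_weXn2l// leq_addr.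
  apply: le_trans (H' t y t01) _; rewrite ler_wpM2r// ler_wpM2l//.
  by rewrite ler_weXn2l// leq_addl.
- exists (`|a| * C), N; split=> [|t y t01]; first by rewrite mulr_ge0.
  by rewrite normrM -!mulrA ler_wpM2l// mulrA H.
Qed.

Lemma gauss_poly_bounded F : gauss_poly F ->
  exists B, forall t y, 0 <= t <= 1 -> `|F t y| <= B.
Proof.
move=> /gauss_poly_dominated[C [N [C0 H]]].
(* The decay rate at [t = 1], the slowest on [[0, 1]]. The factor in front bounds
   [(1 + Q) ^ (N + 1)] by one term of the series of [expR (a * (1 + Q))]. *)
pose a := (c0 + kappa)^-1 / 2.
have a0 : 0 < a by rewrite divr_gt0// invr_gt0 ltr_wpDr.
exists (C * (N.+1`!%:R / a ^+ N.+1 * expR a)) => t y t01.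
apply: le_trans (H t y t01) _; rewrite -mulrA ler_wpM2l//.
set Q := \sum_j _.
have Q0 : 0 <= Q by apply: sumr_ge0 => j _; exact: sqr_ge0.
have Q1 : 1 <= 1 + Q by rewrite lerDl.
have gle : gaussian t y <= expR (- (a * Q)).
  rewrite ler_expR lerN2 ler_wpM2r// inv_scale_sqr// ler_wpM2r//.
  rewrite lef_pV2 ?posrE ?scale_gt0//; last by rewrite ltr_wpDr.
  by rewrite lerD2l ler_piMr//; case/andP: t01.
have e1 : (1 + Q) ^+ N.+1 <= N.+1`!%:R / a ^+ N.+1 * expR (a * (1 + Q)).
  have aQ : 0 <= a * (1 + Q) by rewrite mulr_ge0 ?(ltW a0)// addr_ge0.
  have := expR_ge1Dxn N aQ.
  have f0 : 0 < N.+1`!%:R :> R by rewrite ltr0n fact_gt0.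
  have aN : 0 < a ^+ N.+1 by rewrite exprn_gt0.
  move=> /(le_trans (ler_wpDl ler01 (lexx _))).
  rewrite ler_pdivrMr// exprMn => e.
  by rewrite mulrAC ler_pdivlMr// mulrC [leRHS]mulrC.
apply: (@le_trans _ _ ((1 + Q) ^+ N.+1 * expR (- (a * Q)))).
  apply: ler_pM => //; first by rewrite exprn_ge0// addr_ge0.
    exact: expR_ge0.
  by rewrite ler_weXn2l.
apply: (@le_trans _ _ (N.+1`!%:R / a ^+ N.+1 * expR (a * (1 + Q)) * expR (- (a * Q)))).
  by rewrite ler_wpM2r// expR_ge0.
by rewrite -mulrA -expRD mulrDr mulr1 addrK.
Qed.

Let total (_ : J -> R) := True.

Lemma gradient_coord j : has_gradient total (fun y => y j) (fun i _ => (i == j)%:R).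
Proof.
move=> x h t _.
have d : is_derive t 1 (fun t => t * h j) (1 * h j + t * 0).
  exact: derive_mul (derive_var _) (derive_cst (h j) _).
apply: derive_eq (derive_add (derive_cst (x j) _) d) _.
rewrite mulr0 add0r addr0 mul1r (bigD1 j)//= eqxx mulr1 big1 ?addr0// => i.
by move=> /negPf ->; rewrite mulr0.
Qed.

Lemma gradient_mul (F G : (J -> R) -> R) DF DG :
  has_gradient total F DF -> has_gradient total G DG ->
  has_gradient total (fun y => F y * G y) (fun i y => DF i y * G y + F y * DG i y).
Proof.
move=> HF HG x h t _; apply: derive_eq (derive_mul (HF x h t I) (HG x h t I)) _.
rewrite mulr_suml mulr_sumr -big_split/=; apply: eq_bigr => i _.
by rewrite mulrDr !mulrA (mulrC (h i) (F _)).
Qed.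

Lemma gradient_add (F G : (J -> R) -> R) DF DG :
  has_gradient total F DF -> has_gradient total G DG ->
  has_gradient total (fun y => F y + G y) (fun i y => DF i y + DG i y).
Proof.
move=> HF HG x h t _; apply: derive_eq (derive_add (HF x h t I) (HG x h t I)) _.
by rewrite -big_split/=; apply: eq_bigr => i _; rewrite mulrDr.
Qed.

Lemma gradient_scale a (F : (J -> R) -> R) DF : has_gradient total F DF ->
  has_gradient total (fun y => a * F y) (fun i y => a * DF i y).
Proof.
move=> HF x h t _; apply: derive_eq (derive_scale a (HF x h t I)) _.
by rewrite mulr_sumr; apply: eq_bigr => i _; rewrite mulrCA.
Qed.

Lemma gradient_sum (I : Type) (r : seq I) (F : I -> (J -> R) -> R)
    (DF : I -> J -> (J -> R) -> R) : (forall i, has_gradient total (F i) (DF i)) ->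
  has_gradient total (fun y => \sum_(i <- r) F i y)
    (fun j y => \sum_(i <- r) DF i j y).
Proof.
move=> HF x h t _; apply: derive_eq (derive_sum r (fun i => HF i x h t Logic.I)) _.
by rewrite exchange_big/=; apply: eq_bigr => i _; rewrite mulr_sumr.
Qed.

Lemma gradient_comp (f : R -> R) (df : R -> R) (F : (J -> R) -> R) DF :
  (forall x : R, is_derive x 1 f (df x)) -> has_gradient total F DF ->
  has_gradient total (fun y => f (F y)) (fun i y => df (F y) * DF i y).
Proof.
move=> fd HF x h t _; apply: derive_eq (@derive_comp _ f (fun t => F (along x h t)) _ _ _
  (fd _) (HF x h t I)) _.
by rewrite mulr_sumr; apply: eq_bigr => i _; rewrite mulrCA.
Qed.

Lemma gradient_eq (F : (J -> R) -> R) DF DG : has_gradient total F DF ->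
  (forall i y, DF i y = DG i y) -> has_gradient total F DG.
Proof.
move=> HF E x h t _; apply: derive_eq (HF x h t I) _.
by apply: eq_bigr => i _; rewrite E.
Qed.

Lemma gradient_gaussian t : has_gradient total (gaussian t)
  (fun j y => - (inv_scale t ^+ 2 * y j) * gaussian t y).
Proof.
have H := gradient_comp (@is_derive_expR R) (gradient_scale (- (inv_scale t ^+ 2 / 2))
  (gradient_sum (index_enum J)
    (fun j => gradient_mul (gradient_coord j) (gradient_coord j)))).
rewrite (_ : gaussian t = (fun y => expR (- (inv_scale t ^+ 2 / 2) *
   \sum_j y j * y j))); last first.
  apply/funext => y; rewrite /gaussian mulNr.
  by under eq_bigr do rewrite expr2.
apply: gradient_eq H _ => j y /=; rewrite mulrC; congr (_ * _).
rewrite (bigD1 j)//= eqxx mul1r mulr1 big1 => [|i]; last first.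
  by rewrite eq_sym => /negPf ->; rewrite mul0r mulr0 addr0.
by rewrite addr0; field.
Qed.

Lemma derive_gaussian t y : 0 <= t <= 1 -> is_derive t 1 (gaussian ^~ y)
  (kappa / 2 * inv_scale t ^+ 4 * (\sum_j y j ^+ 2) * gaussian t y).
Proof.
move=> t01; have d := derive_inv_scale t01.
have H := @derive_comp _ expR _ _ _ _ (is_derive_expR _)
  (derive_scale (- ((\sum_j y j ^+ 2) / 2)) (derive_mul d d)).
rewrite (_ : gaussian^~ y =
    expR \o (fun t => - ((\sum_j y j ^+ 2) / 2) * (inv_scale t * inv_scale t))).
  apply: derive_eq H _; rewrite mulrC; congr (_ * _); last first.
    by rewrite /gaussian; congr expR; field.
  by field.
by apply/funext => v; rewrite /gaussian /=; congr expR; field.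
Qed.

Lemma gauss_poly_gradient F : gauss_poly F -> exists DF : J -> R -> (J -> R) -> R,
  (forall j, gauss_poly (DF j)) /\
  forall t, has_gradient total (F t) (fun j => DF j t).
Proof.
elim=> {F} [|j F gF [DF [gD HD]]|F gF [DF [gD HD]]
  |F G gF [DF [gD HD]] gG [DG [gDG HDG]]|a F gF [DF [gD HD]]].
- exists (fun j t y => - (inv_scale t ^+ 2 * y j) * gaussian t y); split.
    move=> j; apply: gauss_poly_eq (gauss_poly_scale (-1) (gauss_poly_inv
      (gauss_poly_inv (gauss_poly_coord j gauss_poly_exp)))) _.
    by move=> t y; ring.
  by move=> t; exact: gradient_gaussian.
- exists (fun i t y => (i == j)%:R * F t y + y j * DF i t y); split.
    by move=> i; apply: gauss_poly_add;
      [exact: gauss_poly_scale|exact: gauss_poly_coord].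
  by move=> t; exact: gradient_mul (gradient_coord j) (HD t).
- exists (fun i t y => inv_scale t * DF i t y); split.
    by move=> i; exact: gauss_poly_inv.
  by move=> t; exact: gradient_scale.
- exists (fun i t y => DF i t y + DG i t y); split.
    by move=> i; exact: gauss_poly_add.
  by move=> t; exact: gradient_add.
- exists (fun i t y => a * DF i t y); split.
    by move=> i; exact: gauss_poly_scale.
  by move=> t; exact: gradient_scale.
Qed.

Lemma gauss_poly_time F : gauss_poly F -> exists TF : R -> (J -> R) -> R,
  gauss_poly TF /\
  forall t y, 0 <= t <= 1 -> is_derive t 1 (F ^~ y) (TF t y).
Proof.
elim=> {F} [|j F gF [DF [gD HD]]|F gF [DF [gD HD]]
  |F G gF [DF [gD HD]] gG [DG [gDG HDG]]|a F gF [DF [gD HD]]].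
- exists (fun t y => kappa / 2 * inv_scale t ^+ 4 * (\sum_j y j ^+ 2) * gaussian t y).
  split; last by move=> t y; exact: derive_gaussian.
  have g1 := gauss_poly_sum (index_enum J) (fun j => gauss_poly_coord j
    (gauss_poly_coord j gauss_poly_exp)).
  apply: gauss_poly_eq (gauss_poly_scale (kappa / 2) (gauss_poly_inv (gauss_poly_inv
    (gauss_poly_inv (gauss_poly_inv g1))))) _ => t y.
  have -> : \sum_j y j * (y j * gaussian t y) = (\sum_j y j ^+ 2) * gaussian t y.
    by rewrite mulr_suml; apply: eq_bigr => j _; rewrite mulrA.
  by ring.
- exists (fun t y => y j * DF t y); split; first exact: gauss_poly_coord.
  by move=> t y t01; apply: derive_scale; exact: HD.
- exists (fun t y => inv_scale t * DF t y +
    (- (kappa / 2)) * (inv_scale t * (inv_scale t * (inv_scale t * F t y)))); split.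
    apply: gauss_poly_add; first exact: gauss_poly_inv.
    by apply: gauss_poly_scale; do 3 apply: gauss_poly_inv.
  move=> t y t01; apply: derive_eq (derive_mul (derive_inv_scale t01) (HD t y t01)) _.
  by ring.
- exists (fun t y => DF t y + DG t y); split; first exact: gauss_poly_add.
  by move=> t y t01; apply: derive_add; [exact: HD|exact: HDG].
- exists (fun t y => a * DF t y); split; first exact: gauss_poly_scale.
  by move=> t y t01; apply: derive_scale; exact: HD.
Qed.

(** Only the first and second derivatives have to be in the class: [u] may be a distribution
    function, which is not a Gaussian times a polynomial. *)
Lemma heat_function_gauss_poly (S : J * J -> R) u
    (D1 : J -> R -> (J -> R) -> R) (D2 : J -> J -> R -> (J -> R) -> R) :
  (forall j, gauss_poly (D1 j)) -> (forall j l, gauss_poly (D2 j l)) ->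
  (forall t, 0 <= t <= 1 -> has_gradient total (u t) (fun j => D1 j t)) ->
  (forall j t, 0 <= t <= 1 -> has_gradient total (D1 j t) (fun l => D2 j l t)) ->
  (forall t y, 0 <= t <= 1 ->
    is_derive t 1 (u ^~ y) (\sum_p S p / 2 * D2 p.1 p.2 t y)) ->
  heat_function S u.
Proof.
move=> g1 g2 H1 H2 Ht.
have [D3 HD3] := choice (fun p => gauss_poly_gradient (g2 p.1 p.2)).
have [T1 HT1] := choice (fun j => gauss_poly_time (g1 j)).
have [T2 HT2] := choice (fun p => gauss_poly_time (g2 p.1 p.2)).
have [b1 Hb1] := choice (fun j => gauss_poly_bounded (g1 j)).
have [b2 Hb2] := choice (fun p => gauss_poly_bounded (g2 p.1 p.2)).
have [b3 Hb3] := choice (fun p => gauss_poly_bounded ((HD3 p.1).1 p.2)).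
have [b4 Hb4] := choice (fun j => gauss_poly_bounded (HT1 j).1).
have [b5 Hb5] := choice (fun p => gauss_poly_bounded (HT2 p).1).
have [B1 B10 HB1] := finite_upper_bound b1.
have [B2 B20 HB2] := finite_upper_bound b2.
have [B3 B30 HB3] := finite_upper_bound b3.
have [B4 B40 HB4] := finite_upper_bound b4.
have [B5 B50 HB5] := finite_upper_bound b5.
exists D1, D2, (fun j l m => D3 (j, l) m), T1, (fun j l => T2 (j, l)),
  (B1 + B2 + B3 + B4 + B5); split.
- by rewrite !addr_ge0// ltW.
- move=> t t01; split; [exact: H1|by move=> j; exact: H2|].
  by move=> j l; exact: (HD3 (j, l)).2.
- move=> t y t01; split; [exact: Ht|by move=> j; exact: (HT1 j).2|].
  by move=> j l; exact: (HT2 (j, l)).2.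
- move=> t y t01 j l m; split.
  + have := le_trans (Hb1 j t y t01) (HB1 j); lra.
  + have := le_trans (Hb2 (j, l) t y t01) (HB2 (j, l)); move=> /=; lra.
  + have := le_trans (Hb3 ((j, l), m) t y t01) (HB3 ((j, l), m)); move=> /=; lra.
  + have := le_trans (Hb4 j t y t01) (HB4 j); lra.
  + have := le_trans (Hb5 (j, l) t y t01) (HB5 (j, l)); move=> /=; lra.
Qed.

End GaussianPolynomials.

(** * Distribution functions and the normal law *)

Section DistributionFunction.
Context {R : realType}.
Implicit Types mu : probability (measurableTypeR R) R.

Definition real_cdf mu (x : R) : R := fine (mu `]-oo, x]%classic).

Let idR : measurableTypeR R -> R := idfun.

Let measurable_idR : measurable_fun setT idR. Proof. exact: measurable_id. Qed.

#[local] HB.instance Definition _ := isMeasurableFun.Build _ _ _ _ idR measurable_idR.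

Lemma real_cdfE mu x : mu `]-oo, x]%classic = (real_cdf mu x)%:E.
Proof. by rewrite /real_cdf fineK// fin_num_measure. Qed.

Lemma cdf_idR mu : cdf (idR : {RV mu >-> R}) = EFin \o real_cdf mu.
Proof. by apply/funext => x; rewrite /= -real_cdfE. Qed.

Lemma real_cdf_ge0 mu x : 0 <= real_cdf mu x.
Proof. exact: fine_ge0. Qed.

Lemma real_cdf_le1 mu x : real_cdf mu x <= 1.
Proof. by rewrite -lee_fin -real_cdfE probability_le1. Qed.

Lemma real_cdf_nondecreasing mu x y : x <= y -> real_cdf mu x <= real_cdf mu y.
Proof.
move=> xy; rewrite -lee_fin -!real_cdfE le_measure ?inE//.
exact: subitvPr.
Qed.

Lemma real_cdf_cvgy mu : real_cdf mu x @[x --> +oo%R] --> (1 : R).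
Proof.
have := cvg_cdfy1 (idR : {RV mu >-> R}).
by rewrite cdf_idR => /fine_cvgP[].
Qed.

Lemma real_cdf_cvgNy mu : real_cdf mu x @[x --> -oo%R] --> (0 : R).
Proof.
have := cvg_cdfNy0 (idR : {RV mu >-> R}).
by rewrite cdf_idR => /fine_cvgP[].
Qed.

End DistributionFunction.

Section NormalDistributionFunction.
Context {R : realType}.

Definition std_normal : probability (measurableTypeR R) R := normal_prob (0 : R) (1 : R).

Lemma derive_normal_cdf (v x : R) : v != 0 ->
  is_derive x 1 (real_cdf (normal_prob (0 : R) v)) (normal_pdf 0 v x).
Proof.
move=> v0.
have E : real_cdf (normal_prob (0 : R) v) =
    (fun x => \int[lebesgue_measure]_(t in [set` Interval -oo%O (BRight x)]) normal_pdf 0 v t).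
  by apply/funext => y.
have xx : x < x + 1 by rewrite ltrDl.
have intf : lebesgue_measure.-integrable [set` Interval -oo%O (BRight (x + 1))]
    (EFin \o normal_pdf 0 v).
  apply: (@integrableS _ _ _ _ setT) => //; exact: integrable_normal_pdf.
have [|d <-] := @continuous_FTC1 _ _ -oo%O x (x + 1) xx intf _ (@continuous_normal_pdf R 0 v v0 x).
  by rewrite ltNyr.
by rewrite E; apply: DeriveDef; [exact: d|rewrite derive1E].
Qed.

Definition Phi : R -> R := real_cdf std_normal.

Lemma derive_Phi (x : R) :
  is_derive x 1 Phi (normal_peak 1 * expR (- (x ^+ 2 / 2))).
Proof.
have := @derive_normal_cdf 1 x (oner_neq0 _).
rewrite normal_pdfE ?oner_neq0// /normal_fun subr0 expr1n mulNr.
exact.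
Qed.

(** Both sides have the same derivative and tend to 0 at minus infinity, which replaces a change of
    variables in the integral. *)
Lemma normal_cdf_Phi (v x : R) : 0 < v ->
  real_cdf (normal_prob (0 : R) v) x = Phi (x / v).
Proof.
move=> v0.
pose f y := real_cdf (normal_prob (0 : R) v) y - Phi (v^-1 * y).
have f' (y : R) : is_derive y 1 f 0.
  have d1 := @derive_normal_cdf v y (lt0r_neq0 v0).
  have d2 := @derive_comp _ Phi (fun y => v^-1 * y) _ _ _ (derive_Phi _)
    (derive_scale v^-1 (derive_var y)).
  apply: derive_eq (derive_sub d1 d2) _; apply/eqP; rewrite subr_eq0; apply/eqP.
  rewrite normal_pdfE ?lt0r_neq0// /normal_fun subr0 mulr1 mulrAC; congr (_ * _).
    rewrite /normal_peak expr1n mul1r -mulrnAr sqrtrM ?sqr_ge0//.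
    by rewrite sqrtr_sqr gtr0_norm// invfM mulrC.
  congr expR; rewrite -[_ *+ 2]mulr_natr; field; exact: lt0r_neq0.
have fc y z : f y = f z.
  wlog yz : y z / y <= z.
    by move=> H; have /orP[|zy] := le_total y z; [exact: H|exact/esym/H].
  apply/esym/eqP; rewrite -subr_eq0 -normr_le0.
  have := @mean_value_bound _ f (fun=> 0) y z 0 yz.
  by rewrite mul0r; apply=> t _; rewrite normr0.
have f0 : f y @[y --> -oo%R] --> (0 : R).
  rewrite -(subrr 0); apply: cvgB; first exact: real_cdf_cvgNy.
  apply: (cvg_comp (fun y => v^-1 * y) Phi); last exact: real_cdf_cvgNy.
  apply: gt0_cvgMrNy; first by rewrite invr_gt0.
  exact: cvg_id.
have fx : f = fun=> f x by apply/funext => y; exact: fc.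
have : f x = 0.
  have : f y @[y --> -oo%R] --> f x by rewrite fx; exact: cvg_cst.
  move=> H; exact: (cvg_unique (@norm_hausdorff _ _) H f0).
by move/eqP; rewrite subr_eq0 mulrC => /eqP.
Qed.

(** The value is the probability that [y] plus a normal variable of variance [c0 + kappa * t] is at
    most 0: a step function smoothed by [c0], then diffused. *)
Lemma heat_function_Phi (c0 kappa : R) : 0 < c0 -> 0 <= kappa ->
  heat_function (fun _ : unit * unit => kappa)
    (fun t (y : unit -> R) => Phi (- (inv_scale c0 kappa t * y tt))).
Proof.
move=> c00 k0; pose p : R := normal_peak 1.
pose w := inv_scale c0 kappa.
pose E := @gaussian R unit c0 kappa.
have Ey t y : expR (- ((- (w t * y tt)) ^+ 2 / 2)) = E t y.
  rewrite /E /gaussian; congr (expR (- _)).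
  rewrite (bigD1 tt)//= big1 ?addr0; last by case.
  by rewrite -/w; field.
have gE : gauss_poly c0 kappa E by exact: gauss_poly_exp.
have gwE : gauss_poly c0 kappa (fun t y => w t * E t y) by exact: gauss_poly_inv.
apply: (heat_function_gauss_poly c00 k0
  (D1 := fun _ t y => - p * (w t * E t y))
  (D2 := fun _ _ t y => p * (w t * (w t * (w t * (y tt * E t y)))))).
- by move=> _; exact: gauss_poly_scale.
- move=> _ _; apply: gauss_poly_scale; do 3 apply: gauss_poly_inv.
  exact: gauss_poly_coord.
- move=> t t01.
  have H := gradient_comp derive_Phi (gradient_scale (- w t) (@gradient_coord R unit tt)).
  rewrite (_ : (fun y : unit -> R => _) = (fun y => Phi (- w t * y tt))); last first.
    by apply/funext => y; rewrite mulNr.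
  apply: gradient_eq H _ => -[] y /=; rewrite -(Ey t y) mulNr -/p; ring.
- move=> [] t t01.
  have H := gradient_scale (- p * w t) (gradient_gaussian c0 kappa t (J := unit)).
  rewrite (_ : (fun y : unit -> R => _) = (fun y => - p * w t * gaussian c0 kappa t y)); last first.
    by apply/funext => y; rewrite mulrA.
  apply: gradient_eq H _ => -[] y /=; rewrite -/w -/E; ring.
- move=> t y t01.
  rewrite (bigD1 (tt, tt))//= big1 ?addr0; last by case=> [[] []].
  have dw := derive_inv_scale c00 k0 t01.
  have H := @derive_comp _ Phi (fun t => (- y tt) * w t) _ _ _ (derive_Phi _)
    (derive_scale (- y tt) dw).
  rewrite (_ : (fun t => _) = (fun t => Phi (- y tt * w t))); last first.
    by apply/funext => v; rewrite mulNr mulrC.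
  apply: derive_eq H _; rewrite -(Ey t y) -/w -/p mulNr (mulrC (y tt)); ring.
Qed.

(** Up to a power of [2 pi], this is the density of the centered normal law with covariance [c0 + t]
    times the identity, that is, the heat kernel. *)
Lemma heat_function_gaussian (J : finType) (c0 : R) : 0 < c0 ->
  heat_function (fun p : J * J => (p.1 == p.2)%:R)
    (fun t y => inv_scale c0 1 t ^+ #|J| * gaussian c0 1 t y).
Proof.
move=> c00; pose w := inv_scale c0 1; pose E := @gaussian R J c0 1.
pose m := #|J|.
pose u t y := w t ^+ m * E t y.
have gu : gauss_poly c0 1 u.
  suff H n : gauss_poly c0 1 (fun t y => w t ^+ n * E t y) by exact: H.
  elim: n => [|n IH].
    by apply: gauss_poly_eq (gauss_poly_exp _ _ _) _ => t y; rewrite expr0 mul1r.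
  by apply: gauss_poly_eq (gauss_poly_inv IH) _ => t y; rewrite exprS mulrA.
have Gu t : has_gradient (fun=> True) (u t) (fun j y => - (w t * (w t * (y j * u t y)))).
  have H := gradient_scale (w t ^+ m) (gradient_gaussian c0 1 t (J := J)).
  by apply: gradient_eq H _ => j y /=; rewrite /u -/w -/E; ring.
have dwn n (t : R) : 0 <= t <= 1 ->
    is_derive t 1 (fun t => w t ^+ n) (- (n%:R / 2 * w t ^+ n * w t ^+ 2)).
  move=> t01; have dw := derive_inv_scale c00 ler01 t01.
  elim: n => [|n IH].
    apply: derive_eq (derive_cst 1 t) _; by rewrite !mul0r oppr0.
  rewrite (_ : (fun t => _) = (fun t => w t * w t ^+ n)); last first.
    by apply/funext => v; rewrite exprS.
  apply: derive_eq (derive_mul dw IH) _.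
  by rewrite -/w -[n.+1%:R]natr1 [w t ^+ n.+1]exprS; field.
apply: (heat_function_gauss_poly c00 ler01 (u := u)
  (D1 := fun j t y => - 1 * (w t * (w t * (y j * u t y))))
  (D2 := fun j l t y => (j == l)%:R * (- 1 * (w t * (w t * u t y))) +
     w t * (w t * (w t * (w t * (y j * (y l * u t y))))))).
- move=> j; apply: gauss_poly_scale; do 2 apply: gauss_poly_inv.
  exact: gauss_poly_coord.
- move=> j l; apply: gauss_poly_add.
    by apply: gauss_poly_scale; apply: gauss_poly_scale; do 2 apply: gauss_poly_inv.
  by do 4 apply: gauss_poly_inv; do 2 apply: gauss_poly_coord.
- by move=> t t01; apply: gradient_eq (Gu t) _ => j y; rewrite mulN1r.
- move=> j t t01.
  have H := gradient_scale (- (w t * w t)) (gradient_mul (@gradient_coord R J j) (Gu t)).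
  rewrite (_ : (fun y : J -> R => _) = (fun y => - (w t * w t) * (y j * u t y))); last first.
    by apply/funext => y; ring.
  by apply: gradient_eq H _ => l y /=; rewrite eq_sym; ring.
- move=> t y t01.
  have H := derive_mul (dwn m t t01) (derive_gaussian c00 ler01 y t01).
  apply: derive_eq H _.
  rewrite -/w -/E.
  rewrite -(pair_bigA _ (fun j l => (j == l)%:R / 2 *
    ((j == l)%:R * (- 1 * (w t * (w t * u t y))) +
     w t * (w t * (w t * (w t * (y j * (y l * u t y)))))))) /=.
  have Ej j : \sum_l (j == l)%:R / 2 *
    ((j == l)%:R * (- 1 * (w t * (w t * u t y))) +
     w t * (w t * (w t * (w t * (y j * (y l * u t y)))))) =
    - (w t ^+ 2 * u t y / 2) + w t ^+ 4 * u t y / 2 * y j ^+ 2.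
    rewrite (bigD1 j)//= eqxx big1 => [|l]; last first.
      by rewrite eq_sym => /negPf ->; rewrite !mul0r.
    by rewrite addr0 /=; field.
  rewrite (eq_bigr _ (fun j _ => Ej j)).
  rewrite big_split/= -mulr_sumr sumr_const -/m -mulr_natr /u.
  by field.
Qed.

End NormalDistributionFunction.

(** * From smoothed distribution functions to the normal limit *)

Section NormalLimit.
Context {R : realType}.

Lemma Phi_ge0 (x : R) : 0 <= Phi x. Proof. exact: real_cdf_ge0. Qed.

Lemma Phi_le1 (x : R) : Phi x <= 1. Proof. exact: real_cdf_le1. Qed.

Lemma le_Phi (x y : R) : x <= y -> Phi x <= Phi y.
Proof. exact: real_cdf_nondecreasing. Qed.

Lemma continuous_Phi : continuous (@Phi R).
Proof.
move=> x; apply: differentiable_continuous; apply/derivable1_diffP.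
by have [] := derive_Phi x.
Qed.

Lemma Phi_tails (eta : R) : 0 < eta ->
  exists2 M, 0 < M & forall t, M <= t -> 1 - eta <= Phi t /\ Phi (- t) <= eta.
Proof.
move=> eta0.
have /cvgrPdist_le/(_ _ eta0)[M1 [_ H1]] := real_cdf_cvgy (@std_normal R).
have /cvgrPdist_le/(_ _ eta0)[M2 [_ H2]] := real_cdf_cvgNy (@std_normal R).
exists (1 + `|M1| + `|M2|); first by rewrite addrC ltr_wpDl// ltr_wpDr.
move=> t Mt; have n1 := ler_norm M1; have n2 := ler_norm (- M2).
have p1 : 0 <= `|M1| by []. have p2 : 0 <= `|M2| by [].
rewrite normrN in n2.
split.
- have := H1 t; rewrite /= => /(_ _)/ler_normlP[]; first by lra.
  by rewrite -/(Phi t); lra.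
- have := H2 (- t); rewrite /= => /(_ _)/ler_normlP[]; first by lra.
  by rewrite -/(Phi (- t)); lra.
Qed.

(** The point 0 is excluded because of the point mass when [kappa = 0]: the smoothed value there is
    [Phi 0] for every [e]. *)
Lemma centered_normal_cdf_limit (kappa y eta : R) : 0 <= kappa -> y != 0 -> 0 < eta ->
  exists2 e0, 0 < e0 & forall e, 0 < e < e0 ->
    `|Phi (y / Num.sqrt (e ^+ 2 + kappa)) - real_cdf (centered_normal kappa) y| <= eta.
Proof.
move=> k0 y0 eta0; rewrite /centered_normal; case: eqVneq => [->|kn0].
  have [M M0 HM] := Phi_tails eta0.
  exists (`|y| / M); first by rewrite divr_gt0// normr_gt0.
  move=> e /andP[e0 ee]; rewrite addr0 sqrtr_sqr (gtr0_norm e0).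
  have Mt : M <= `|y| / e by rewrite ler_pdivlMr// mulrC -ler_pdivlMr// ltW.
  have [h1 h2] := HM _ Mt.
  rewrite /real_cdf [X in fine X](_ : _ = (\1_(`]-oo, y]%classic) (0 : R))%:E)// indicE/=.
  have [yp|yn] := ltP 0 y.
    rewrite mem_set/=; last by rewrite /= in_itv/= ltW.
    rewrite gtr0_norm// in h1; have := Phi_le1 (y / e).
    by move=> h3; rewrite ler_norml; apply/andP; split; lra.
  rewrite memNset/=; last by rewrite in_itv/= leNgt lt_neqAle y0 yn.
  rewrite ler0_norm// mulNr opprK in h2; have := Phi_ge0 (y / e).
  by move=> h3; rewrite ler_norml; apply/andP; split; lra.
have kp : 0 < kappa by rewrite lt_neqAle eq_sym kn0.
rewrite normal_cdf_Phi ?sqrtr_gt0//.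
have : (fun e => Phi (y / Num.sqrt (e ^+ 2 + kappa))) @ (0 : R) -->
    Phi (y / Num.sqrt kappa).
  apply: (cvg_comp (fun e => y / Num.sqrt (e ^+ 2 + kappa)) Phi); last exact: continuous_Phi.
  apply: cvgM; first exact: cvg_cst.
  apply: cvgV; first by rewrite gt_eqF// sqrtr_gt0.
  have H : (fun e : R => e ^+ 2 + kappa) @ (0 : R) --> kappa.
    rewrite -[X in _ --> X]add0r; apply: cvgD; last exact: cvg_cst.
    rewrite -[X in _ --> X](expr0n R 2); exact: sqr_continuous.
  exact: (cvg_comp (fun e : R => e ^+ 2 + kappa) Num.sqrt H (@sqrt_continuous _ _)).
move=> /cvgrPdist_le/(_ _ eta0)/nbhs_ballP[e0 /= e00 H].
exists e0 => // e /andP[e1 e2]; rewrite distrC; apply: H.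
by rewrite /ball/= sub0r normrN gtr0_norm.
Qed.

Variables (d : measure_display) (Omega : measurableType d).
Variables (P : probability Omega R) (V S : nat -> Omega -> R) (kappa : R).

(** The indicator of [V n <= x] is squeezed between smoothed indicators of [S n] shifted by [2 dl].
    One [dl] pays for the distance from [V n] to [S n], by Markov's inequality, and one for the
    width of the smoothing, by the tails of [Phi]. *)
Lemma cvg_in_distribution_normal : 0 <= kappa ->
  (forall n, simple_rv (V n)) -> (forall n, simple_rv (S n)) ->
  (fun n => mean P (fun w => `|V n w - S n w|)) @ \oo --> (0 : R) ->
  (forall e x, 0 < e ->
    (fun n => mean P (fun w => Phi ((x - S n w) / e))) @ \oo -->
      Phi (x / Num.sqrt (e ^+ 2 + kappa))) ->
  cvg_in_distribution P V (centered_normal kappa).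
Proof.
move=> k0 sV sS VS clt x.
have -> : (fun t : R => centered_normal kappa `]-oo, t]%classic) =
    EFin \o real_cdf (centered_normal kappa).
  by apply/funext => t; rewrite real_cdfE.
rewrite real_cdfE => /fine_cvgP[_ /= Fx].
under eq_fun do rewrite simple_le_prob//.
apply: cvg_EFin; first by near=> n.
apply/cvgrPdist_le => eta' eta'0.
set F := real_cdf _.
(* Five errors add up: convergence of the smoothed means, removal of the smoothing in the limit,
   continuity of [F] at [x], the tail of [Phi], and Markov's inequality. *)
pose eta := eta' / 5.
have eta0 : 0 < eta by rewrite divr_gt0.
have /cvgrPdist_le/(_ _ eta0)/nbhs_ballP[d0 /= d00 Hd] := Fx.
(* The shifted points must avoid 0, where the limit law may have an atom. *)
have [dl [dl0 dld0 xp xm]] : exists dl, [/\ 0 < dl, 2 * dl < d0,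
    x + 2 * dl != 0 & x - 2 * dl != 0].
  have [->|x0] := eqVneq x 0.
    exists (d0 / 4); rewrite add0r sub0r oppr_eq0.
    by split; [lra|lra|apply: lt0r_neq0; lra|apply: lt0r_neq0; lra].
  have ax : 0 < `|x| by rewrite normr_gt0.
  exists (Num.min d0 `|x| / 4).
  have m0 : 0 < Num.min d0 `|x| by rewrite lt_min d00.
  have m1 : Num.min d0 `|x| <= d0 by rewrite ge_min lexx.
  have m2 : Num.min d0 `|x| <= `|x| by rewrite ge_min lexx orbT.
  move: (Num.min d0 `|x|) m0 m1 m2 => m m0 m1 m2.
  split; [lra|lra| |].
    have [xp|xn] := ltP 0 x; first by apply: lt0r_neq0; lra.
    have xlt : x < 0 by rewrite lt_neqAle x0 xn.
    by rewrite ltr0_norm// in m2; apply: ltr0_neq0; lra.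
  have [xp|xn] := ltP 0 x; last by apply: ltr0_neq0; lra.
  by rewrite gtr0_norm// in m2; apply: lt0r_neq0; lra.
have [M M0 HM] := Phi_tails eta0.
have [e1 e10 He1] := centered_normal_cdf_limit k0 xp eta0.
have [e2 e20 He2] := centered_normal_cdf_limit k0 xm eta0.
have [e [e0 ee1 ee2 eM]] : exists e, [/\ 0 < e, e < e1, e < e2 & M <= dl / e].
  pose m := Num.min (Num.min e1 e2) (dl / M).
  have m0 : 0 < m by rewrite !lt_min e10 e20 divr_gt0.
  have m1 : m <= e1 by rewrite /m !ge_min lexx.
  have m2 : m <= e2 by rewrite /m !ge_min lexx orbT.
  have m3 : m <= dl / M by rewrite /m ge_min lexx orbT.
  exists (m / 2); split; [lra|lra|lra|].
  rewrite ler_pdivlMr ?divr_gt0// mulrC -ler_pdivlMr//; lra.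
have [T1 T2] := HM _ eM.
have E1 := He1 e; rewrite e0 ee1 in E1; have {}E1 := E1 isT.
have E2 := He2 e; rewrite e0 ee2 in E2; have {}E2 := E2 isT.
have F1 : `|F x - F (x + 2 * dl)| <= eta.
  by apply: Hd; rewrite /ball/= opprD addrA subrr sub0r normrN gtr0_norm//; lra.
have F2 : `|F x - F (x - 2 * dl)| <= eta.
  by apply: Hd; rewrite /ball/= opprB addrC subrK gtr0_norm//; lra.
have up w n : (V n w <= x)%R%:R <= Phi ((x + 2 * dl - S n w) / e) +
    ((1 - Phi (dl / e)) + dl^-1 * `|V n w - S n w|).
  have a0 := Phi_ge0 ((x + 2 * dl - S n w) / e).
  have a1 := Phi_le1 (dl / e).
  have a2 : 0 <= dl^-1 * `|V n w - S n w| by rewrite mulr_ge0// invr_ge0 ltW.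
  have [vx|vx] /= := leP (V n w) x; last by lra.
  have [vs|vs] := leP dl `|V n w - S n w|.
    have : 1 <= dl^-1 * `|V n w - S n w| by rewrite ler_pdivlMl// mulr1.
    by lra.
  have : Phi (dl / e) <= Phi ((x + 2 * dl - S n w) / e).
    apply: le_Phi; rewrite ler_pM2r ?invr_gt0//.
    by move: vs; rewrite ltr_norml => /andP[]; lra.
  by lra.
have lo w n : Phi ((x - 2 * dl - S n w) / e) +
    (- Phi (- (dl / e)) + (- dl^-1) * `|V n w - S n w|) <= (V n w <= x)%R%:R.
  have a0 := Phi_le1 ((x - 2 * dl - S n w) / e).
  have a1 := Phi_ge0 (- (dl / e)).
  have a2 : 0 <= dl^-1 * `|V n w - S n w| by rewrite mulr_ge0// invr_ge0 ltW.
  have [vx|vx] /= := leP (V n w) x; first by lra.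
  have [vs|vs] := leP dl `|V n w - S n w|.
    have : 1 <= dl^-1 * `|V n w - S n w| by rewrite ler_pdivlMl// mulr1.
    by lra.
  have : Phi ((x - 2 * dl - S n w) / e) <= Phi (- (dl / e)).
    apply: le_Phi; rewrite -[- (dl / e)]mulNr ler_pM2r ?invr_gt0//.
    by move: vs; rewrite ltr_norml => /andP[]; lra.
  by lra.
have sPhi y n : simple_rv (fun w => Phi ((y - S n w) / e)).
  exact: (simple_map (fun s => Phi ((y - s) / e)) (sS n)).
have sI n : simple_rv ((fun v : R => (v <= x)%R%:R : R) \o V n).
  exact: simple_map.
have sD n : simple_rv (fun w => `|V n w - S n w|).
  exact: (simple_map2 (fun v s => `|v - s|) (sV n) (sS n)).
have C1 := clt e (x + 2 * dl) e0; have C2 := clt e (x - 2 * dl) e0.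
near=> n.
have N1 : `|Phi ((x + 2 * dl) / Num.sqrt (e ^+ 2 + kappa)) -
    mean P (fun w => Phi ((x + 2 * dl - S n w) / e))| <= eta.
  by near: n; move/cvgrPdist_le : C1; apply.
have N2 : `|Phi ((x - 2 * dl) / Num.sqrt (e ^+ 2 + kappa)) -
    mean P (fun w => Phi ((x - 2 * dl - S n w) / e))| <= eta.
  by near: n; move/cvgrPdist_le : C2; apply.
have N3 : dl^-1 * mean P (fun w => `|V n w - S n w|) <= eta.
  rewrite ler_pdivrMl//; near: n.
  have de : 0 < dl * eta by rewrite mulr_gt0.
  move/cvgrPdist_le : VS => /(_ _ de); apply: filterS => n.
  by rewrite sub0r normrN; exact: le_trans (ler_norm _).
have := le_mean P (sI n) _ (up^~ n).
rewrite meanD//; last by apply: simpleD; [exact: simple_cst|exact: simpleZ].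
rewrite meanD//; [|exact: simple_cst|exact: simpleZ].
rewrite mean_cst meanZ// => /(_ _) U.
have {}U := U (simpleD (sPhi _ n) (simpleD (simple_cst _) (simpleZ _ (sD n)))).
have := le_mean P _ (sI n) (lo^~ n).
rewrite meanD//; last by apply: simpleD; [exact: simple_cst|exact: simpleZ].
rewrite meanD//; [|exact: simple_cst|exact: simpleZ].
rewrite mean_cst meanZ// => /(_ _) L.
have {}L := L (simpleD (sPhi _ n) (simpleD (simple_cst _) (simpleZ _ (sD n)))).
move: N1 N2 E1 E2 F1 F2; rewrite !ler_norml -/F.
move=> /andP[? ?] /andP[? ?] /andP[? ?] /andP[? ?] /andP[? ?] /andP[? ?].
have : eta' = 5 * eta by rewrite /eta; field.
by move=> ->; apply/andP; split; lra.
Unshelve. all: by end_near. Qed.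

End NormalLimit.

(** * Laplace transforms and the chi-squared law *)

Section ChiSquared.
Context {R : realType}.

Lemma integral_std_normal (f : R -> R) : measurable_fun setT f ->
  (forall x, 0 <= f x <= 1) ->
  (\int[normal_prob (0 : R) (1 : R)]_x (f x)%:E =
   \int[lebesgue_measure]_x (f x * normal_pdf 0 1 x)%:E)%E.
Proof.
move=> mf f01.
have intf : (normal_prob (0 : R) (1 : R)).-integrable setT (EFin \o f).
  apply: (@le_integrable _ _ _ _ _ _ _ (cst 1%E)) => //.
  - exact/measurable_EFinP.
  - move=> x _ /=; rewrite normr1 lee_fin; have /andP[f0 f1] := f01 x.
    by rewrite ger0_norm.
  - exact: finite_measure_integrable_cst.
rewrite -(Radon_Nikodym_change_of_variables (normal_prob_dominates 0 1))//=.
apply: ae_eq_integral => //.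
- apply: emeasurable_funM => //; first exact/measurable_EFinP.
  apply: (measurable_int lebesgue_measure).
  by apply: Radon_Nikodym_integrable; exact: normal_prob_dominates.
- apply/measurable_EFinP; apply: measurable_funM => //.
  exact: measurable_normal_pdf.
- under [X in ae_eq _ _ _ X]eq_fun do rewrite EFinM.
  apply: ae_eqe_mul2l => /=.
  apply: integral_ae_eq => //=.
  + by apply: Radon_Nikodym_integrable; exact: normal_prob_dominates.
  + by apply/measurable_EFinP; exact: measurable_normal_pdf.
  + move=> E _ mE; rewrite -Radon_Nikodym_integral//.
    exact: normal_prob_dominates.
Qed.

(** The exponential times the standard density is [v] times the centered normal density of standard
    deviation [v], with [v = (1 + 2 c)^(-1/2)]. *)
Lemma normal_laplace_square (c : R) : 0 <= c ->
  (\int[normal_prob (0 : R) (1 : R)]_x (expR (- (c * x ^+ 2)))%:E =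
   ((Num.sqrt (1 + 2 * c))^-1)%:E)%E.
Proof.
move=> c0; pose v : R := (Num.sqrt (1 + 2 * c))^-1.
have c1 : 0 < 1 + 2 * c by lra.
have v0 : 0 < v by rewrite invr_gt0 sqrtr_gt0.
have vv : v ^+ 2 = (1 + 2 * c)^-1 by rewrite exprVn sqr_sqrtr// ltW.
have key (a : R) : - (c * a) + - a / (1 ^+ 2 *+ 2) = - a / (v ^+ 2 *+ 2).
  by rewrite vv expr1n -[_^-1 *+ 2]mulr_natr invfM invrK; field.
have pk : v * normal_peak v = normal_peak 1.
  rewrite /normal_peak expr1n mul1r -mulrnAr sqrtrM ?sqr_ge0// sqrtr_sqr gtr0_norm//.
  by rewrite invfM mulrA mulfV ?mul1r// gt_eqF.
rewrite integral_std_normal; last 2 first.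
- apply: measurableT_comp => //; apply: measurableT_comp => //.
  by apply: measurable_funM => //; exact: measurable_funX.
- move=> x; rewrite expR_ge0 -expR0 ler_expR oppr_le0 mulr_ge0// sqr_ge0//.
transitivity (\int[lebesgue_measure]_x (v%:E * (normal_pdf 0 v x)%:E))%E; last first.
  rewrite integralZl//; last exact: integrable_normal_pdf.
  by rewrite integral_normal_pdf mule1.
apply: eq_integral => x _; rewrite -EFinM; congr EFin.
rewrite !normal_pdfE ?oner_neq0 ?lt0r_neq0// /normal_fun !subr0.
rewrite [RHS]mulrA pk mulrCA -expRD; congr (_ * expR _).
exact: key.
Qed.

Lemma chi_squared_lt0 s : chi_squared R s `]-oo, 0[%classic = 0%E.
Proof.
elim: s => [|s IH] /=.
  rewrite diracE memNset//= in_itv/= ltxx //.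
apply/eqP; rewrite eq_le measure_ge0 andbT -IH.
rewrite /distribution /pushforward /=.
apply: (@le_trans _ _ ((chi_squared R s \x normal_prob (0 : R) (1 : R))%E
  (`]-oo, 0[%classic `*` setT))).
  apply: le_measure; rewrite ?inE.
  - by rewrite -[X in measurable X]setTI; exact: measurable_add_square.
  - exact: measurableX.
  - move=> [x y] /=; rewrite !in_itv/= /add_square/= => xy; split=> //.
    by rewrite (le_lt_trans _ xy)// lerDl sqr_ge0.
rewrite product_measure1E// [X in (_ * X)%E](_ : _ = 1%E) ?mule1//.
exact: (@probability_setT _ _ _ (normal_prob (0 : R) (1 : R) : probability _ _)).
Qed.

Lemma chi_squared_laplace (c : R) s : 0 <= c ->
  (\int[chi_squared R s]_x (expR (- (c * x)))%:E =
   ((Num.sqrt (1 + 2 * c))^-1 ^+ s)%:E)%E.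
Proof.
move=> c0.
have mE : measurable_fun (setT : set (measurableTypeR R))
    (fun x : R => (expR (- (c * x)))%:E).
  apply/measurable_EFinP; apply: measurableT_comp => //.
  by apply: measurableT_comp => //; exact: measurable_funM.
elim: s => [|s IH] /=.
  by rewrite integral_dirac//= diracT mul1e mulr0 oppr0 expR0 expr0.
rewrite ge0_integral_distribution//=.
rewrite (@fubini_tonelli1 _ _ _ _ _ _ _ (fun z : measurableTypeR R * measurableTypeR R =>
   (expR (- (c * add_square z)))%:E))/=; last 2 first.
- apply: measurableT_comp mE _; exact: measurable_add_square.
- by move=> x; rewrite lee_fin expR_ge0.
rewrite /fubini_F /add_square/=.
have inner (x : R) : (\int[normal_prob (0 : R) (1 : R)]_y (expR (- (c * (x + y ^+ 2))))%:E =
    ((Num.sqrt (1 + 2 * c))^-1)%:E * (expR (- (c * x)))%:E)%E.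
  transitivity (\int[normal_prob (0 : R) (1 : R)]_y
      ((expR (- (c * x)))%:E * (expR (- (c * y ^+ 2)))%:E))%E.
    by apply: eq_integral => y _; rewrite -EFinM -expRD mulrDr opprD.
  rewrite ge0_integralZl ?lee_fin ?expR_ge0//.
  - by rewrite normal_laplace_square// muleC.
  - apply/measurable_EFinP; apply: measurableT_comp => //; apply: measurableT_comp => //.
    by apply: measurable_funM => //; exact: measurable_funX.
transitivity (\int[chi_squared R s]_x (((Num.sqrt (1 + 2 * c))^-1)%:E *
    (expR (- (c * x)))%:E))%E.
  by apply: eq_integral => x _; exact: inner.
rewrite ge0_integralZl ?lee_fin ?invr_ge0 ?sqrtr_ge0//.
by rewrite IH -EFinM exprS.
Qed.

End ChiSquared.

(** * From Laplace transforms to convergence in distribution *)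

Section LaplaceLimit.
Context {R : realType}.

(** By the binomial formula this is a finite combination of exponentials [exp (- i c y)], so its
    mean is determined by the Laplace transform and passes to the limit with it. *)
Definition soft_indicator (c : R) (M : nat) (y : R) : R := 1 - (1 - expR (- (c * y))) ^+ M.

Lemma soft_indicatorE c M y :
  soft_indicator c M y = \sum_(i < M.+1)
    ((i == 0%N :> nat)%:R - (-1) ^+ i *+ 'C(M, i)) * expR (- (i%:R * c * y)).
Proof.
rewrite /soft_indicator exprBn.
under [RHS]eq_bigr do rewrite mulrBl.
have E1 : \sum_(i < M.+1) (i == 0%N :> nat)%:R * expR (- (i%:R * c * y)) = 1.
  rewrite big_ord_recl big1 => [|i _]; last by rewrite lift0 mul0r.
  by rewrite /= !mul0r oppr0 expR0 mul1r addr0.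
rewrite sumrB E1; congr (_ - _); apply: eq_bigr => i _.
have -> : - (i%:R * c * y) = i%:R * - (c * y) by ring.
by rewrite expRM_natl expr1n mulr1 mulrnAl.
Qed.

Lemma soft_indicator_bounds c M y : 0 <= c -> 0 <= y -> 0 <= soft_indicator c M y <= 1.
Proof.
move=> c0 y0.
have e0 : 0 <= expR (- (c * y)) by exact: expR_ge0.
have e1 : expR (- (c * y)) <= 1 by rewrite -expR0 ler_expR oppr_le0 mulr_ge0.
apply/andP; split; rewrite /soft_indicator.
  by rewrite subr_ge0 exprn_ile1//; lra.
by rewrite gerBl exprn_ge0//; lra.
Qed.

(* [(1 - t ^ N) ^ (2 ^ N)] with [t = expR (- l y)] passes from 0 to 1 at [t = 1/2] *)
Lemma soft_indicator_exists (z dl eta : R) : 0 < z -> 0 < dl -> 0 < eta ->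
  exists c M, 0 < c /\ forall y, 0 <= y ->
    (y <= z - dl -> 1 - eta <= soft_indicator c M y) /\
    (z + dl <= y -> soft_indicator c M y <= eta).
Proof.
move=> z0 dl0 eta0.
have ln2 : 0 < ln (2 : R) by rewrite ln_gt0// ltr1n.
pose l := ln (2 : R) / z.
have l0 : 0 < l by rewrite divr_gt0.
have [N NP] : exists N : nat, (0 < N)%N /\ (l * dl * eta)^-1 <= N%:R.
  exists (Num.truncn ((l * dl * eta)^-1)).+1; split=> //.
  by rewrite ltW// truncnS_gt.
case: NP => N0 NP.
have ldl : 0 < l * dl by rewrite mulr_gt0.
have small : expR (- (N%:R * (l * dl))) <= eta.
  rewrite expRN -[leRHS]invrK lef_pV2 ?posrE ?expR_gt0 ?invr_gt0//.
  apply: le_trans (expR_ge1Dx _); apply: ler_wpDl => //.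
  by rewrite -ler_pdivrMr// -invfM mulrC.
exists (N%:R * l), (2 ^ N)%N; split; first by rewrite mulr_gt0// ltr0n.
move=> y y0; set t := expR (- (N%:R * l * y)).
have Nl0 : 0 <= N%:R * l by rewrite mulr_ge0 ?ler0n// ltW.
have t0 : 0 < t by exact: expR_gt0.
have t1 : t <= 1.
  by rewrite /t -[leRHS]expR0 ler_expR oppr_le0 mulr_ge0// mulr_ge0 ?ler0n// ltW.
have M1 : (1 <= 2 ^ N)%N by rewrite expn_gt0.
(* The choice [l = ln 2 / z] puts the switch at [y = z]: this product is at least [exp (N l dl)] for
   [y <= z - dl] and at most [exp (- N l dl)] for [y >= z + dl]. *)
have tE : (2 ^ N)%:R * t = expR (N%:R * l * (z - y)).
  rewrite mulrBr expRD -/t; congr (_ * _).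
  rewrite natrX -[in LHS](@lnK _ 2) ?posrE// -expRM_natl; congr expR.
  by rewrite /l -mulrA divfK// gt_eqF.
rewrite /soft_indicator -/t; split=> yz.
  rewrite lerD2l lerN2.
  apply: (@le_trans _ _ (expR (- ((2 ^ N)%:R * t)))).
    rewrite -mulrN expRM_natl lerXn2r ?nnegrE ?expR_ge0 ?subr_ge0//.
    exact: expR_ge1Dx.
  apply: le_trans small; rewrite ler_expR lerN2 tE.
  have : N%:R * l * dl <= N%:R * l * (z - y).
    by apply: ler_wpM2l => //; lra.
  rewrite mulrA => /le_trans; apply.
  by apply: le_trans (expR_ge1Dx _); rewrite ler_wpDl.
(* Bernoulli's inequality; on the other side of the switch [1 - t <= exp (- t)] was used. *)
have bern : 1 - (2 ^ N)%:R * t <= (1 - t) ^+ (2 ^ N).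
  elim: (2 ^ N)%N => [|n IH]; first by rewrite mul0r subr0 expr0.
  rewrite exprS (le_trans _ (ler_wpM2l _ IH)) ?subr_ge0//.
  rewrite -natr1; have : 0 <= n%:R * t ^+ 2 by rewrite mulr_ge0 ?sqr_ge0.
  by nra.
have : (2 ^ N)%:R * t <= eta; last by lra.
rewrite tE; apply: le_trans small; rewrite ler_expR.
have : N%:R * l * (z - y) <= N%:R * l * (- dl).
  by apply: ler_wpM2l => //; lra.
by rewrite mulrN mulrA.
Qed.

Variables (mu : probability (measurableTypeR R) R) (ell : R -> R).
Hypothesis mu_lt0 : mu `]-oo, 0[%classic = 0%E.
Hypothesis laplace : forall c, 0 <= c ->
  (\int[mu]_x (expR (- (c * x)))%:E = (ell c)%:E)%E.

(** Soft indicators are known to stay in [[0, 1]] only for nonnegative arguments, so they are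
    compared with indicators on the half line, which carries all of [mu]. *)
Let half_line : set (measurableTypeR R) := `[0, +oo[%classic.

Let half_lineE : half_line = setT `\` `]-oo, 0[%classic.
Proof.
by apply/seteqP; split=> x /=; rewrite /half_line/= !in_itv/= ?andbT;
  [move=> x0; split=> //; rewrite ltNge x0|move=> [_ /negP]; rewrite -leNgt].
Qed.

Definition laplace_soft (c : R) (M : nat) : R := \sum_(i < M.+1)
  ((i == 0%N :> nat)%:R - (-1) ^+ i *+ 'C(M, i)) * ell (i%:R * c).

Let measurable_exp c : measurable_fun (setT : set (measurableTypeR R))
  (fun x : R => expR (- (c * x))).
Proof.
apply: measurableT_comp => //; apply: measurableT_comp => //.
Qed.

Let integrable_exp c : 0 <= c -> mu.-integrable setT (fun x => (expR (- (c * x)))%:E).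
Proof.
move=> c0; apply/integrableP; split.
  by apply/measurable_EFinP; exact: measurable_exp.
under eq_integral do rewrite /= ger0_norm ?expR_ge0//.
by rewrite laplace// ltry.
Qed.

Let integrable_soft c M : 0 <= c ->
  mu.-integrable setT (fun x => (soft_indicator c M x)%:E).
Proof.
move=> c0; under eq_fun do rewrite soft_indicatorE -sumEFin.
apply: integrable_sum => // i _.
under eq_fun do rewrite EFinM.
by apply: integrableZl => //; apply: integrable_exp; rewrite mulr_ge0.
Qed.

Let integral_soft c M : 0 <= c ->
  (\int[mu]_(x in half_line) (soft_indicator c M x)%:E = (laplace_soft c M)%:E)%E.
Proof.
move=> c0; rewrite half_lineE -negligible_integral//; last exact: integrable_soft.
under eq_integral do rewrite soft_indicatorE -sumEFin.
rewrite integral_sum//; last first.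
  move=> i; under eq_fun do rewrite EFinM.
  by apply: integrableZl => //; apply: integrable_exp; rewrite mulr_ge0.
rewrite /laplace_soft -sumEFin; apply: eq_bigr => i _.
under eq_integral do rewrite EFinM.
rewrite integralZl//; last by apply: integrable_exp; rewrite mulr_ge0.
by rewrite laplace ?mulr_ge0// EFinM.
Qed.

Let integral_step b eta : (\int[mu]_(x in half_line) ((x <= b)%R%:R + eta)%:E =
  (real_cdf mu b + eta)%:E)%E.
Proof.
have mh : measurable half_line by exact: measurable_itv.
have mu1 : mu half_line = 1%E.
  rewrite half_lineE setTD; have := @probability_setC _ _ _ mu `]-oo, 0[%classic.
  by move=> -> //; rewrite [X in (_ - X)%E]mu_lt0 sube0.
under eq_integral do rewrite EFinD.
rewrite (eq_integral (fun x =>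
  (\1_(`]-oo, b]%classic : set (measurableTypeR R)) x)%:E + eta%:E)%E); last first.
  move=> x _; rewrite indicE; congr ((nat_of_bool _)%:R%:E + _)%E; apply/idP/idP.
    by move=> xb; rewrite mem_set//= in_itv.
  by move=> /set_mem; rewrite /= in_itv.
rewrite integralD//; last 2 first.
- apply: (@integrableS _ _ _ mu setT) => //; exact: integrable_indic.
- apply: finite_measure_integrable_cst.
- exact: mh.
rewrite EFinD -real_cdfE; congr (_ + _)%E; last first.
  by apply: etrans (integral_cst mu mh eta%:E) _; rewrite [X in (_ * X)%E]mu1 mule1.
rewrite integral_indic//.
have mb : measurable (`]-oo, b]%classic : set (measurableTypeR R)) by exact: measurable_itv.
rewrite [RHS](measureDI mu mb mh) [X in _ = (X + _)%E](_ : _ = 0%E) ?add0e//.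
apply/eqP; rewrite eq_le measure_ge0 andbT -[leRHS]mu_lt0.
apply: le_measure; rewrite ?inE//; first exact: measurableD.
by move=> x /= [_]; rewrite /half_line /= !in_itv/= andbT => /negP; rewrite -ltNge.
Qed.

Variables (d : measure_display) (Omega : measurableType d).
Variables (P : probability Omega R) (V : nat -> Omega -> R).

(** A soft indicator that switches within [2 dl] of [x] is compared twice, with the indicator of
    [V n <= x] and with an indicator under [mu]; [dl] and [eta] are fixed before [n] grows. *)
Lemma cvg_in_distribution_laplace :
  (forall n, simple_rv (V n)) -> (forall n w, 0 <= V n w) ->
  (forall c, 0 <= c ->
    (fun n => mean P (fun w => expR (- (c * V n w)))) @ \oo --> ell c) ->
  cvg_in_distribution P V mu.
Proof.
move=> sV V0 lap x.
have -> : (fun t : R => mu `]-oo, t]%classic) = EFin \o real_cdf mu.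
  by apply/funext => t; rewrite real_cdfE.
rewrite real_cdfE => /fine_cvgP[_ /= Fx].
under eq_fun do rewrite simple_le_prob//.
apply: cvg_EFin; first by near=> n.
have sE c n : simple_rv (fun w => expR (- (c * V n w))).
  exact: (simple_map (fun v => expR (- (c * v))) (sV n)).
have lapS c M : 0 <= c ->
    (fun n => mean P (fun w => soft_indicator c M (V n w))) @ \oo --> laplace_soft c M.
  move=> c0.
  under eq_fun => n.
    rewrite (_ : (fun w => _) = (fun w => \sum_(i < M.+1)
      ((i == 0%N :> nat)%:R - (-1) ^+ i *+ 'C(M, i)) * expR (- (i%:R * c * V n w)))); last first.
      by apply/funext => w; rewrite soft_indicatorE.
    rewrite mean_sum; last by move=> i; exact: simpleZ.
    over.
  apply: cvg_sumr => i; under eq_fun do rewrite meanZ//.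
  by apply: cvgMl_tmp; apply: lap; rewrite mulr_ge0.
have sI n : simple_rv ((fun v : R => (v <= x)%R%:R : R) \o V n).
  exact: simple_map.
have sS c M n : simple_rv (fun w => soft_indicator c M (V n w)).
  exact: (simple_map (soft_indicator c M) (sV n)).
have Fneg y : y < 0 -> real_cdf mu y = 0.
  move=> y0; apply/eqP; rewrite eq_le real_cdf_ge0 andbT -lee_fin -real_cdfE -[leRHS]mu_lt0.
  apply: le_measure; rewrite ?inE//.
  by move=> z /=; rewrite !in_itv/= => /le_lt_trans; apply.
have mh : measurable half_line by exact: measurable_itv.
have integrable_step b eta : mu.-integrable half_line (fun x => ((x <= b)%R%:R + eta)%:E).
  apply: (@integrableS _ _ _ mu setT) => //.
  under eq_fun do rewrite EFinD.
  apply: integrableD => //; last exact: finite_measure_integrable_cst.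
  rewrite (_ : (fun x => _) = (fun x => (\1_(`]-oo, b]%classic : set (measurableTypeR R)) x)%:E)).
    exact: integrable_indic.
  apply/funext => y; rewrite indicE; congr ((nat_of_bool _)%:R%:E); apply/idP/idP.
    by move=> xb; rewrite mem_set//= in_itv.
  by move=> /set_mem; rewrite /= in_itv.
have integrable_softh c M : 0 <= c ->
    mu.-integrable half_line (fun x => (soft_indicator c M x)%:E).
  by move=> c0; apply: (@integrableS _ _ _ mu setT) => //; exact: integrable_soft.
have half0 y : half_line y -> 0 <= y by rewrite /half_line/= in_itv/= andbT.
apply/cvgrPdist_le => eta' eta'0.
set F := real_cdf mu in Fx *.
(* Four errors: continuity of [F], the two comparisons with the soft indicator, and convergence of
   its means. *)
pose eta := eta' / 4.
have eta0 : 0 < eta by rewrite divr_gt0.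
have /cvgrPdist_le/(_ _ eta0)/nbhs_ballP[d0 /= d00 Hd] := Fx.
have pn0 n : 0 <= mean P (fun w => (V n w <= x)%R%:R).
  by apply: mean_ge0 => [|w]; [exact: sI|rewrite ler0n].
suff [lower upper] : (\forall n \near \oo, F x - eta' <= mean P (fun w => (V n w <= x)%R%:R)) /\
    (\forall n \near \oo, mean P (fun w => (V n w <= x)%R%:R) <= F x + eta').
  near=> n; rewrite ler_distlC; apply/andP; split; near: n => //.
have etaE : eta' = 4 * eta by rewrite /eta; field.
split.
(* A switch needs a positive threshold. For [x <= 0] the lower bound is trivial: [F] vanishes at
   [x - d0 / 2], so continuity makes [F x] at most [eta]. *)
- have [x0|x0] := leP x 0.
    near=> n; apply: le_trans (pn0 n).
    have : `|F x - F (x - d0 / 2)| <= eta.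
      by apply: Hd; rewrite /ball/= opprB addrC subrK gtr0_norm; lra.
    have -> : F (x - d0 / 2) = 0 by apply: Fneg; lra.
    by rewrite subr0 => /(le_trans (ler_norm _)) ?; lra.
  pose dl := Num.min d0 x / 4.
  have m0 : 0 < Num.min d0 x by rewrite lt_min d00.
  have m1 : Num.min d0 x <= d0 by rewrite ge_min lexx.
  have m2 : Num.min d0 x <= x by rewrite ge_min lexx orbT.
  have dl0 : 0 < dl by rewrite divr_gt0.
  have dl1 : 4 * dl <= d0 by rewrite /dl; lra.
  have dl2 : 4 * dl <= x by rewrite /dl; lra.
  have [c [M [c0 H]]] := @soft_indicator_exists (x - dl) dl eta ltac:(lra) dl0 eta0.
  have HF : F (x - 2 * dl) - eta <= laplace_soft c M.
    rewrite -lee_fin -integral_soft ?(ltW c0)// -integral_step.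
    apply: le_integral => //; first exact: integrable_softh (ltW c0).
    move=> y /set_mem/half0 y0; rewrite lee_fin; have [H1 _] := H y y0.
    have /andP[s0 s1] := soft_indicator_bounds M (ltW c0) y0.
    case: (leP (y : R) (x - 2 * dl)) => yb /=; last by lra.
    have := H1 ltac:(lra); lra.
  have := lapS c M (ltW c0) => /cvgrPdist_le/(_ _ eta0); apply: filterS => n.
  have : mean P (fun w => soft_indicator c M (V n w) + - eta) <=
      mean P (fun w => (V n w <= x)%R%:R).
    apply: le_mean; [by apply: simpleD => //; exact: simple_cst|exact: sI|].
    move=> w; have [_ H2] := H _ (V0 n w).
    have /andP[s0 s1] := soft_indicator_bounds M (ltW c0) (V0 n w).
    case: (leP (V n w) x) => vx /=; first by lra.
    have := H2 ltac:(lra); lra.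
  rewrite meanD//; last exact: simple_cst.
  rewrite mean_cst.
  have : `|F x - F (x - 2 * dl)| <= eta.
    by apply: Hd; rewrite /ball/= opprB addrC subrK gtr0_norm; lra.
  rewrite !ler_norml => /andP[? ?] ? /andP[? ?]; lra.
- have [x0|x0] := ltP x 0.
    near=> n; rewrite (_ : (fun w => _) = fun=> 0).
      rewrite mean_cst; have := real_cdf_ge0 mu x; rewrite -/F; lra.
    apply/funext => w; case: leP => //= vx.
    by have := V0 n w; rewrite leNgt (le_lt_trans vx x0).
  pose dl := d0 / 4.
  have dl0 : 0 < dl by rewrite divr_gt0.
  have dl1 : 4 * dl <= d0 by rewrite /dl; lra.
  have [c [M [c0 H]]] := @soft_indicator_exists (x + dl) dl eta ltac:(lra) dl0 eta0.
  have HF : laplace_soft c M <= F (x + 2 * dl) + eta.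
    rewrite -lee_fin -integral_soft ?(ltW c0)// -integral_step.
    apply: le_integral => //; first exact: integrable_softh (ltW c0).
    move=> y /set_mem/half0 y0; rewrite lee_fin; have [_ H1] := H y y0.
    have /andP[s0 s1] := soft_indicator_bounds M (ltW c0) y0.
    case: (leP (y : R) (x + 2 * dl)) => yb /=; first by lra.
    have := H1 ltac:(lra); lra.
  have := lapS c M (ltW c0) => /cvgrPdist_le/(_ _ eta0); apply: filterS => n.
  have : mean P (fun w => (V n w <= x)%R%:R) <=
      mean P (fun w => soft_indicator c M (V n w) + eta).
    apply: le_mean; [exact: sI|by apply: simpleD => //; exact: simple_cst|].
    move=> w; have [H2 _] := H _ (V0 n w).
    have /andP[s0 s1] := soft_indicator_bounds M (ltW c0) (V0 n w).
    case: (leP (V n w) x) => vx /=; last by lra.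
    have := H2 ltac:(lra); lra.
  rewrite meanD//; last exact: simple_cst.
  rewrite mean_cst.
  have : `|F x - F (x + 2 * dl)| <= eta.
    by apply: Hd; rewrite /ball/= opprD addrA subrr sub0r normrN gtr0_norm; lra.
  rewrite !ler_norml => /andP[? ?] ? /andP[? ?]; lra.
Unshelve. all: by end_near. Qed.

End LaplaceLimit.

(** * Divergences and conditional mutual information *)

Section PmfImage.
Context {R : realType}.

Lemma sum_pmf_image (T U : finType) (p : T -> R) (g : T -> U) (f : U -> R) :
  \sum_u pmf_image p g u * f u = \sum_t p t * f (g t).
Proof.
rewrite /pmf_image; under eq_bigr do rewrite mulr_suml.
rewrite (exchange_big_dep xpredT)//=; apply: eq_bigr => t _.
by rewrite (big_pred1 (g t))// => u; rewrite eq_sym.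
Qed.

Lemma sum_pmf_image1 (T U : finType) (p : T -> R) (g : T -> U) :
  \sum_u pmf_image p g u = \sum_t p t.
Proof.
have := sum_pmf_image p g (fun=> 1).
by under eq_bigr do rewrite mulr1; under [X in _ = X]eq_bigr do rewrite mulr1.
Qed.

Lemma pmf_image_ge0 (T U : finType) (p : T -> R) (g : T -> U) u :
  (forall t, 0 <= p t) -> 0 <= pmf_image p g u.
Proof. by move=> p0; apply: sumr_ge0. Qed.

Lemma le_pmf_image (T U : finType) (p : T -> R) (g : T -> U) t :
  (forall t, 0 <= p t) -> p t <= pmf_image p g (g t).
Proof.
by move=> p0; rewrite /pmf_image (bigD1 t)//= lerDl sumr_ge0.
Qed.

Lemma pmf_image_comp (T U W : finType) (p : T -> R) (g : T -> U) (h : U -> W) w :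
  pmf_image (pmf_image p g) h w = pmf_image p (h \o g) w.
Proof.
have E (I : finType) (a : I -> R) (b : pred I) :
    \sum_(i | b i) a i = \sum_i a i * (b i)%:R.
  rewrite big_mkcond/=; apply: eq_bigr => i _.
  by case: (b i); rewrite ?mulr1 ?mulr0.
by rewrite /pmf_image E [RHS]E -(sum_pmf_image p g (fun u => (h u == w)%:R)).
Qed.

Lemma pmf_image_dist (T U : finType) (p q : T -> R) (g : T -> U) u :
  `|pmf_image q g u - pmf_image p g u| <= \sum_t `|q t - p t|.
Proof.
rewrite /pmf_image -sumrB (le_trans (ler_norm_sum _ _ _))//.
by rewrite big_mkcond/=; apply: ler_sum => t _; case: ifP.
Qed.

End PmfImage.

Section KullbackLeibler.
Context {R : realType}.

Lemma ln_le_sub1 (x : R) : 0 < x -> ln x <= x - 1.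
Proof.
move=> x0; rewrite -ler_expR lnK ?posrE//.
by apply: le_trans (expR_ge1Dx _); rewrite addrC subrK.
Qed.

Lemma ln_eq_sub1 (x : R) : 0 < x -> ln x = x - 1 -> x = 1.
Proof.
move=> x0 E; have [/eqP|n0] := boolP (x - 1 == 0); first by move=> ?; lra.
have := expR_gt1Dx n0; rewrite -E lnK ?posrE//; lra.
Qed.

Definition kl (T : finType) (q p : T -> R) : R := \sum_t q t * ln (q t / p t).

Definition chi2 (T : finType) (q p : T -> R) : R := \sum_t (q t - p t) ^+ 2 / p t.

Variable T : finType.
Variables p q : T -> R.
Hypotheses (p0 : forall t, 0 < p t) (q0 : forall t, 0 <= q t).
Hypothesis pq1 : \sum_t q t = \sum_t p t.

(** Apply [ln x <= x - 1] to [p / q], and to [q / p] for the upper bound that follows; the linear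
    terms cancel because the total masses agree. *)
Lemma kl_ge0 : 0 <= kl q p.
Proof.
have -> : 0 = \sum_t (q t - p t) by rewrite sumrB pq1 subrr.
apply: ler_sum => t _; have := q0 t; rewrite le_eqVlt => /orP[/eqP <-|qt].
  by rewrite mul0r sub0r oppr_le0 ltW.
have := @ln_le_sub1 (p t / q t) (divr_gt0 (p0 t) qt).
rewrite -[q t / p t]invf_div lnV ?posrE ?divr_gt0// mulrN => H.
rewrite -[leLHS]opprB lerN2.
have -> : p t - q t = q t * (p t / q t - 1) by field; rewrite gt_eqF.
by rewrite ler_wpM2l// ltW.
Qed.

Lemma kl_le_chi2 : kl q p <= chi2 q p.
Proof.
have -> : chi2 q p = \sum_t ((q t - p t) ^+ 2 / p t + (q t - p t)).
  by rewrite big_split/= sumrB pq1 subrr addr0.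
apply: ler_sum => t _.
have -> : (q t - p t) ^+ 2 / p t + (q t - p t) = q t * (q t / p t - 1).
  by field; rewrite gt_eqF.
have := q0 t; rewrite le_eqVlt => /orP[/eqP <-|qt]; first by rewrite !mul0r.
by rewrite ler_wpM2l//; apply: ln_le_sub1; rewrite divr_gt0.
Qed.

Lemma chi2_le (dist c : R) : (forall t, `|q t - p t| <= dist) ->
  (forall t, c <= p t) -> 0 < c -> chi2 q p <= #|T|%:R / c * dist ^+ 2.
Proof.
move=> qpd cp c0; rewrite mulrAC -mulrA mulr_natl -sumr_const.
apply: ler_sum => t _; apply: ler_pM; rewrite ?sqr_ge0 ?invr_ge0 ?(ltW (p0 t))//.
  rewrite -[leLHS]real_normK ?num_real// lerXn2r ?nnegrE//.
  exact: le_trans (qpd t).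
by rewrite lef_pV2 ?posrE.
Qed.

End KullbackLeibler.

Section LogExpansion.
Context {R : realType}.

Lemma xlnx_bounds (t : R) : 0 <= 1 + t ->
  0 <= (1 + t) * ln (1 + t) - t <= t ^+ 2.
Proof.
rewrite le_eqVlt => /orP[/eqP E|t1].
  by rewrite -E mul0r sub0r (_ : t = -1) ?sqrrN ?expr1n ?opprK ?ler01 ?lexx//; lra.
have H1 := ln_le_sub1 t1.
have := ln_le_sub1 (x := (1 + t)^-1); rewrite invr_gt0 t1 lnV ?posrE// => /(_ isT) H2.
have {H2} : (1 + t) * - ln (1 + t) <= (1 + t) * ((1 + t)^-1 - 1).
  by rewrite ler_wpM2l// ltW.
rewrite mulrBr mulfV ?gt_eqF// mulr1 mulrN => H2.
have : (1 + t) * ln (1 + t) <= (1 + t) * (1 + t - 1) by rewrite ler_wpM2l// ltW.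
move=> H3; apply/andP; split; [lra|nra].
Qed.

(** For [|t| >= 1/2] the crude bound by [t ^ 2] is already cubic. For smaller [t] the argument stays
    above [1/2], and the derivative [ln (1 + v) - v] of the Taylor remainder is at most [2 t ^ 2].
    The value [t = -1], an empty cell, is included. *)
Lemma xlnx_expansion (t : R) : 0 <= 1 + t ->
  `|2 * ((1 + t) * ln (1 + t) - t) - t ^+ 2| <= 4 * `|t| ^+ 3.
Proof.
move=> t1; have /andP[b1 b2] := xlnx_bounds t1.
have [tbig|tsmall] := leP 2^-1 `|t|.
  apply: (@le_trans _ _ (t ^+ 2)).
    by rewrite ler_norml; apply/andP; split; lra.
  rewrite -[t ^+ 2]real_normK ?num_real//.
  have : 0 <= `|t| ^+ 2 by exact: sqr_ge0.
  rewrite [`|t| ^+ 3]exprS; nra.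
pose f (v : R) := (1 + v) * ln (1 + v) - v - v ^+ 2 / 2.
have f0 : f 0 = 0 by rewrite /f addr0 ln1 expr0n/=; ring.
have df (v : R) : `|v| <= `|t| -> is_derive v 1 f (ln (1 + v) - v).
  move=> vt; have v1 : 0 < 1 + v.
    by move: vt; rewrite ler_norml => /andP[]; lra.
  have d1 : is_derive v 1 (fun v => 1 + v) 1.
    apply: derive_eq (derive_add (derive_cst 1 v) (derive_var v)) _.
    by rewrite add0r.
  have d2 := @derive_comp _ (@ln R) (fun v => 1 + v) _ _ _ (is_derive1_ln v1) d1.
  have d3 : is_derive v 1 (fun v => v ^+ 2 / 2) v.
    apply: derive_eq (derive_mul (derive_mul (derive_var v) (derive_var v))
      (derive_cst 2^-1 v)) _.
    by field.
  apply: derive_eq (derive_sub (derive_sub (derive_mul d1 d2) (derive_var v)) d3) _.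
  by field; rewrite gt_eqF.
have bf (v : R) : `|v| <= `|t| -> `|ln (1 + v) - v| <= 2 * `|t| ^+ 2.
  move=> vt; have vb : `|v| < 2^-1 by exact: le_lt_trans vt tsmall.
  have v1 : 2^-1 < 1 + v by move: vb; rewrite ltr_norml => /andP[]; lra.
  have v10 : 0 < 1 + v by lra.
  have H1 := ln_le_sub1 v10.
  have := ln_le_sub1 (x := (1 + v)^-1); rewrite invr_gt0 v10 lnV ?posrE// => /(_ isT) H2.
  have vv : v ^+ 2 <= `|t| ^+ 2.
    by rewrite -[leLHS]real_normK ?num_real// lerXn2r ?nnegrE.
  have H3 : (1 + v)^-1 - 1 <= - v + 2 * v ^+ 2.
    rewrite lerBlDr -[leLHS]mul1r ler_pdivrMr//; nra.
  by rewrite ler_norml; apply/andP; split; lra.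
have ft : `|f t| <= 2 * `|t| ^+ 3.
  rewrite [`|t| ^+ 3]exprSr mulrA.
  have [t0|t0] := leP 0 t.
    have := @mean_value_bound _ f (fun v => ln (1 + v) - v) 0 t (2 * `|t| ^+ 2) t0.
    rewrite f0 !subr0 => H; rewrite [X in _ * _ * X]ger0_norm//.
    apply: H => v /andP[v0 vt].
      by apply: df; rewrite !ger0_norm.
    by apply: bf; rewrite !ger0_norm.
  have := @mean_value_bound _ f (fun v => ln (1 + v) - v) t 0 (2 * `|t| ^+ 2) (ltW t0).
  rewrite f0 !sub0r normrN => H; rewrite [X in _ * _ * X]ltr0_norm//.
  apply: H => v /andP[v0 vt].
    by apply: df; rewrite (ltr0_norm t0) ler0_norm// lerN2.
  by apply: bf; rewrite (ltr0_norm t0) ler0_norm// lerN2.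
have -> : 2 * ((1 + t) * ln (1 + t) - t) - t ^+ 2 = 2 * f t by rewrite /f; field.
by rewrite normrM ger0_norm//; lra.
Qed.

(** The scalar expansion is applied to the relative deviations [x = (q - p) / p]; their linear terms
    sum to 0 since the masses agree. *)
Lemma kl_expansion (T : finType) (p q : T -> R) (dist c : R) :
  (forall t, 0 < p t) -> (forall t, 0 <= q t) -> \sum_t q t = \sum_t p t ->
  (forall t, `|q t - p t| <= dist) -> (forall t, c <= p t) -> 0 < c ->
  `|2 * kl q p - chi2 q p| <= 4 * #|T|%:R / c ^+ 2 * dist ^+ 3.
Proof.
move=> p0 q0 pq1 qpd cp c0.
pose x t := (q t - p t) / p t.
have x1 t : 1 + x t = q t / p t by rewrite /x; field; rewrite gt_eqF.
have -> : 2 * kl q p - chi2 q p =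
    \sum_t p t * (2 * ((1 + x t) * ln (1 + x t) - x t) - x t ^+ 2).
  have E : \sum_t (q t - p t) = 0 by rewrite sumrB pq1 subrr.
  have -> : 2 * kl q p - chi2 q p = 2 * kl q p - chi2 q p - 2 * \sum_t (q t - p t).
    by rewrite E mulr0 subr0.
  rewrite /kl /chi2 !mulr_sumr -!sumrB; apply: eq_bigr => t _.
  by rewrite x1 /x; field; rewrite gt_eqF.
rewrite (le_trans (ler_norm_sum _ _ _))//.
have -> : 4 * #|T|%:R / c ^+ 2 * dist ^+ 3 =
    \sum_(t : T) 4 / c ^+ 2 * dist ^+ 3.
  by rewrite sumr_const -[_ *+ #|T|]mulr_natr; ring.
apply: ler_sum => t _; rewrite normrM gtr0_norm//.
apply: (@le_trans _ _ (p t * (4 * `|x t| ^+ 3))).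
  by rewrite ler_wpM2l ?(ltW (p0 t))// xlnx_expansion// x1 divr_ge0// ltW.
have d0 : 0 <= dist by exact: le_trans (qpd t).
have -> : p t * (4 * `|x t| ^+ 3) = 4 / p t ^+ 2 * `|q t - p t| ^+ 3.
  rewrite /x normrM (gtr0_norm (x := (p t)^-1)) ?invr_gt0//.
  by field; rewrite gt_eqF.
apply: ler_pM; rewrite ?exprn_ge0 ?divr_ge0 ?exprn_ge0 ?(ltW (p0 t))//.
  rewrite ler_wpM2l// lef_pV2 ?posrE ?exprn_gt0// lerXn2r ?nnegrE ?(ltW c0)//.
  exact: ltW.
by rewrite lerXn2r// nnegrE.
Qed.

End LogExpansion.

Section MutualInformation.
Context {R : realType} (U V W : finType).
Local Notation T := (U * V * W)%type.
Implicit Types p q : T -> R.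

Definition margUW p : U * W -> R := pmf_image p (fun t => (t.1.1, t.2)).
Definition margVW p : V * W -> R := pmf_image p (fun t => (t.1.2, t.2)).
Definition margW p : W -> R := pmf_image p snd.

Lemma info_ratioE p u v w : info_ratio p u v w =
  (p (u, v, w) / margW p w) /
  ((margUW p (u, w) / margW p w) * (margVW p (v, w) / margW p w)).
Proof. by rewrite /info_ratio /cond_pmf !pmf_image_comp. Qed.

Lemma marg_gt0 r (r0 : forall t, 0 <= r t) u v w : 0 < r (u, v, w) ->
  [/\ 0 < margUW r (u, w), 0 < margVW r (v, w) & 0 < margW r w].
Proof.
move=> ruvw; split; apply: lt_le_trans ruvw _.
- exact: (le_pmf_image (fun t => (t.1.1, t.2)) (u, v, w) r0).
- exact: (le_pmf_image (fun t => (t.1.2, t.2)) (u, v, w) r0).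
- exact: (le_pmf_image snd (u, v, w) r0).
Qed.

Lemma ln_info_ratio r (r0 : forall t, 0 <= r t) u v w : 0 < r (u, v, w) ->
  0 < info_ratio r u v w /\
  ln (info_ratio r u v w) = ln (r (u, v, w)) + ln (margW r w)
    - ln (margUW r (u, w)) - ln (margVW r (v, w)).
Proof.
move=> ruvw; have [UW VW W0] := marg_gt0 r0 ruvw.
rewrite info_ratioE; split; first by rewrite !divr_gt0// mulr_gt0// divr_gt0.
have d1 := divr_gt0 ruvw W0; have d2 := divr_gt0 UW W0; have d3 := divr_gt0 VW W0.
have d4 := mulr_gt0 d2 d3.
have lnB (x y : R) : 0 < x -> 0 < y -> ln (x / y) = ln x - ln y by exact: ln_div.
by rewrite (lnB _ _ d1 d4) (lnM d2 d3) !lnB//; ring.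
Qed.

Section Positive.
Variables p q : T -> R.
Hypotheses (p0 : forall t, 0 < p t) (q0 : forall t, 0 <= q t).

Let p0' t : 0 <= p t := ltW (p0 t).

(* the second-order part of the conditional mutual information near [p] *)
Definition mutual_info_remainder : R :=
  cond_mutual_info q - \sum_t q t * ln (info_ratio p t.1.1 t.1.2 t.2).

Lemma mutual_info_remainderE : mutual_info_remainder =
  kl q p + kl (margW q) (margW p) - kl (margUW q) (margUW p)
    - kl (margVW q) (margVW p).
Proof.
rewrite /mutual_info_remainder /cond_mutual_info /kl.
rewrite (sum_pmf_image q (fun t => (t.1.1, t.2)) (fun x => ln (margUW q x / margUW p x))).
rewrite (sum_pmf_image q (fun t => (t.1.2, t.2)) (fun x => ln (margVW q x / margVW p x))).
rewrite (sum_pmf_image q snd (fun x => ln (margW q x / margW p x))).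
rewrite -!sumrB -big_split/= -!sumrB; apply: eq_bigr => -[[u v] w] _ /=.
(* Empty cells contribute 0 everywhere; elsewhere all margins are positive and the logarithms
   split. *)
have := q0 (u, v, w); rewrite le_eqVlt => /orP[/eqP <-|qt].
  by rewrite !mul0r !subr0 addr0.
have [q1 q2 q3] := marg_gt0 q0 qt.
have [p1 p2 p3] := marg_gt0 p0' (p0 (u, v, w)).
have [_ ->] := ln_info_ratio q0 qt.
have [_ ->] := ln_info_ratio p0' (p0 (u, v, w)).
by rewrite !ln_div ?posrE//; ring.
Qed.

Hypothesis pq1 : \sum_t q t = \sum_t p t.
Variable T0 : T.

(** A margin is at least any cell above it. The element [T0] provides such a cell by filling in the
    missing coordinates. *)
Lemma margins_lower_bound : exists2 c, 0 < c &
  [/\ forall t, c <= p t, forall w, c <= margW p w,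
      forall x, c <= margUW p x & forall x, c <= margVW p x].
Proof.
have [c c0 cp] := finite_lower_bound p0.
exists c => //; case: T0 => -[u v] w; split=> //.
- move=> w'; apply: le_trans (cp (u, v, w')) _; exact: (le_pmf_image snd (u, v, w') p0').
- by move=> [u' w']; apply: le_trans (cp (u', v, w')) _;
    exact: (le_pmf_image (fun t => (t.1.1, t.2)) (u', v, w') p0').
- by move=> [v' w']; apply: le_trans (cp (u, v', w')) _;
    exact: (le_pmf_image (fun t => (t.1.2, t.2)) (u, v', w') p0').
Qed.

End Positive.

Definition chi2_remainder p q : R :=
  chi2 q p + chi2 (margW q) (margW p) - chi2 (margUW q) (margUW p)
    - chi2 (margVW q) (margVW p).

(** Each of the four divergences is bounded, or expanded, separately: margins deviate by at most
    [dist], and the least cell [c] of [p] also bounds its margins from below. *)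
Lemma mutual_info_remainder_bounds p (t0 : T) : (forall t, 0 < p t) ->
  exists2 K, 0 <= K & forall q, (forall t, 0 <= q t) -> \sum_t q t = \sum_t p t ->
  let dist := \sum_t `|q t - p t| in
  `|mutual_info_remainder p q| <= K * dist ^+ 2 /\
  `|2 * mutual_info_remainder p q - chi2_remainder p q| <= K * dist ^+ 3.
Proof.
move=> p0.
have [c c0 [c1 c2 c3 c4]] := margins_lower_bound p0 t0.
pose n : R := #|{: T}|%:R + #|W|%:R + #|{: U * W}|%:R + #|{: V * W}|%:R.
have n0 : 0 <= n by rewrite !addr_ge0.
exists (n / c + 4 * n / c ^+ 2).
  by rewrite addr_ge0// ?divr_ge0 ?mulr_ge0 ?exprn_ge0// ltW.
move=> q q0 pq1 dist.
have d0 : 0 <= dist by apply: sumr_ge0.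
have qpd t : `|q t - p t| <= dist.
  by rewrite /dist (bigD1 t)//= lerDl sumr_ge0.
have p0' t : 0 <= p t by exact: ltW.
have marg0 (I : finType) (f : T -> I) i : 0 <= pmf_image q f i by exact: pmf_image_ge0.
have marg1 (I : finType) (f : T -> I) : \sum_i pmf_image q f i = \sum_i pmf_image p f i.
  by rewrite !sum_pmf_image1.
have mp2 w : 0 < margW p w by exact: lt_le_trans (c2 w).
have mp3 w : 0 < margUW p w by exact: lt_le_trans (c3 w).
have mp4 w : 0 < margVW p w by exact: lt_le_trans (c4 w).
have c20 : 0 < c ^+ 2 by rewrite exprn_gt0.
rewrite mutual_info_remainderE//; split.
  have k1 := kl_ge0 p0 q0 pq1; have k1' := kl_le_chi2 p0 q0 pq1.
  have k1'' := chi2_le p0 qpd c1 c0.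
  have k2 := kl_ge0 mp2 (marg0 _ _) (marg1 _ _).
  have k2' := kl_le_chi2 mp2 (marg0 _ _) (marg1 _ _).
  have k2'' := chi2_le mp2 (pmf_image_dist p q snd) c2 c0.
  have k3 := kl_ge0 mp3 (marg0 _ _) (marg1 _ _).
  have k3' := kl_le_chi2 mp3 (marg0 _ _) (marg1 _ _).
  have k3'' := chi2_le mp3 (pmf_image_dist p q (fun t => (t.1.1, t.2))) c3 c0.
  have k4 := kl_ge0 mp4 (marg0 _ _) (marg1 _ _).
  have k4' := kl_le_chi2 mp4 (marg0 _ _) (marg1 _ _).
  have k4'' := chi2_le mp4 (pmf_image_dist p q (fun t => (t.1.2, t.2))) c4 c0.
  apply: (@le_trans _ _ (n / c * dist ^+ 2)); last first.
    rewrite ler_wpM2r ?exprn_ge0// lerDl.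
    by apply: divr_ge0; [exact: mulr_ge0|exact: ltW].
  have -> : n / c * dist ^+ 2 = #|{: T}|%:R / c * dist ^+ 2 + #|W|%:R / c * dist ^+ 2 +
      #|{: U * W}|%:R / c * dist ^+ 2 + #|{: V * W}|%:R / c * dist ^+ 2.
    by rewrite /n; ring.
  move: k1 k1' k1'' k2 k2' k2'' k3 k3' k3'' k4 k4' k4''.
  rewrite -/(margUW q) -/(margVW q) -/(margW q).
  move: (kl q p) (kl (margW q) _) (kl (margUW q) _) (kl (margVW q) _).
  move: (chi2 q p) (chi2 (margW q) _) (chi2 (margUW q) _) (chi2 (margVW q) _).
  rewrite -/dist.
  move: (_ * _) (_ * _) (_ * _) (_ * _) => e1 e2 e3 e4 *.
  by rewrite ler_norml; apply/andP; split; lra.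
have k1 := kl_expansion p0 q0 pq1 qpd c1 c0.
have k2 := kl_expansion mp2 (marg0 _ _) (marg1 _ _) (pmf_image_dist p q snd) c2 c0.
have k3 := kl_expansion mp3 (marg0 _ _) (marg1 _ _)
  (pmf_image_dist p q (fun t => (t.1.1, t.2))) c3 c0.
have k4 := kl_expansion mp4 (marg0 _ _) (marg1 _ _)
  (pmf_image_dist p q (fun t => (t.1.2, t.2))) c4 c0.
apply: (@le_trans _ _ (4 * n / c ^+ 2 * dist ^+ 3)); last first.
  by rewrite ler_wpM2r ?exprn_ge0// lerDr divr_ge0// ltW.
have -> : 4 * n / c ^+ 2 * dist ^+ 3 = 4 * #|{: T}|%:R / c ^+ 2 * dist ^+ 3
    + 4 * #|W|%:R / c ^+ 2 * dist ^+ 3 + 4 * #|{: U * W}|%:R / c ^+ 2 * dist ^+ 3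
    + 4 * #|{: V * W}|%:R / c ^+ 2 * dist ^+ 3.
  by rewrite /n; ring.
rewrite /chi2_remainder.
move: k1 k2 k3 k4; rewrite -/(margUW q) -/(margVW q) -/(margW q) -/dist.
move: (kl q p) (kl (margW q) _) (kl (margUW q) _) (kl (margVW q) _).
move: (chi2 q p) (chi2 (margW q) _) (chi2 (margUW q) _) (chi2 (margVW q) _).
move: (_ * _ ^+ 3) (_ * _ ^+ 3) (_ * _ ^+ 3) (_ * _ ^+ 3) => e1 e2 e3 e4.
move=> x1 x2 x3 x4 y1 y2 y3 y4; rewrite !ler_norml.
move=> /andP[? ?] /andP[? ?] /andP[? ?] /andP[? ?].
by apply/andP; split; lra.
Qed.

Lemma sum_triple (F : T -> R) : \sum_t F t = \sum_w \sum_u \sum_v F (u, v, w).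
Proof.
rewrite (eq_bigr (fun t => F (t.1, t.2))); last by case.
rewrite -(pair_bigA _ (fun uv w => F (uv, w)))/= exchange_big/=.
apply: eq_bigr => w _.
rewrite (pair_bigA _ (fun u v => F (u, v, w)))/=.
by apply: eq_bigr => -[u v] _.
Qed.

Lemma margUW_sum p u w : margUW p (u, w) = \sum_v p (u, v, w).
Proof.
rewrite /margUW /pmf_image (reindex_onto (fun v => (u, v, w)) (fun t => t.1.2))/=.
  by apply: eq_bigl => v; rewrite !eqxx.
by move=> [[u' v'] w'] /= /eqP[-> ->].
Qed.

Lemma margVW_sum p v w : margVW p (v, w) = \sum_u p (u, v, w).
Proof.
rewrite /margVW /pmf_image (reindex_onto (fun u => (u, v, w)) (fun t => t.1.1))/=.
  by apply: eq_bigl => u; rewrite !eqxx.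
by move=> [[u' v'] w'] /= /eqP[-> ->].
Qed.

Lemma margW_sum p w : margW p w = \sum_u \sum_v p (u, v, w).
Proof.
rewrite /margW /pmf_image big_mkcond/= sum_triple (bigD1 w)//= [X in _ + X]big1.
  by rewrite addr0 eqxx.
by move=> w' /negPf w'w; rewrite big1// => u _; rewrite big1// => v _; rewrite w'w.
Qed.

(** The summand is the law with the same pair margins under which [U] and [V] are conditionally
    independent. An empty [w] is harmless, as its quotients are 0. *)
Lemma sum_cond_product p :
  \sum_t margUW p (t.1.1, t.2) * margVW p (t.1.2, t.2) / margW p t.2 = \sum_t p t.
Proof.
rewrite !sum_triple; apply: eq_bigr => w _ /=.
under eq_bigr do rewrite -mulr_suml -mulr_sumr.
rewrite -mulr_suml -mulr_suml -[RHS]margW_sum.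
have -> : \sum_u margUW p (u, w) = margW p w.
  by rewrite margW_sum; apply: eq_bigr => u _; rewrite margUW_sum.
have -> : \sum_v margVW p (v, w) = margW p w.
  by rewrite margW_sum exchange_big; apply: eq_bigr => v _; rewrite margVW_sum.
have [->|n0] := eqVneq (margW p w) 0; first by rewrite !mul0r.
by rewrite mulfK.
Qed.

Lemma div_info_ratio p u v w : (forall t, 0 <= p t) -> 0 < p (u, v, w) ->
  p (u, v, w) / info_ratio p u v w = margUW p (u, w) * margVW p (v, w) / margW p w.
Proof.
move=> p0 puvw; have [p1 p2 p3] := marg_gt0 p0 puvw.
by rewrite info_ratioE; field; rewrite !gt_eqF.
Qed.

(** Gibbs' inequality relative to the conditionally independent law, termwise from
    [ln x <= x - 1]. *)
Lemma cond_mutual_info_ge0 p : (forall t, 0 <= p t) -> 0 <= cond_mutual_info p.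
Proof.
move=> p0; have -> : 0 = \sum_t (p t -
    margUW p (t.1.1, t.2) * margVW p (t.1.2, t.2) / margW p t.2).
  by rewrite sumrB sum_cond_product subrr.
apply: ler_sum => -[[u v] w] _ /=.
have := p0 (u, v, w); rewrite le_eqVlt => /orP[/eqP <-|puvw].
  by rewrite mul0r sub0r oppr_le0 divr_ge0 ?mulr_ge0// pmf_image_ge0.
have [r0 _] := ln_info_ratio p0 puvw.
have := @ln_le_sub1 _ (info_ratio p u v w)^-1.
rewrite invr_gt0 => /(_ r0); rewrite lnV ?posrE// => H.
by rewrite -div_info_ratio// -[X in X - _]mulr1 -mulrBr ler_wpM2l//; lra.
Qed.

(** Equality in Gibbs' inequality: the nonnegative terms [F t] sum to 0, and each vanishes only at
    ratio 1. *)
Lemma cond_mutual_info_eq0 p : (forall t, 0 < p t) -> cond_mutual_info p = 0 ->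
  forall u v w, info_ratio p u v w = 1.
Proof.
move=> p0 I0 u v w; have p0' t : 0 <= p t by exact: ltW.
pose F t := p t * (ln (info_ratio p t.1.1 t.1.2 t.2) - 1 +
  (info_ratio p t.1.1 t.1.2 t.2)^-1).
have F0 t : 0 <= F t.
  rewrite mulr_ge0//; case: t => -[u' v'] w' /=.
  have [r0 _] := ln_info_ratio p0' (p0 (u', v', w')).
  have := @ln_le_sub1 _ (info_ratio p u' v' w')^-1.
  by rewrite invr_gt0 => /(_ r0); rewrite lnV ?posrE//; lra.
have sF : \sum_t F t = 0.
  rewrite /F; under eq_bigr do rewrite mulrDr mulrBr mulr1.
  rewrite big_split/= sumrB.
  rewrite (_ : \sum_t p t * ln _ = 0) ?add0r//.
  have -> : \sum_t p t / info_ratio p t.1.1 t.1.2 t.2 = \sum_t p t.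
    rewrite -[RHS]sum_cond_product; apply: eq_bigr => -[[u' v'] w'] _ /=.
    exact: div_info_ratio.
  by rewrite addNr.
have /eqP := sF; rewrite psumr_eq0// => /allP/(_ (u, v, w) (mem_index_enum _)).
rewrite /= mulf_eq0 gt_eqF//= => /eqP H.
have [r0 _] := ln_info_ratio p0' (p0 (u, v, w)).
have E : (info_ratio p u v w)^-1 = 1.
  by apply: ln_eq_sub1; rewrite ?invr_gt0// lnV ?posrE//; lra.
by rewrite -[LHS]invrK E invr1.
Qed.

Lemma cond_mutual_info_ratio1 p : (forall u v w, info_ratio p u v w = 1) ->
  cond_mutual_info p = 0.
Proof.
by move=> H; rewrite /cond_mutual_info big1// => t _; rewrite H ln1 mulr0.
Qed.

End MutualInformation.

(** * An orthonormal basis of the interactions *)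

Section OrthonormalComplement.
Context {R : realType} (U : finType) (a : U -> R) (u0 : U).
Hypotheses (a0 : forall u, 0 < a u) (a1 : \sum_u a u = 1).

Local Notation others := {u : U | u != u0}.

Lemma sum_others (F : U -> R) : \sum_u F u = F u0 + \sum_(i : others) F (val i).
Proof.
rewrite (bigD1 u0)//=; congr (_ + _).
by rewrite -(big_sub (fun u => u != u0)).
Qed.

Lemma sum_delta (I : finType) (i : I) (F : I -> R) : \sum_j (i == j)%:R * F j = F i.
Proof.
rewrite (bigD1 i)//= eqxx mul1r big1 ?addr0// => j.
by rewrite eq_sym => /negPf ->; rewrite mul0r.
Qed.

(* the rows other than [u0] of the Householder reflection exchanging the basis
   vector at [u0] with [Num.sqrt \o a], divided by the latter *)
Lemma orthonormal_complement : exists e : others -> U -> R,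
  [/\ forall i, \sum_u a u * e i u = 0,
      forall i j, \sum_u a u * (e i u * e j u) = (i == j)%:R &
      forall u u', \sum_i e i u * e i u' = (u == u')%:R / a u - 1].
Proof.
pose s u := Num.sqrt (a u).
have s0 u : 0 < s u by rewrite sqrtr_gt0.
have ss u : s u * s u = a u by rewrite -expr2 sqr_sqrtr// ltW.
(* The direction of the reflection. Its squared norm is [2 (1 - s u0)], so [c] is 2 divided by that
   norm. *)
pose dl u := s u - (u0 == u)%:R.
pose c := (1 - s u0)^-1.
have dd : \sum_u dl u * dl u = 2 * (1 - s u0).
  have E u : dl u * dl u = a u - (u0 == u)%:R * (2 * s u - 1).
    by rewrite /dl; case: eqP => _ /=; rewrite -ss; ring.
  by rewrite (eq_bigr _ (fun u _ => E u)) sumrB a1 sum_delta; ring.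
(* If [s u0 = 1] then [dl] vanishes, so the default [c = 0] makes the reflection the identity and no
   separate case is needed. *)
have cd u : c * (1 - s u0) * dl u = dl u.
  rewrite /c; have [E|n] := eqVneq (1 - s u0) 0; last by rewrite mulVf// mul1r.
  rewrite E mulr0 mul0r; apply/esym/eqP.
  move: dd; rewrite E mulr0 => /eqP; rewrite psumr_eq0; last first.
    by move=> v _; rewrite -expr2 sqr_ge0.
  by move=> /allP/(_ u (mem_index_enum _)); rewrite /= mulf_eq0 orbb.
pose H i u := (i == u)%:R - c * (dl i * dl u).
have HH i j : \sum_u H i u * H j u = (i == j)%:R.
  have E u : H i u * H j u = (i == u)%:R * H j u - c * dl i * ((j == u)%:R * dl u)
      + c * c * dl i * dl j * (dl u * dl u).
    by rewrite /H; ring.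
  rewrite (eq_bigr _ (fun u _ => E u)) big_split/= sumrB -!mulr_sumr !sum_delta dd.
  have -> : c * c * dl i * dl j * (2 * (1 - s u0)) =
    2 * (c * dl i * (c * (1 - s u0) * dl j)) by ring.
  rewrite cd /H eq_sym; ring.
have Hu0 u : H u0 u = s u.
  have d0 : dl u0 = - (1 - s u0) by rewrite /dl eqxx /=; ring.
  have -> : H u0 u = (u0 == u)%:R + c * (1 - s u0) * dl u by rewrite /H d0; ring.
  by rewrite cd /dl; ring.
have Hsym i u : H i u = H u i by rewrite /H eq_sym; ring.
exists (fun i u => H (val i) u / s u); split.
- move=> i; apply: (@etrans _ _ (\sum_u H u0 u * H (val i) u)).
    by apply: eq_bigr => u _; rewrite Hu0 -(ss u); field; rewrite gt_eqF.
  by rewrite HH eq_sym (negPf (valP i)).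
- move=> i j; have <- : \sum_u H (val i) u * H (val j) u = (i == j)%:R.
    by rewrite HH (inj_eq val_inj).
  apply: eq_bigr => u _.
  by rewrite -(ss u); field; rewrite gt_eqF.
- move=> u u'.
  have : \sum_i H i u * H i u' = (u == u')%:R.
    by rewrite -HH; apply: eq_bigr => i _; rewrite !(Hsym i).
  rewrite sum_others !Hu0 => E.
  have -> : \sum_(i : others) H (val i) u / s u * (H (val i) u' / s u') =
      (s u * s u')^-1 * \sum_(i : others) H (val i) u * H (val i) u'.
    by rewrite mulr_sumr; apply: eq_bigr => i _; field; rewrite !gt_eqF.
  have -> : \sum_(i : others) H (val i) u * H (val i) u' = (u == u')%:R - s u * s u'.
    by rewrite -E addrC addKr.
  case: eqP => [<-|_] /=; last by field; rewrite !gt_eqF.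
  by rewrite -ss; field; rewrite gt_eqF.
Qed.

(** Parseval's identity for the density of [x] relative to [a]: the component along the constants is
    subtracted. The hypothesis is the kernel of the projection onto their complement. *)
Lemma complement_parseval (e : others -> U -> R) :
  (forall u u', \sum_i e i u * e i u' = (u == u')%:R / a u - 1) ->
  forall x : U -> R, \sum_i (\sum_u e i u * x u) ^+ 2 =
    \sum_u x u ^+ 2 / a u - (\sum_u x u) ^+ 2.
Proof.
move=> He x.
have E i : (\sum_u e i u * x u) ^+ 2 = \sum_u \sum_u' x u * x u' * (e i u * e i u').
  rewrite expr2 mulr_suml; apply: eq_bigr => u _.
  by rewrite mulr_sumr; apply: eq_bigr => u' _; ring.
rewrite (eq_bigr _ (fun i _ => E i)) exchange_big/=.
rewrite expr2 mulr_suml -sumrB; apply: eq_bigr => u _.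
rewrite exchange_big/=.
under eq_bigr do rewrite -mulr_sumr He.
rewrite mulr_sumr.
have -> : x u ^+ 2 / a u = \sum_u' (u == u')%:R * (x u * x u' / a u).
  by rewrite sum_delta; ring.
by rewrite -sumrB; apply: eq_bigr => u' _; ring.
Qed.

End OrthonormalComplement.

Section InteractionBasis.
Context {R : realType} (U V W : finType) (u0 : U) (v0 : V).
Variables (c : W -> R) (a : W -> U -> R) (b : W -> V -> R).
Hypotheses (c0 : forall w, 0 < c w) (a0 : forall w u, 0 < a w u)
  (b0 : forall w v, 0 < b w v).
Hypotheses (a1 : forall w, \sum_u a w u = 1) (b1 : forall w, \sum_v b w v = 1).

(** One index for each free entry of the table in [(u, v)] left by its row and column sums, for
    every [w]: the degrees of freedom of a test of conditional independence. *)
Definition interaction_index : finType :=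
  (W * {u : U | u != u0} * {v : V | v != v0})%type.

Lemma card_interaction_index :
  #|interaction_index| = (#|W| * (#|V| - 1) * (#|U| - 1))%N.
Proof.
by rewrite !card_prod !card_sig !subn1 -(cardC1 u0) -(cardC1 v0) mulnAC.
Qed.

(** For each [w] the basis is the tensor product of the complements of the constants for [a w] and
    [b w], scaled by the square root of [c w]. The last identity turns into a sum of squares the
    chi-square combination relative to [c w * a w u * b w v]. *)
Lemma interaction_basis : exists phi : interaction_index -> U -> V -> W -> R,
  [/\ forall j v w, \sum_u a w u * phi j u v w = 0,
      forall j l, \sum_w \sum_u \sum_v c w * a w u * b w v *
         (phi j u v w * phi l u v w) = (j == l)%:R &
      forall D : U -> V -> W -> R,
        \sum_j (\sum_w \sum_u \sum_v phi j u v w * D u v w) ^+ 2 =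
        \sum_w (\sum_u \sum_v D u v w ^+ 2 / (c w * a w u * b w v)
          + (\sum_u \sum_v D u v w) ^+ 2 / c w
          - \sum_u (\sum_v D u v w) ^+ 2 / (c w * a w u)
          - \sum_v (\sum_u D u v w) ^+ 2 / (c w * b w v))].
Proof.
have [e He] := choice (fun w => orthonormal_complement u0 (a0 w) (a1 w)).
have [f Hf] := choice (fun w => orthonormal_complement v0 (b0 w) (b1 w)).
pose sc w := Num.sqrt (c w).
have sc0 w : 0 < sc w by rewrite sqrtr_gt0.
have scc w : sc w * sc w = c w by rewrite -expr2 sqr_sqrtr// ltW.
exists (fun j u v w => (j.1.1 == w)%:R * (e w j.1.2 u * f w j.2 v / sc w)); split.
- move=> [[w' i] j] v w /=; have [He1 _ _] := He w.
  have -> : \sum_u a w u * ((w' == w)%:R * (e w i u * f w j v / sc w)) =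
      (w' == w)%:R * (f w j v / sc w) * \sum_u a w u * e w i u.
    by rewrite mulr_sumr; apply: eq_bigr => u _; ring.
  by rewrite He1 mulr0.
- move=> [[w1 i1] j1] [[w2 i2] j2] /=.
  have E w : \sum_u \sum_v c w * a w u * b w v *
      ((w1 == w)%:R * (e w i1 u * f w j1 v / sc w) *
       ((w2 == w)%:R * (e w i2 u * f w j2 v / sc w))) =
      (w1 == w)%:R * ((w2 == w)%:R * ((i1 == i2)%:R * (j1 == j2)%:R)).
    have [_ He2 _] := He w; have [_ Hf2 _] := Hf w.
    rewrite -He2 -Hf2 mulr_suml !mulr_sumr; apply: eq_bigr => u _.
    rewrite !mulr_sumr; apply: eq_bigr => v _.
    by rewrite -scc; field; rewrite gt_eqF.
  rewrite (eq_bigr _ (fun w _ => E w)) sum_delta.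
  rewrite !xpair_eqE (eq_sym w2) -!natrM !mulnb andbA //.
- move=> D.
  pose g w i j := \sum_u e w i u * \sum_v f w j v * D u v w.
  have E j : \sum_w \sum_u \sum_v (j.1.1 == w)%:R *
      (e w j.1.2 u * f w j.2 v / sc w) * D u v w = g j.1.1 j.1.2 j.2 / sc j.1.1.
    rewrite -[RHS](sum_delta j.1.1 (fun w => g w j.1.2 j.2 / sc w)).
    apply: eq_bigr => w _; rewrite /g mulr_suml mulr_sumr; apply: eq_bigr => u _.
    by rewrite mulr_sumr mulr_suml mulr_sumr; apply: eq_bigr => v _; ring.
  rewrite (eq_bigr (fun j : interaction_index => (g j.1.1 j.1.2 j.2 / sc j.1.1) ^+ 2)); last first.
    by move=> j _; rewrite E.
  rewrite -(pair_bigA _ (fun wi j => (g wi.1 wi.2 j / sc wi.1) ^+ 2))/=.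
  rewrite -(pair_bigA _ (fun w i => \sum_j (g w i j / sc w) ^+ 2))/=.
  apply: eq_bigr => w _; rewrite exchange_big/=.
  have [_ _ He3] := He w; have [_ _ Hf3] := Hf w.
  (* Parseval is applied in [u] for fixed [j], then in [v] to both resulting terms, which gives the
     four sums. *)
  have Ej j : \sum_i (g w i j / sc w) ^+ 2 = (c w)^-1 *
      (\sum_u (\sum_v f w j v * D u v w) ^+ 2 / a w u -
       (\sum_v f w j v * \sum_u D u v w) ^+ 2).
    have -> : \sum_v f w j v * \sum_u D u v w = \sum_u \sum_v f w j v * D u v w.
      by rewrite exchange_big/=; apply: eq_bigr => v _; rewrite mulr_sumr.
    rewrite -(complement_parseval He3) mulr_sumr; apply: eq_bigr => i _.
    by rewrite -scc /g; field; rewrite gt_eqF.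
  rewrite (eq_bigr _ (fun j _ => Ej j)) -mulr_sumr sumrB exchange_big/=.
  rewrite (complement_parseval Hf3).
  have Eu u : \sum_j (\sum_v f w j v * D u v w) ^+ 2 / a w u =
      (\sum_v D u v w ^+ 2 / b w v - (\sum_v D u v w) ^+ 2) / a w u.
    by rewrite -mulr_suml (complement_parseval Hf3).
  rewrite (eq_bigr _ (fun u _ => Eu u)).
  under eq_bigr do rewrite mulrBl.
  rewrite sumrB.
  have -> : \sum_u (\sum_v D u v w ^+ 2 / b w v) / a w u =
      c w * \sum_u \sum_v D u v w ^+ 2 / (c w * a w u * b w v).
    rewrite mulr_sumr; apply: eq_bigr => u _; rewrite mulr_suml mulr_sumr.
    by apply: eq_bigr => v _; field; rewrite !gt_eqF.
  have -> : \sum_u (\sum_v D u v w) ^+ 2 / a w u =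
      c w * \sum_u (\sum_v D u v w) ^+ 2 / (c w * a w u).
    rewrite mulr_sumr; apply: eq_bigr => u _; field; by rewrite !gt_eqF.
  have -> : \sum_v (\sum_u D u v w) ^+ 2 / b w v =
      c w * \sum_v (\sum_u D u v w) ^+ 2 / (c w * b w v).
    rewrite mulr_sumr; apply: eq_bigr => u _; field; by rewrite !gt_eqF.
  have -> : \sum_v \sum_u D u v w = \sum_u \sum_v D u v w by exact: exchange_big.
  by field; rewrite gt_eqF.
Qed.

End InteractionBasis.

(** * The directed information rate *)

Section Entropies.
Context {R : realType}.

Lemma pmf_image_inj (T U : finType) (p : T -> R) (f : T -> U) t :
  injective f -> pmf_image p f (f t) = p t.
Proof. by move=> fi; rewrite /pmf_image (big_pred1 t)// => t'; rewrite /= (inj_eq fi). Qed.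

Lemma entropy_inj (T U : finType) (p : T -> R) (f : T -> U) : injective f ->
  entropy (pmf_image p f) = entropy p.
Proof.
move=> fi; rewrite /entropy sum_pmf_image; congr (- _).
by apply: eq_bigr => t _; rewrite pmf_image_inj.
Qed.

Lemma entropy_chain (U V : finType) (p : U * V -> R) : (forall t, 0 <= p t) ->
  entropy p = entropy (pmf_image p snd) + cond_entropy p.
Proof.
move=> p0; rewrite /entropy /cond_entropy sum_pmf_image -opprD -big_split/=; congr (- _).
apply: eq_bigr => -[u v] _ /=; rewrite -mulrDr.
have := p0 (u, v); rewrite le_eqVlt => /orP[/eqP <-|puv]; first by rewrite !mul0r.
have pv : 0 < pmf_image p snd v.
  exact: lt_le_trans puv (le_pmf_image snd (u, v) p0).
rewrite /cond_pmf (_ : ln (_ / _) = ln (p (u, v)) - ln (pmf_image p snd v)).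
  by rewrite addrC subrK.
exact: ln_div.
Qed.

Lemma factor_image (U V W : finType) (p : U * V -> R) (h : V -> W)
    (c : U -> W -> R) (p' := pmf_image p (fun t => (t.1, h t.2))) :
  (forall u v, p (u, v) = pmf_image p snd v * c u (h v)) ->
  forall u w, p' (u, w) = pmf_image p' snd w * c u w.
Proof.
move=> pc u w; rewrite pmf_image_comp.
rewrite (_ : pmf_image p _ w = pmf_image (pmf_image p snd) h w); last first.
  by rewrite pmf_image_comp.
rewrite [X in X * _]/pmf_image mulr_suml /p' /pmf_image.
rewrite (reindex_onto (fun v => (u, v)) snd)/=; last first.
  by case=> u' v; rewrite xpair_eqE => /andP[/eqP/= -> _].
apply: eq_big => [v|v]; first by rewrite !xpair_eqE !eqxx /= andbT.
by rewrite !xpair_eqE !eqxx/= andbT => /eqP <-; exact: pc.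
Qed.

(** The hypothesis says that [v] acts on [u] only through [h v]. The kernel [c] is then the
    conditional law before and after coarsening, so both entropies average the same logarithm. *)
Lemma cond_entropy_factor (U V W : finType) (p : U * V -> R) (h : V -> W)
    (c : U -> W -> R) : (forall t, 0 <= p t) ->
  (forall u v, p (u, v) = pmf_image p snd v * c u (h v)) ->
  cond_entropy p = cond_entropy (pmf_image p (fun t => (t.1, h t.2))).
Proof.
move=> p0 pc; have p'c := factor_image pc; set p' := pmf_image p _ in p'c *.
rewrite /cond_entropy; congr (- _).
rewrite (sum_pmf_image p (fun t => (t.1, h t.2)) (fun x => ln (cond_pmf p' x.1 x.2))).
apply: eq_bigr => -[u v] _ /=.
have := p0 (u, v); rewrite le_eqVlt => /orP[/eqP <-|puv]; first by rewrite !mul0r.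
congr (_ * ln _).
have pv : 0 < pmf_image p snd v.
  exact: lt_le_trans puv (le_pmf_image snd (u, v) p0).
have p'0 t : 0 <= p' t by exact: pmf_image_ge0.
have p'uv : 0 < p' (u, h v).
  exact: lt_le_trans puv (le_pmf_image (fun t => (t.1, h t.2)) (u, v) p0).
have p'v : 0 < pmf_image p' snd (h v).
  exact: lt_le_trans p'uv (le_pmf_image snd (u, h v) p'0).
rewrite /cond_pmf p'c pc mulrAC divff ?gt_eqF// mul1r.
by rewrite mulrAC divff ?gt_eqF// mul1r.
Qed.

Lemma cond_mutual_info_entropies (U V W : finType) (p : U * V * W -> R) :
  (forall t, 0 <= p t) ->
  cond_mutual_info p = cond_entropy (margUW p) -
    cond_entropy (pmf_image p (fun t => (t.1.1, (t.1.2, t.2)))).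
Proof.
move=> p0; rewrite /cond_mutual_info /cond_entropy opprK addrC.
rewrite (sum_pmf_image p (fun t => (t.1.1, t.2))
  (fun x => ln (cond_pmf (margUW p) x.1 x.2))).
set p2 := pmf_image p (fun t => _).
rewrite (sum_pmf_image p (fun t => (t.1.1, (t.1.2, t.2)))
  (fun x => ln (cond_pmf p2 x.1 x.2))).
rewrite -sumrB; apply: eq_bigr => -[[u v] w] _ /=; rewrite -mulrBr.
have := p0 (u, v, w); rewrite le_eqVlt => /orP[/eqP <-|puvw]; first by rewrite !mul0r.
have [_ ->] := ln_info_ratio p0 puvw; congr (_ * _).
have [p1 p3 p4] := marg_gt0 p0 puvw.
have -> : cond_pmf (margUW p) u w = margUW p (u, w) / margW p w.
  by rewrite /cond_pmf pmf_image_comp.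
have -> : cond_pmf p2 u (v, w) = p (u, v, w) / margVW p (v, w).
  rewrite /cond_pmf /p2 pmf_image_comp; congr (_ / _).
  rewrite (pmf_image_inj p (f := fun t => (t.1.1, (t.1.2, t.2))) (u, v, w))//.
  by move=> [[? ?] ?] [[? ?] ?] /= [-> -> ->].
have lnB (x y : R) : 0 < x -> 0 < y -> ln (x / y) = ln x - ln y by exact: ln_div.
by rewrite !lnB//; ring.
Qed.

End Entropies.

Section WindowLaw.
Context {R : realType} (A B : finType) (k : nat).
Variable Q : k.-tuple A -> k.-tuple B -> A -> B -> R.

Local Notation Z := (k.-tuple A * k.-tuple B)%type.
Local Notation C := (A * B)%type.
Local Notation q := (rate Q).

(* the window, split as the variables of the plug-in estimator *)
Definition split_window (z : Z) (c : C) : B * k.+1.-tuple A * k.-tuple B :=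
  (c.2, extend z.1 c.1, z.2).

Definition split_window_law (nu : Z -> R) (t : B * k.+1.-tuple A * k.-tuple B) : R :=
  nu (front t.1.2, t.2) * q (front t.1.2, t.2) (final t.1.2, t.1.1).

Lemma split_law_window_law nu : split_law (window_law Q nu) = split_window_law nu.
Proof.
apply/funext => -[[u v] w]; rewrite /split_law /pmf_image (big_pred1 (v, extend w u)).
  by rewrite /window_law /= front_extend final_extend.
move=> [a b] /=; rewrite !xpair_eqE; apply/idP/idP.
  by move=> /andP[/andP[/eqP <- /eqP ->] /eqP <-]; rewrite extend_front_final !eqxx.
by move=> /andP[/eqP -> /eqP ->]; rewrite front_extend final_extend !eqxx.
Qed.

Lemma split_window_bij : bijective (fun p : Z * C => split_window p.1 p.2).
Proof.
exists (fun t => ((front t.1.2, t.2), (final t.1.2, t.1.1))).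
  by move=> [[a b] [c d]] /=; rewrite front_extend final_extend.
by move=> [[u v] w] /=; rewrite /split_window /= extend_front_final.
Qed.

Lemma sum_split_window_law nu f :
  \sum_t split_window_law nu t * f t =
  \sum_z nu z * \sum_c q z c * f (split_window z c).
Proof.
rewrite (reindex _ (onW_bij _ split_window_bij))/=.
rewrite -(pair_bigA _ (fun z c => split_window_law nu (split_window z c) *
  f (split_window z c)))/=.
apply: eq_bigr => -[a b] _; rewrite mulr_sumr; apply: eq_bigr => -[c d] _.
by rewrite /split_window_law /= front_extend final_extend mulrA.
Qed.

Lemma sum_split_window_law1 nu : (forall z, \sum_c q z c = 1) ->
  \sum_t split_window_law nu t = \sum_z nu z.
Proof.
move=> q1; have := sum_split_window_law nu (fun=> 1).
under eq_bigr do rewrite mulr1.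
move=> ->; apply: eq_bigr => z _.
by under eq_bigr do rewrite mulr1; rewrite q1 mulr1.
Qed.

Lemma margVW_split_window_law nu v w : margVW (split_window_law nu) (v, w) =
  nu (front v, w) * \sum_b q (front v, w) (final v, b).
Proof.
rewrite /margVW /pmf_image (reindex_onto (fun u => (u, v, w)) (fun t => t.1.1))/=.
  rewrite mulr_sumr; apply: eq_big => [u|u _ //].
  by rewrite !eqxx.
by move=> [[u' v'] w'] /= /eqP[-> ->].
Qed.

(** Given the past and the new letter of [X], the new letter of [Y] has a law that depends on the
    past of [Y] alone. This is absence of causal influence read on the kernel, free of the initial
    law. *)
Definition conditionally_autonomous : Prop :=
  exists g : k.-tuple B -> B -> R, forall z a b,
    q z (a, b) = g z.2 b * \sum_b' q z (a, b').

Hypothesis q0 : forall z c, 0 < q z c.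
Hypothesis q1 : forall z, \sum_c q z c = 1.

Lemma rate_fst_gt0 (b0 : B) z a : 0 < \sum_b q z (a, b).
Proof. by rewrite (bigD1 b0)//= ltr_wpDr// sumr_ge0// => b _; rewrite ltW. Qed.

Lemma autonomous_sum1 (b0 : B) (a0 : A) (g : k.-tuple B -> B -> R) :
  (forall z a b, q z (a, b) = g z.2 b * \sum_b' q z (a, b')) ->
  forall w, \sum_b g w b = 1.
Proof.
move=> gP w; pose z : Z := ([tuple a0 | j < k], w).
have S0 := rate_fst_gt0 b0 z a0.
have : \sum_b q z (a0, b) = (\sum_b g w b) * \sum_b q z (a0, b).
  by rewrite mulr_suml; apply: eq_bigr => b _; exact: gP.
by move=> E; apply: (mulIf (lt0r_neq0 S0)); rewrite mul1r -E.
Qed.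

Lemma autonomous_split_window_law (b0 : B) (a0 : A) (g : k.-tuple B -> B -> R) nu :
  (forall z a b, q z (a, b) = g z.2 b * \sum_b' q z (a, b')) ->
  [/\ forall u v w, split_window_law nu (u, v, w) =
        g w u * margVW (split_window_law nu) (v, w) &
      forall u w, margUW (split_window_law nu) (u, w) =
        g w u * margW (split_window_law nu) w].
Proof.
move=> gP.
have E u v w : split_window_law nu (u, v, w) = g w u * margVW (split_window_law nu) (v, w).
  by rewrite margVW_split_window_law /split_window_law /= gP mulrCA.
split=> // u w.
have -> : margW (split_window_law nu) w = \sum_v margVW (split_window_law nu) (v, w).
  rewrite /margW -(pmf_image_comp (split_window_law nu) (fun t => (t.1.2, t.2)) snd w).
  rewrite [LHS]/pmf_image (reindex_onto (fun v => (v, w)) fst)/=.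
    by apply: eq_bigl => v; rewrite !eqxx.
  by case=> v w' /eqP/= ->.
rewrite mulr_sumr /margUW /pmf_image.
rewrite (reindex_onto (fun v => (u, v, w)) (fun t => t.1.2))/=.
  apply: eq_big => [v|v _]; first by rewrite !eqxx.
  exact: E.
by move=> [[u' v'] w'] /= /eqP[-> ->].
Qed.

(** The kernel is the conditional law of the new letter of [Y] under the window law. Any positive
    [nu] will do, which allows both the stationary law and the law of the state at a finite time. *)
Lemma autonomous_of_info_ratio nu : (forall z, 0 < nu z) ->
  (forall u v w, info_ratio (split_window_law nu) u v w = 1) ->
  conditionally_autonomous.
Proof.
move=> nu0 H; set p := split_window_law nu.
have p0 t : 0 < p t by rewrite mulr_gt0.
have p0' t : 0 <= p t by exact: ltW.
exists (fun w u => margUW p (u, w) / margW p w) => -[a w] a' u /=.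
have [p1 p2 p3] := marg_gt0 p0' (p0 (u, extend a a', w)).
have := H u (extend a a') w; rewrite info_ratioE -/p => /divr1_eq E.
apply: (mulfI (lt0r_neq0 (nu0 (a, w)))); rewrite mulrCA.
have := margVW_split_window_law nu (extend a a') w.
rewrite front_extend final_extend -/p => <-.
have -> : nu (a, w) * q (a, w) (a', u) = p (u, extend a a', w).
  by rewrite /p /split_window_law /= front_extend final_extend.
have -> : p (u, extend a a', w) = p (u, extend a a', w) / margW p w * margW p w.
  by rewrite divfK// gt_eqF.
by rewrite E; field; rewrite gt_eqF.
Qed.

Lemma info_ratio_autonomous (b0 : B) (a0 : A) nu : (forall z, 0 < nu z) ->
  conditionally_autonomous ->
  forall u v w, info_ratio (split_window_law nu) u v w = 1.
Proof.
move=> nu0 [g gP] u v w; set p := split_window_law nu.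
have p0 t : 0 < p t by rewrite mulr_gt0.
have p0' t : 0 <= p t by exact: ltW.
have [p1 p2 p3] := marg_gt0 p0' (p0 (u, v, w)).
have [E1 E2] := autonomous_split_window_law b0 a0 nu gP.
have g0 : g w u != 0 by move: p1; rewrite E2 pmulr_lgt0// => /lt0r_neq0.
by rewrite info_ratioE /p E1 E2 -/p; field; rewrite g0 !gt_eqF.
Qed.

End WindowLaw.

Section DirectedInformation.
Context {d : measure_display} {Omega : measurableType d} {R : realType}.
Variables (P : probability Omega R) (A B : finType) (k : nat).
Variables (X : nat -> Omega -> A) (Y : nat -> Omega -> B).
Variable Q : k.-tuple A -> k.-tuple B -> A -> B -> R.
Hypothesis mX : forall n, finite_rv (X n).
Hypothesis mY : forall n, finite_rv (Y n).
Hypothesis PQ : markov_chain_with P Q X Y.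
Hypothesis Qpos : positive_transition_matrix Q.

Local Notation Z := (k.-tuple A * k.-tuple B)%type.
Local Notation C := (A * B)%type.
Local Notation q := (rate Q).
Local Notation s := (@step A B k).
Local Notation st := (state k X Y).
Local Notation sy := (symbol k X Y).

Lemma mean_stateS (f : Z -> C -> R) i :
  mean P (fun w => f (st i w) (sy i w)) =
  mean P (fun w => \sum_c q (st i w) c * f (st i w) c).
Proof.
apply: (mean_one_step mX mY PQ (F := fun w c => f (st i w) c)) => c w w' H.
by rewrite (adapted_state H).
Qed.

Lemma mean_state_iter (f : Z -> R) n :
  mean P (fun w => f (st n w)) =
  \sum_z pmf_of P (st 0%N) z * iter n (transition q s) f z.
Proof.
elim: n f => [|n IH] f /=; first by rewrite -mean_comp//; exact: finite_rv_state.
have -> : (fun w => f (st n.+1 w)) = (fun w => f (s (st n w) (sy n w))).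
  by apply/funext => w; rewrite stateS.
rewrite (mean_stateS (fun z c => f (s z c))) (IH (transition q s f)).
by apply: eq_bigr => z _; rewrite -iterSr.
Qed.

Lemma pmf_split_window i :
  pmf_of P (fun w => (Y (i + k) w, block X i k.+1 w, block Y i k w)) =
  split_window_law Q (pmf_of P (st i)).
Proof.
apply/funext => t.
have -> : (fun w => (Y (i + k) w, block X i k.+1 w, block Y i k w)) =
    (fun w => split_window (st i w) (sy i w)).
  by apply/funext => w; rewrite block_extend.
rewrite pmf_of_mean; last first.
  apply: (@finite_rv_comp _ _ _ _ (fun w => (st i w, sy i w))
    (fun zc => split_window zc.1 zc.2)).
  by apply: finite_rv_pair; [exact: finite_rv_state|exact: finite_rv_symbol].
rewrite (mean_stateS (fun z c => (split_window z c == t)%:R)).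
rewrite (mean_comp P (@finite_rv_state _ _ _ _ k _ _ mX mY i)
  (fun z => \sum_c q z c * (split_window z c == t)%:R)).
rewrite -(sum_split_window_law Q _ (fun t' => (t' == t)%:R)).
rewrite (bigD1 t)//= eqxx mulr1 big1 ?addr0// => t' /negPf ->.
by rewrite mulr0.
Qed.

Lemma finite_rv_split_window i :
  finite_rv (fun w => (Y (i + k) w, block X i k.+1 w, block Y i k w)).
Proof.
apply: finite_rv_pair; last exact: finite_rv_block.
by apply: finite_rv_pair => //; exact: finite_rv_block.
Qed.

Lemma entropy_block n : entropy (pmf_of P (block Y k n)) =
  \sum_(i < n) cond_entropy (pmf_of P (fun w => (Y (i + k) w, block Y k i w))).
Proof.
elim: n => [|n IH].
  rewrite big_ord0 /entropy big1 ?oppr0// => t _.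
  rewrite (_ : pmf_of _ _ _ = 1) ?ln1 ?mulr0// /pmf_of.
  rewrite (_ : _ @^-1` _ = setT) ?probability_setT//.
  by apply/seteqP; split=> w // _ /=; rewrite (tuple0 t) [LHS]tuple0.
rewrite big_ord_recr/= -IH.
have mp : finite_rv (fun w => (Y (n + k) w, block Y k n w)).
  by apply: finite_rv_pair => //; exact: finite_rv_block.
have -> : block Y k n.+1 = (fun t => extend t.2 t.1) \o
    (fun w => (Y (n + k)%N w, block Y k n w)).
  by apply/funext => w; rewrite block_extend addnC.
rewrite (_ : pmf_of P (_ \o _) = pmf_image (pmf_of P
  (fun w => (Y (n + k)%N w, block Y k n w))) (fun t => extend t.2 t.1)); last first.
  by apply/funext => t; rewrite pmf_of_comp.
rewrite entropy_inj; last first.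
  move=> [u v] [u' v'] /= E; congr (_, _).
    by rewrite -(final_extend v u) E final_extend.
  by rewrite -(front_extend v u) E front_extend.
rewrite entropy_chain; last by move=> t; exact: pmf_of_ge0.
congr (entropy _ + _).
by apply/funext => t; rewrite -(pmf_of_comp P snd mp).
Qed.

Variables (a0 : A) (b0 : B).

Lemma segment_nested (T : Type) (x0 : T) i N (f : N.-tuple T) : (k <= i)%N -> (i + k <= N)%N ->
  segment (nth x0 (segment (nth x0 f) k i)) (i - k) k = segment (nth x0 f) i k.
Proof.
move=> ki iN; apply: eq_from_tnth => j; rewrite !tnth_mktuple.
have jl : (i - k + j < i)%N by rewrite -[X in (_ < X)%N](subnK ki) ltn_add2l.
rewrite (_ : (i - k + j)%N = Ordinal jl :> nat)// -tnth_nth tnth_mktuple /=.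
by rewrite addnA subnKC.
Qed.

Lemma segment_extend (T : finType) (x0 : T) i (t : i.-tuple T) a : (k <= i)%N ->
  segment (nth x0 (extend t a)) (i - k) k.+1 = extend (segment (nth x0 t) (i - k) k) a.
Proof.
move=> ki; rewrite -[LHS]extend_front_final; congr extend.
  apply: eq_from_tnth => j; rewrite !tnth_mktuple /= nth_rcons size_tuple ifT//.
  by rewrite -[X in (_ < X)%N](subnK ki) ltn_add2l.
by rewrite /final tnth_mktuple /= subnK// nth_rcons size_tuple ltnn eqxx.
Qed.

(** Directed information conditions on [Y] from time 1, index [k], whereas the Markov property
    conditions on the past from index 0. The initial block is first dropped by [g], which keeps the
    kernel, then [h] retains the last [k] letters; these lie after the initial block because
    [k <= i]. *)
Lemma cond_entropy_past i : markov_memory P k Y -> (k <= i)%N ->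
  cond_entropy (pmf_of P (fun w => (Y (i + k) w, block Y k i w))) =
  cond_entropy (margUW (split_window_law Q (pmf_of P (st i)))).
Proof.
move=> MY ki.
pose g (f : (i + k).-tuple B) : i.-tuple B := segment (nth b0 f) k i.
pose h (v : i.-tuple B) : k.-tuple B := segment (nth b0 v) (i - k) k.
pose c u v := cond_prob P (Y (i + k)) (block Y i k) u v.
pose p := pmf_of P (fun w => (Y (i + k)%N w, block Y 0 (i + k) w)).
have mp : finite_rv (fun w => (Y (i + k)%N w, block Y 0 (i + k) w)).
  by apply: finite_rv_pair => //; exact: finite_rv_block.
have mp1 : finite_rv (fun w => (Y (i + k)%N w, block Y k i w)).
  by apply: finite_rv_pair => //; exact: finite_rv_block.
have pc u f : p (u, f) = pmf_image p snd f * c u (h (g f)).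
  have pF : pmf_image p snd f = pmf_of P (block Y 0 (i + k)) f.
    by rewrite -(pmf_of_comp P snd mp).
  have p0 t : 0 <= p t by exact: pmf_of_ge0.
  have := pmf_image_ge0 snd f p0; rewrite le_eqVlt => /orP[/eqP E|pos].
    rewrite -E mul0r; apply/eqP; rewrite eq_le p0 andbT [leRHS]E.
    exact: (le_pmf_image snd (u, f) p0).
  pose y j := if j == (i + k)%N then u else nth b0 f j.
  have yE a m : (a + m <= i + k)%N -> segment y a m = segment (nth b0 f) a m.
    move=> am; apply: eq_from_tnth => j; rewrite !tnth_mktuple /y ifF//.
    by apply/negbTE; rewrite neq_ltn (leq_trans _ am)// ltn_add2l.
  have fE : segment (nth b0 f) 0 (i + k) = f.
    by apply: eq_from_tnth => j; rewrite tnth_mktuple add0n -tnth_nth.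
  have := MY i y; rewrite !yE ?add0n// fE -pF => /(_ pos).
  have yu : y (i + k)%N = u by rewrite /y eqxx.
  rewrite !yu /h /g segment_nested// => E.
  rewrite /c -E /cond_prob /cond_pmf -/p.
  by rewrite mulrC divfK// gt_eqF.
have p1E : pmf_of P (fun w => (Y (i + k)%N w, block Y k i w)) =
    pmf_image p (fun t => (t.1, g t.2)).
  apply/funext => t; rewrite -(pmf_of_comp P (fun t => (t.1, g t.2)) mp).
  congr (pmf_of P _ t); apply/funext => w /=; congr pair.
  by rewrite /g -(@block_segment _ _ Y b0 0 k i (i + k)%N w) ?add0n// addnC.
have p1c := @factor_image _ _ _ _ p g (fun u v => c u (h v)) pc.
rewrite p1E (cond_entropy_factor (h := h) _ p1c); last first.
  by move=> t; apply: pmf_image_ge0 => t'; exact: pmf_of_ge0.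
rewrite -p1E /margUW -pmf_split_window; congr cond_entropy; apply/funext => t.
rewrite -(pmf_of_comp P (fun t => (t.1, h t.2)) mp1).
rewrite -(pmf_of_comp P (fun t => (t.1.1, t.2)) (finite_rv_split_window i)).
congr (pmf_of P _ t); apply/funext => w /=; congr pair.
rewrite /h -(@block_segment _ _ Y b0 k (i - k) k i w) ?subnK//.
by rewrite subnKC.
Qed.

(** Here the pair chain provides the kernel: [c] is the law of the new letter of [Y] given the state
    and the new letter of [X]. *)
Lemma cond_entropy_pasts i : (k <= i)%N ->
  cond_entropy (pmf_of P (fun w => (Y (i + k) w, (block Y k i w, block X k i.+1 w)))) =
  cond_entropy (pmf_image (split_window_law Q (pmf_of P (st i)))
    (fun t => (t.1.1, (t.1.2, t.2)))).
Proof.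
move=> ki.
pose h (v : i.-tuple B * i.+1.-tuple A) : k.+1.-tuple A * k.-tuple B :=
  (segment (nth a0 v.2) (i - k) k.+1, segment (nth b0 v.1) (i - k) k).
pose c u (vw : k.+1.-tuple A * k.-tuple B) :=
  q (front vw.1, vw.2) (final vw.1, u) / \sum_b q (front vw.1, vw.2) (final vw.1, b).
pose p := pmf_of P (fun w => (Y (i + k)%N w, (block Y k i w, block X k i.+1 w))).
have mV : finite_rv (fun w => (block Y k i w, block X k i.+1 w)).
  by apply: finite_rv_pair => //; exact: finite_rv_block.
have mp : finite_rv (fun w => (Y (i + k)%N w, (block Y k i w, block X k i.+1 w))).
  exact: finite_rv_pair.
have q0 := rate_gt0 Qpos.
(* The conditioning block contains the current letter of [X], which belongs to the new symbol.
   Making it an argument leaves an adapted function, as [mean_one_step] requires. *)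
pose V w (a : A) := (block Y k i w, extend (block X k i w) a).
have VE w : (block Y k i w, block X k i.+1 w) = V w (sy i w).1.
  by rewrite /V block_extend /symbol addnC.
have adV v a : adapted k X Y i (fun w => (V w a == v)%:R : R).
  move=> w w' H; congr ((_ == _)%:R); rewrite /V; congr (_, extend _ _);
  apply: eq_from_tnth => j; rewrite !tnth_mktuple;
  by have [] := H (k + j)%N; rewrite // [(i + k)%N]addnC ltn_add2l.
have hV w a : h (V w a) = (extend (st i w).1 a, (st i w).2).
  have -> : h (V w a) = (segment (nth a0 (extend (block X k i w) a)) (i - k) k.+1,
    segment (nth b0 (block Y k i w)) (i - k) k) by [].
  rewrite segment_extend// -!(@block_segment _ _ _ _ k (i - k) k i w) ?subnK//.
  by rewrite subnKC.
have pc u v : p (u, v) = pmf_image p snd v * c u (h v).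
  have -> : pmf_image p snd v = pmf_of P (fun w => (block Y k i w, block X k i.+1 w)) v.
    by rewrite -(pmf_of_comp P snd mp).
  rewrite /p !pmf_of_mean//.
  have -> : (fun w => ((block Y k i w, block X k i.+1 w) == v)%:R : R) =
      (fun w => (V w (sy i w).1 == v)%:R).
    by apply/funext => w; rewrite VE.
  have -> : (fun w => ((Y (i + k)%N w, (block Y k i w, block X k i.+1 w)) == (u, v))%:R : R) =
      (fun w => (V w (sy i w).1 == v)%:R * ((sy i w).2 == u)%:R).
    by apply/funext => w; rewrite xpair_eqE VE andbC -natrM mulnb.
  rewrite (mean_one_step mX mY PQ (n := i)
    (F := fun w c => (V w c.1 == v)%:R * (c.2 == u)%:R)); last first.
    by move=> c' w w' H; rewrite (adV v c'.1 _ _ H).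
  rewrite (mean_one_step mX mY PQ (n := i)
    (F := fun w c => (V w c.1 == v)%:R)); last first.
    by move=> c' w w' H; rewrite (adV v c'.1 _ _ H).
  rewrite mulrC -meanZ; last first.
    apply: (adapted_simple (k := k) mX mY (n := i)) => w w' H.
    rewrite (adapted_state H); apply: eq_bigr => c' _.
    by rewrite (adV v c'.1 _ _ H).
  congr (mean P); apply/funext => w.
  rewrite -(pair_bigA _ (fun a b => q (st i w) (a, b) * ((V w a == v)%:R * (b == u)%:R)))/=.
  rewrite -(pair_bigA _ (fun a b => q (st i w) (a, b) * (V w a == v)%:R))/=.
  rewrite mulr_sumr; apply: eq_bigr => a _.
  rewrite -mulr_suml (bigD1 u)//= eqxx mulr1 big1 ?addr0; last first.
    by move=> b /negPf ->; rewrite !mulr0.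
  case: eqP => [<-|_]; last by rewrite !mulr0.
  rewrite !mulr1 hV /c; case: (st i w) => z1 z2 /=.
  by rewrite front_extend final_extend divfK// gt_eqF// rate_fst_gt0.
rewrite (cond_entropy_factor (h := h) _ pc); last by move=> t; exact: pmf_of_ge0.
rewrite -pmf_split_window; congr cond_entropy; apply/funext => t.
rewrite -(pmf_of_comp P (fun t => (t.1, h t.2)) mp).
rewrite -(pmf_of_comp P (fun t => (t.1.1, (t.1.2, t.2))) (finite_rv_split_window i)).
congr (pmf_of P _ t); apply/funext => w /=; congr pair.
by rewrite VE hV block_extend.
Qed.

Lemma directed_info_sum n : directed_info P k X Y n =
  \sum_(i < n) (cond_entropy (pmf_of P (fun w => (Y (i + k) w, block Y k i w))) -
   cond_entropy (pmf_of P (fun w => (Y (i + k) w, (block Y k i w, block X k i.+1 w))))).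
Proof. by rewrite /directed_info entropy_block sumrB. Qed.

Lemma directed_info_increment i : markov_memory P k Y -> (k <= i)%N ->
  cond_entropy (pmf_of P (fun w => (Y (i + k) w, block Y k i w))) -
  cond_entropy (pmf_of P (fun w => (Y (i + k) w, (block Y k i w, block X k i.+1 w)))) =
  cond_mutual_info (split_window_law Q (pmf_of P (st i))).
Proof.
move=> MY ki; rewrite cond_entropy_past// cond_entropy_pasts//.
rewrite cond_mutual_info_entropies// => t.
by rewrite mulr_ge0 ?pmf_of_ge0// ltW// rate_gt0.
Qed.

Section Stationary.
Variable nu : Z -> R.
Hypothesis nu0 : forall z, 0 < nu z.
Hypothesis nu1 : \sum_z nu z = 1.
Hypothesis nu_cvg : forall f z,
  (fun n => iter n (transition q s) f z) @ \oo --> stationary_mean nu f.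

Lemma cvg_pmf_state z : (fun n => pmf_of P (st n) z) @ \oo --> nu z.
Proof.
have E n : pmf_of P (st n) z = \sum_z' pmf_of P (st 0%N) z' *
    iter n (transition q s) (fun y => (y == z)%:R) z'.
  by rewrite pmf_of_mean ?(mean_state_iter (fun y => (y == z)%:R))//; exact: finite_rv_state.
under eq_fun do rewrite E.
have -> : nu z = \sum_z' pmf_of P (st 0%N) z' *
    stationary_mean nu (fun y => (y == z)%:R).
  rewrite -mulr_suml pmf_of_sum1 ?mul1r; last exact: finite_rv_state.
  rewrite /stationary_mean (bigD1 z)//= eqxx mulr1 big1 ?addr0// => y /negPf ->.
  by rewrite mulr0.
by apply: cvg_sumr => z'; apply: cvgMl_tmp; exact: nu_cvg.
Qed.

Lemma split_window_law_gt0 t : 0 < split_window_law Q nu t.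
Proof. by rewrite mulr_gt0// rate_gt0. Qed.

(** Continuity of the information at a positive law comes from the quadratic remainder bound: the
    main part is linear in the law and the rest tends to 0. *)
Lemma cvg_cond_mutual_info :
  (fun i => cond_mutual_info (split_window_law Q (pmf_of P (st i)))) @ \oo -->
  cond_mutual_info (split_window_law Q nu).
Proof.
set p := split_window_law Q nu.
pose t0 : B * k.+1.-tuple A * k.-tuple B :=
  (b0, [tuple a0 | j < k.+1], [tuple b0 | j < k]).
have [K K0 HK] := mutual_info_remainder_bounds t0 split_window_law_gt0.
pose p' i := split_window_law Q (pmf_of P (st i)).
have p'0 i t : 0 <= p' i t by rewrite mulr_ge0 ?pmf_of_ge0// ltW// rate_gt0.
have p'1 i : \sum_t p' i t = \sum_t p t.
  rewrite !sum_split_window_law1 ?nu1 ?pmf_of_sum1//; try exact: rate_sum1.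
  exact: finite_rv_state.
have p'p t : (fun i => p' i t) @ \oo --> p t.
  by apply: cvgMr_tmp; exact: cvg_pmf_state.
pose lin i := \sum_t p' i t * ln (info_ratio p t.1.1 t.1.2 t.2).
have linc : lin @ \oo --> cond_mutual_info p.
  apply: (@cvg_sumr _ _ _ _ _ _ (fun t i => p' i t * ln (info_ratio p t.1.1 t.1.2 t.2))
    (fun t => p t * ln (info_ratio p t.1.1 t.1.2 t.2))) => t.
  by apply: cvgMr_tmp; exact: p'p.
have distc : (fun i => K * (\sum_t `|p' i t - p t|) ^+ 2) @ \oo --> (0 : R).
  have D : (fun i => \sum_t `|p' i t - p t|) @ \oo --> (0 : R).
    rewrite -[X in _ --> X](@big1 R 0 +%R _ (index_enum (B * k.+1.-tuple A * k.-tuple B)%type)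
      xpredT (fun=> 0))//.
    apply: cvg_sumr => t.
    rewrite -(normr0 R) -(subrr (p t)).
    by apply: cvg_norm; apply: cvgB; [exact: p'p|exact: cvg_cst].
  have := @cvgMl_tmp R nat \oo _ _ K _ (cvgM D D); rewrite !mulr0.
  move=> H; rewrite (_ : (fun i => _) = (fun i => K *
    ((\sum_t `|p' i t - p t|) * (\sum_t `|p' i t - p t|)))); first exact: H.
  by apply/funext => i; rewrite expr2.
have remc : (fun i => cond_mutual_info (p' i) - lin i) @ \oo --> (0 : R).
  apply/cvgrPdist_le => e e0; move/cvgrPdist_le : distc => /(_ _ e0).
  apply: filterS => i; rewrite !sub0r !normrN; apply: le_trans.
  rewrite (le_trans (HK _ (p'0 i) (p'1 i)).1)//; exact: ler_norm.
rewrite -[X in _ --> X]add0r.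
rewrite (_ : (fun i => _) = (fun i => (cond_mutual_info (p' i) - lin i) + lin i)).
  exact: cvgD.
by apply/funext => i; rewrite subrK.
Qed.

(** The rate is a Cesaro mean of increments, so the first [k] of them, to which the window formula
    does not apply, have no effect. *)
Lemma directed_info_rate_cvg : markov_memory P k Y ->
  (fun n => directed_info P k X Y n / n%:R) @ \oo -->
  cond_mutual_info (split_window_law Q nu).
Proof.
move=> MY.
pose u i := cond_entropy (pmf_of P (fun w => (Y (i + k)%N w, block Y k i w))) -
   cond_entropy (pmf_of P (fun w => (Y (i + k)%N w, (block Y k i w, block X k i.+1 w)))).
have uc : u @ \oo --> cond_mutual_info (split_window_law Q nu).
  apply: cvg_trans cvg_cond_mutual_info; apply: near_eq_cvg.
  near=> i; rewrite /u directed_info_increment//.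
  by near: i; exact: nbhs_infty_ge.
rewrite -cvg_shiftS.
have := cesaro uc.
rewrite (_ : arithmetic_mean u = (fun n => directed_info P k X Y n.+1 / n.+1%:R))//.
apply/funext => n; rewrite /arithmetic_mean /series /= big_mkord directed_info_sum.
by rewrite mulrC.
Unshelve. all: by end_near. Qed.

End Stationary.

(** The initial law may have zeros, but after [k] steps every state is charged. *)
Lemma pmf_state_gt0 (e : R) z : 0 < e -> (forall f, (forall z, 0 <= f z) ->
    forall z z', e * f z' <= iter k (transition q s) f z) ->
  0 < pmf_of P (st k) z.
Proof.
move=> e0 He.
rewrite pmf_of_mean; last exact: finite_rv_state.
rewrite (mean_state_iter (fun y => (y == z)%:R)).
apply: lt_le_trans e0 _.
apply: (@le_trans _ _ (\sum_z' pmf_of P (st 0%N) z' * e)).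
  by rewrite -mulr_suml pmf_of_sum1 ?mul1r//; exact: finite_rv_state.
apply: ler_sum => z' _; rewrite ler_wpM2l ?pmf_of_ge0//.
have := He (fun y => (y == z)%:R) (fun y => ler0n _ _) z' z.
have zz : ((z == z)%:R : R) = 1 by rewrite eqxx.
by rewrite /= zz mulr1.
Qed.

(** Conditional independence at the single index [k], where every window has positive probability,
    already determines the form of [Q]. Conversely that form gives it at all times. *)
Lemma no_causal_influenceP : no_causal_influence P k X Y <->
  conditionally_autonomous Q.
Proof.
have q0 := rate_gt0 Qpos.
have law0 i t : 0 <= split_window_law Q (pmf_of P (st i)) t.
  by rewrite mulr_ge0 ?pmf_of_ge0// ltW.
have condE i u v w :
    [/\ cond_prob P (fun w => (Y (i + k)%N w, block X i k.+1 w)) (block Y i k) (u, v) w =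
      split_window_law Q (pmf_of P (st i)) (u, v, w) /
        margW (split_window_law Q (pmf_of P (st i))) w,
      cond_prob P (Y (i + k)%N) (block Y i k) u w =
      margUW (split_window_law Q (pmf_of P (st i))) (u, w) /
        margW (split_window_law Q (pmf_of P (st i))) w,
      cond_prob P (block X i k.+1) (block Y i k) v w =
      margVW (split_window_law Q (pmf_of P (st i))) (v, w) /
        margW (split_window_law Q (pmf_of P (st i))) w &
      pmf_of P (block Y i k) w = margW (split_window_law Q (pmf_of P (st i))) w].
  rewrite -pmf_split_window /margUW /margVW /margW /cond_prob /cond_pmf.
  have mp := finite_rv_split_window i.
  rewrite -(pmf_of_comp P snd mp).
  rewrite -(pmf_of_comp P (fun t => (t.1.1, t.2)) mp).
  rewrite -(pmf_of_comp P (fun t => (t.1.2, t.2)) mp).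
  have m1 : finite_rv (fun w => (Y (i + k)%N w, block Y i k w)).
    by apply: finite_rv_pair => //; exact: finite_rv_block.
  have m2 : finite_rv (fun w => (block X i k.+1 w, block Y i k w)).
    by apply: finite_rv_pair => //; exact: finite_rv_block.
  rewrite -(pmf_of_comp P snd m1) -(pmf_of_comp P snd m2).
  by split.
split=> [nc|[g gP] i u v w pw].
- have [e /andP[e0 _] He] := iter_transition_lower q0 (@shift_mixing A B k).
  have mu0 z : 0 < pmf_of P (st k) z by exact: pmf_state_gt0 e0 He.
  apply: (autonomous_of_info_ratio q0 mu0) => u v w.
  set p := split_window_law Q _.
  have p0 t : 0 < p t by rewrite mulr_gt0.
  have p0' t : 0 <= p t by exact: ltW.
  have [p1 p2 p3] := marg_gt0 p0' (p0 (u, v, w)).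
  have [E1 E2 E3 E4] := condE k u v w.
  have := nc k u v w; rewrite E1 E2 E3 E4 -/p => /(_ p3) E.
  by rewrite info_ratioE E divff// gt_eqF// mulr_gt0// divr_gt0.
- have [E1 E2 E3 E4] := condE i u v w; rewrite E1 E2 E3.
  rewrite E4 in pw.
  have [H1 H2] := autonomous_split_window_law b0 a0 (pmf_of P (st i)) gP.
  by rewrite H1 H2; field; rewrite gt_eqF.
Qed.

End DirectedInformation.

(** * The plug-in estimator *)

Section Empirical.
Context {d : measure_display} {Omega : measurableType d} {R : realType}.
Variables (P : probability Omega R) (A B : finType) (k : nat).
Variables (X : nat -> Omega -> A) (Y : nat -> Omega -> B).
Variable Q : k.-tuple A -> k.-tuple B -> A -> B -> R.

Local Notation Z := (k.-tuple A * k.-tuple B)%type.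
Local Notation C := (A * B)%type.
Local Notation T := (B * k.+1.-tuple A * k.-tuple B)%type.
Local Notation q := (rate Q).
Local Notation s := (@step A B k).
Local Notation st := (state k X Y).
Local Notation sy := (symbol k X Y).

Definition split_empirical n w : T -> R := split_law (empirical_pmf R X Y n w).
Local Notation emp := split_empirical.

Lemma split_empiricalE n w t :
  emp n w t = n%:R^-1 * \sum_(i < n) (split_window (st i w) (sy i w) == t)%:R.
Proof.
rewrite /split_empirical /split_law /pmf_image /empirical_pmf -mulr_sumr; congr (_ * _).
rewrite exchange_big; apply: eq_bigr => i _ /=.
rewrite big_mkcond (bigD1 (block X i k.+1 w, block Y i k.+1 w))//= !eqxx/= big1 ?addr0.
  rewrite /split_window /= -!block_extend.
  have -> : final (block Y i k.+1 w) = Y (i + k)%N w by rewrite block_extend final_extend.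
  have -> : front (block Y i k.+1 w) = block Y i k w by rewrite block_extend front_extend.
  by case: ifP.
move=> [a b]; rewrite xpair_eqE /= eq_sym (eq_sym b) => /negPf ->.
by case: ifP.
Qed.

Lemma split_empirical_ge0 n w t : 0 <= emp n w t.
Proof. by rewrite split_empiricalE mulr_ge0 ?invr_ge0// sumr_ge0. Qed.

Lemma sum_split_empirical n w (f : T -> R) : \sum_t emp n w t * f t =
  n%:R^-1 * partial_sum X Y (fun z c => f (split_window z c)) n w.
Proof.
under eq_bigr do rewrite split_empiricalE -mulrA mulr_suml.
rewrite -mulr_sumr exchange_big; congr (_ * _); apply: eq_bigr => i _ /=.
exact: sum_delta.
Qed.

Lemma sum_split_empirical1 n w : (0 < n)%N -> \sum_t emp n w t = 1.
Proof.
move=> n0; under eq_bigr do rewrite -[emp _ _ _]mulr1.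
rewrite (sum_split_empirical n w (fun=> 1)) /partial_sum sumr_const card_ord.
by rewrite -[1 *+ n]/(n%:R) mulVf// pnatr_eq0 -lt0n.
Qed.

Hypothesis mX : forall n, finite_rv (X n).
Hypothesis mY : forall n, finite_rv (Y n).
Hypothesis PQ : markov_chain_with P Q X Y.
Hypothesis Qpos : positive_transition_matrix Q.
Variable nu : Z -> R.
Hypothesis nu1 : \sum_z nu z = 1.
Hypothesis nu_inv : forall f,
  stationary_mean nu (transition q s f) = stationary_mean nu f.
Hypothesis nu_cvg : forall f z,
  (fun n => iter n (transition q s) f z) @ \oo --> stationary_mean nu f.

Local Notation p := (split_window_law Q nu).

Lemma centered_correctors (psi : Z -> C -> R) : window_mean Q nu psi = 0 ->
  exists (g G : Z -> R) (v : R),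
    (forall z, \sum_c q z c * (psi z c + g (s z c)) = g z) /\
    (forall z, \sum_c q z c *
      (psi z c ^+ 2 + 2 * g (s z c) * psi z c + G (s z c)) = G z + v).
Proof.
move=> psi0.
have [g gP] := poisson_corrector psi nu1 nu_inv nu_cvg.
have [G GP] := poisson_corrector
  (fun z c => psi z c ^+ 2 + 2 * g (s z c) * psi z c) nu1 nu_inv nu_cvg.
exists g, G, (window_mean Q nu (fun z c => psi z c ^+ 2 + 2 * g (s z c) * psi z c)).
by split=> z; [rewrite gP psi0 addr0|rewrite GP].
Qed.

Lemma window_mean_split (f : T -> R) :
  window_mean Q nu (fun z c => f (split_window z c)) = \sum_t p t * f t.
Proof. by rewrite sum_split_window_law. Qed.

Lemma sum_split_law1 : \sum_t p t = 1.
Proof. by rewrite sum_split_window_law1// => z; exact: rate_sum1. Qed.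

Definition empirical_dist n w : R := \sum_t `|emp n w t - p t|.

Lemma simple_split_empirical n t : simple_rv (fun w => emp n w t).
Proof.
have -> : (fun w => emp n w t) = (fun w => n%:R^-1 *
    partial_sum X Y (fun z c => (split_window z c == t)%:R) n w).
  by apply/funext => w; rewrite split_empiricalE.
exact/simpleZ/simple_partial_sum.
Qed.

Lemma simple_empirical_dist n : simple_rv (empirical_dist n).
Proof.
apply: simple_sum => t.
exact: (simple_map (fun x : R => `|x - p t|) (simple_split_empirical n t)).
Qed.

Lemma empirical_dist_ge0 n w : 0 <= empirical_dist n w.
Proof. exact: sumr_ge0. Qed.

Lemma sum_sqr_le (I : finType) (F : I -> R) :
  (\sum_i F i) ^+ 2 <= #|I|%:R * \sum_i F i ^+ 2.
Proof.
have cst (c : R) : \sum_(j : I) c = #|I|%:R * c by rewrite sumr_const mulr_natl.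
rewrite -subr_ge0.
suff -> : #|I|%:R * \sum_i F i ^+ 2 - (\sum_i F i) ^+ 2 =
    2^-1 * \sum_i \sum_j (F i - F j) ^+ 2.
  by rewrite mulr_ge0// sumr_ge0// => i _; rewrite sumr_ge0// => j _; exact: sqr_ge0.
have -> : \sum_i \sum_j (F i - F j) ^+ 2 =
    \sum_i (#|I|%:R * F i ^+ 2 - 2 * F i * (\sum_j F j) + \sum_j F j ^+ 2).
  apply: eq_bigr => i _.
  have e j : (F i - F j) ^+ 2 = F i ^+ 2 - 2 * F i * F j + F j ^+ 2 by ring.
  by under eq_bigr do rewrite e; rewrite big_split sumrB/= cst -mulr_sumr.
rewrite big_split sumrB/= cst -mulr_sumr -mulr_suml -mulr_sumr.
by field.
Qed.

(** Each deviation of the empirical law is a centered partial sum divided by [n], with second moment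
    [O(n)]; the Cauchy-Schwarz inequality adds the cells up. *)
Lemma empirical_dist_moment : exists2 K, 0 <= K &
  forall n, (0 < n)%N -> mean P (fun w => empirical_dist n w ^+ 2) <= K * n%:R^-1.
Proof.
pose psi (t : T) z c : R := (split_window z c == t)%:R - p t.
have psi0 t : window_mean Q nu (psi t) = 0.
  rewrite (window_mean_split (fun u => (u == t)%:R - p t)).
  under eq_bigr do rewrite mulrBr.
  rewrite sumrB -mulr_suml sum_split_law1 mul1r (eq_bigr (fun u => (t == u)%:R * p u)).
    by rewrite sum_delta subrr.
  by move=> u _; rewrite mulrC eq_sym.
have bound t : exists K, 0 <= K /\
    forall n, mean P (fun w => partial_sum X Y (psi t) n w ^+ 2) <= K * n.+1%:R.
  have [g [G [v [gP GP]]]] := centered_correctors (psi0 t).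
  exact: (second_moment_le mX mY PQ Qpos gP GP).
have [K KP] := choice bound.
(* The factor 2 comes from [n + 1 <= 2 n]. *)
exists (#|{: T}|%:R * \sum_t (2 * K t)).
  by rewrite mulr_ge0// sumr_ge0// => t _; rewrite mulr_ge0//; case: (KP t).
move=> n n0.
have nR : (0 : R) < n%:R by rewrite ltr0n.
have empB w t : emp n w t - p t = n%:R^-1 * partial_sum X Y (psi t) n w.
  rewrite split_empiricalE /partial_sum sumrB mulrBr sumr_const card_ord.
  by rewrite -[p t *+ n]mulr_natl mulKf ?gt_eqF.
have sq t : simple_rv (fun w => partial_sum X Y (psi t) n w ^+ 2) by exact: simple_sq.
have step1 : mean P (fun w => empirical_dist n w ^+ 2) <=
    mean P (fun w => #|{: T}|%:R * \sum_t (n%:R^-1 ^+ 2 *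
      partial_sum X Y (psi t) n w ^+ 2)).
  apply: le_mean.
  - exact: (simple_map (fun x : R => x ^+ 2) (simple_empirical_dist n)).
  - by apply: simpleZ; apply: simple_sum => t; exact/simpleZ/sq.
  - move=> w; apply: le_trans (sum_sqr_le _) _.
    by under eq_bigr do rewrite empB -normrX ger0_norm ?sqr_ge0// exprMn.
apply: le_trans step1 _.
rewrite meanZ; last by apply: simple_sum => t; exact/simpleZ/sq.
rewrite mean_sum; last by move=> t; exact/simpleZ/sq.
rewrite -mulrA ler_wpM2l// mulr_suml ler_sum// => t _.
rewrite meanZ//; have [K0 Kle] := KP t.
apply: le_trans (ler_wpM2l _ (Kle n)) _; first exact: sqr_ge0.
rewrite (_ : 2 * K t / n%:R = n%:R^-1 ^+ 2 * (K t * (2 * n%:R))); last first.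
  by field; rewrite gt_eqF.
rewrite ler_wpM2l ?sqr_ge0// ler_wpM2l// -natrM ler_nat.
by rewrite mul2n -addnn -addn1 leq_add2l.
Qed.

Lemma correctors_var_ge0 (psi : Z -> C -> R) (g G : Z -> R) (v : R) :
  (forall z, \sum_c q z c * (psi z c + g (s z c)) = g z) ->
  (forall z, \sum_c q z c *
      (psi z c ^+ 2 + 2 * g (s z c) * psi z c + G (s z c)) = G z + v) ->
  0 <= v.
Proof.
move=> gP GP; have Hv := second_moment_cvg mX mY PQ Qpos gP GP.
rewrite -(cvg_lim (@norm_hausdorff _ _) Hv).
apply: limr_ge; first exact: cvgP Hv.
apply: nearW => n; rewrite mulr_ge0 ?invr_ge0//.
by apply: mean_ge0 => [|w]; [exact: simple_sq|exact: sqr_ge0].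
Qed.

(** The constant [a] does not affect the variance, and the mean of the centered sum is bounded, so
    its square over [n] vanishes. *)
Lemma partial_sum_variance_cvg (psi : Z -> C -> R) (g G : Z -> R) (v a : R) :
  (forall z, \sum_c q z c * (psi z c + g (s z c)) = g z) ->
  (forall z, \sum_c q z c *
      (psi z c ^+ 2 + 2 * g (s z c) * psi z c + G (s z c)) = G z + v) ->
  ((n%:R^-1)%:E * 'V_P[partial_sum X Y (fun z c => psi z c + a)%R n])%E
    @[n --> \oo] --> v%:E.
Proof.
move=> gP GP; have [K0 HK] := mean_partial_sum_bound mX mY PQ Qpos gP.
pose m1 n := mean P (partial_sum X Y psi n).
pose m2 n := mean P (fun w => partial_sum X Y psi n w ^+ 2).
have sP n : simple_rv (partial_sum X Y psi n) by exact: simple_partial_sum.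
have sP2 n : simple_rv (fun w => partial_sum X Y psi n w ^+ 2) by exact: simple_sq.
have VE n : 'V_P[partial_sum X Y (fun z c => psi z c + a) n] = (m2 n - m1 n ^+ 2)%:E.
  rewrite simple_variance; last exact: simple_partial_sum.
  have e w : partial_sum X Y (fun z c => psi z c + a) n w =
      partial_sum X Y psi n w + n%:R * a.
    by rewrite /partial_sum big_split/= sumr_const card_ord -[a *+ n]mulr_natl.
  have -> : (fun w => partial_sum X Y (fun z c => psi z c + a) n w *
        partial_sum X Y (fun z c => psi z c + a) n w) =
      (fun w => partial_sum X Y psi n w ^+ 2 +
        (2 * (n%:R * a) * partial_sum X Y psi n w + (n%:R * a) ^+ 2)).
    by apply/funext => w; rewrite e; ring.
  have -> : partial_sum X Y (fun z c => psi z c + a) n =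
      (fun w => partial_sum X Y psi n w + n%:R * a) by apply/funext.
  have sZ : simple_rv (fun w => 2 * (n%:R * a) * partial_sum X Y psi n w) by exact: simpleZ.
  have sC b : simple_rv (fun _ : Omega => b : R) by exact: simple_cst.
  rewrite !meanD//; last exact: simpleD.
  rewrite meanZ// !mean_cst; congr EFin; rewrite -/(m1 n) -/(m2 n); ring.
have -> : (fun n => ((n%:R^-1)%:E * 'V_P[partial_sum X Y (fun z c => psi z c + a)%R n])%E) =
    (fun n => (n%:R^-1 * m2 n - n%:R^-1 * m1 n ^+ 2)%:E).
  by apply/funext => n; rewrite VE -EFinM mulrBr.
apply: cvg_EFin; first by apply: nearW.
rewrite -[v in X in _ --> X]subr0.
apply: cvgB; first exact: (second_moment_cvg mX mY PQ Qpos gP GP).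
apply: (@cvg_of_sqrt_bound R _ 0 (K0 ^+ 2)); first exact: sqr_ge0.
move=> n n0; rewrite subr0.
have n1 : (1 : R) <= n%:R by rewrite ler1n.
have s1 : 1 <= Num.sqrt (n%:R : R) by rewrite -[leLHS]sqrtr1 ler_wsqrtr.
rewrite ger0_norm; last by rewrite mulr_ge0 ?invr_ge0// sqr_ge0.
rewrite mulrC ler_pM ?sqr_ge0 ?invr_ge0//.
  rewrite -real_normK ?num_real// ler_pXn2r ?nnegrE//; first exact: HK.
  exact: le_trans (HK 0%N).
rewrite lef_pV2 ?posrE ?(lt_le_trans ltr01)//.
by rewrite -[leRHS]sqr_sqrtr ?ler0n// expr2 ler_peMl// (le_trans ler01).
Qed.

(** The walk starts at [- x] with initial variance [c0 = e ^ 2], so the smoothed step at 0 becomes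
    one at [x], and at time 1 the variance is [e ^ 2 + v]. *)
Lemma partial_sum_Phi_cvg (psi : Z -> C -> R) (g G : Z -> R) (v e x : R) :
  (forall z, \sum_c q z c * (psi z c + g (s z c)) = g z) ->
  (forall z, \sum_c q z c *
      (psi z c ^+ 2 + 2 * g (s z c) * psi z c + G (s z c)) = G z + v) ->
  0 < e ->
  (fun n => mean P (fun w =>
     Phi ((x - (Num.sqrt n%:R)^-1 * partial_sum X Y psi n w) / e))) @ \oo -->
    Phi (x / Num.sqrt (e ^+ 2 + v)).
Proof.
move=> gP GP e0; have v0 := correctors_var_ge0 gP GP.
have e20 : 0 < e ^+ 2 by rewrite exprn_gt0.
have := @functional_clt _ _ _ P A B k X Y Q mX mY PQ Qpos unit (fun=> psi) (fun=> v) (fun=> g)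
  (fun _ z => G z / 2) _ (fun=> - x) (fun _ => gP) _ (heat_function_Phi e20 v0).
(* The moment identities use twice the second-order coefficient of the test function expansion,
   hence [G / 2]. *)
have H : forall (p : unit * unit) z, \sum_c q z c * (psi z c * psi z c / 2 +
     g (s z c) * psi z c + G (s z c) / 2) = G z / 2 + v / 2.
  move=> _ z; rewrite -mulrDl -GP mulr_suml; apply: eq_bigr => c _; by field.
move=> /(_ H); rewrite /inv_scale /= mulr1 mulrN opprK [_^-1 * x]mulrC.
under eq_fun => n.
  under eq_fun => w do rewrite mulr0 addr0 sqrtr_sqr (gtr0_norm e0) /along -mulrN opprD opprK mulrC.
  over.
exact.
Qed.

End Empirical.

Section InvariantLaw.
Context {R : realType} (A B : finType) (k : nat).
Variable Q : k.-tuple A -> k.-tuple B -> A -> B -> R.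

Local Notation Z := (k.-tuple A * k.-tuple B)%type.
Local Notation C := (A * B)%type.
Local Notation K := (transition (rate Q) (@step A B k)).

Lemma stationary_mean_window (nu f : Z -> R) :
  \sum_z pmf_image (window_law Q nu) (fun ab => (back ab.1, back ab.2)) z * f z =
  stationary_mean nu (K f).
Proof.
rewrite sum_pmf_image.
rewrite (reindex (fun t : Z * C => (extend t.1.1 t.2.1, extend t.1.2 t.2.2)))/=; last first.
  exists (fun ab => ((front ab.1, front ab.2), (final ab.1, final ab.2))).
    by move=> [[a b] [a' b']] _ /=; rewrite !front_extend !final_extend.
  by move=> [a b] _ /=; rewrite !extend_front_final.
rewrite -(pair_bigA _ (fun z c => window_law Q nu (extend z.1 c.1, extend z.2 c.2) *
  f (back (extend z.1 c.1), back (extend z.2 c.2))))/=.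
apply: eq_bigr => z _; rewrite /transition mulr_sumr; apply: eq_bigr => c _.
by rewrite /window_law/= !front_extend !final_extend mulrA; case: z.
Qed.

Lemma invariant_distributionP (nu : Z -> R) :
  (forall z, 0 <= nu z) -> \sum_z nu z = 1 ->
  invariant_distribution Q nu <->
  forall f, stationary_mean nu (K f) = stationary_mean nu f.
Proof.
move=> nu0 nu1; split=> [[_ _ H] f|H].
  by rewrite -stationary_mean_window; apply: eq_bigr => z _; rewrite H.
split=> // z.
have e (mu : Z -> R) : mu z = \sum_u mu u * (z == u)%:R.
  by rewrite -[LHS](sum_delta z); apply: eq_bigr => u _; rewrite mulrC.
by rewrite [LHS]e stationary_mean_window H /stationary_mean -e.
Qed.

(** Under [nu'] the means of all iterates of [f] coincide, while the iterates themselves converge to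
    the mean of [f] under [nu]. *)
Lemma invariant_distribution_unique (nu nu' : Z -> R) :
  (forall f z, (fun n => iter n K f z) @ \oo --> stationary_mean nu f) ->
  invariant_distribution Q nu' -> nu' =1 nu.
Proof.
move=> nu_cvg inv z; have [nu'0 nu'1 _] := inv.
have inv' := (invariant_distributionP nu'0 nu'1).1 inv.
have e (mu : Z -> R) : mu z = stationary_mean mu (fun u => (z == u)%:R).
  by rewrite -[LHS](sum_delta z); apply: eq_bigr => u _; rewrite mulrC.
rewrite !e; set f := fun u => _.
have it n : stationary_mean nu' (iter n K f) = stationary_mean nu' f.
  by elim: n => // n IH; rewrite iterS inv'.
have : (fun n => stationary_mean nu' (iter n K f)) @ \oo --> stationary_mean nu f.
  rewrite -[X in _ --> X]mul1r -nu'1 mulr_suml; apply: cvg_sumr => u.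
  by apply: cvgMl_tmp; exact: nu_cvg.
under eq_fun do rewrite it.
by move=> /(cvg_unique (@norm_hausdorff _ _) (@cvg_cst _ _ _ _ _)).
Qed.

End InvariantLaw.

Section PlugIn.
Context {d : measure_display} {Omega : measurableType d} {R : realType}.
Variables (P : probability Omega R) (A B : finType) (k : nat).
Variables (X : nat -> Omega -> A) (Y : nat -> Omega -> B).
Variable Q : k.-tuple A -> k.-tuple B -> A -> B -> R.

Local Notation Z := (k.-tuple A * k.-tuple B)%type.
Local Notation C := (A * B)%type.
Local Notation T := (B * k.+1.-tuple A * k.-tuple B)%type.
Local Notation q := (rate Q).
Local Notation s := (@step A B k).
Local Notation st := (state k X Y).
Local Notation sy := (symbol k X Y).

Hypothesis mX : forall n, finite_rv (X n).
Hypothesis mY : forall n, finite_rv (Y n).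
Hypothesis PQ : markov_chain_with P Q X Y.
Hypothesis Qpos : positive_transition_matrix Q.
Variables (a0 : A) (b0 : B).
Variable nu : Z -> R.
Hypothesis nu0 : forall z, 0 < nu z.
Hypothesis nu1 : \sum_z nu z = 1.
Hypothesis nu_inv : forall f,
  stationary_mean nu (transition q s f) = stationary_mean nu f.
Hypothesis nu_cvg : forall f z,
  (fun n => iter n (transition q s) f z) @ \oo --> stationary_mean nu f.

Local Notation p := (split_window_law Q nu).
Local Notation emp := (split_empirical (R := R) X Y).
Local Notation dist := (empirical_dist X Y Q nu).
Local Notation I := (cond_mutual_info p).

Definition log_ratio (z : Z) (c : C) : R :=
  ln (info_ratio p (split_window z c).1.1 (split_window z c).1.2 (split_window z c).2).

Lemma plug_inE n w : (0 < n)%N -> plug_in R k X Y n w - I =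
  n%:R^-1 * partial_sum X Y (fun z c => log_ratio z c - I) n w +
  mutual_info_remainder p (emp n w).
Proof.
move=> n0; have nR : (n%:R : R) != 0 by rewrite pnatr_eq0 -lt0n.
rewrite /mutual_info_remainder
  (sum_split_empirical X Y n w (fun t => ln (info_ratio p t.1.1 t.1.2 t.2))).
rewrite /partial_sum sumrB sumr_const card_ord -[I *+ n]mulr_natl mulrBr mulKf//.
rewrite /plug_in /split_empirical; ring.
Qed.

Lemma log_likelihood_ratioE n w : log_likelihood_ratio Q nu X Y n w =
  partial_sum X Y log_ratio n w.
Proof.
have p0 := split_window_law_gt0 Qpos nu0.
have r0 u v t : 0 < info_ratio p u v t.
  by have [] := ln_info_ratio (fun t => ltW (p0 t)) (p0 (u, v, t)).
rewrite /log_likelihood_ratio split_law_window_law /partial_sum.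
have H m : 0 < \prod_(i < m) info_ratio p (Y (i + k)%N w) (block X i k.+1 w) (block Y i k w).
  by rewrite prodr_gt0.
elim: n => [|n IH]; first by rewrite !big_ord0 ln1.
rewrite !big_ord_recr/= lnM ?posrE; [|exact: H|exact: r0].
by rewrite IH /log_ratio /split_window /= -block_extend.
Qed.

Lemma simple_plug_in n : simple_rv (plug_in R k X Y n).
Proof.
apply: (adapted_simple mX mY (n := n)) => w w' H.
rewrite /plug_in; congr (cond_mutual_info (split_law _)); apply/funext => -[a b].
rewrite /empirical_pmf; congr (_ * _); apply: eq_bigr => i _ /=.
have e j : (j <= k)%N -> (i + j < n + k)%N.
  by move=> jk; rewrite -addSn leq_add.
have -> : block X i k.+1 w = block X i k.+1 w'.
  by apply: eq_from_tnth => j; rewrite !tnth_mktuple; have [] := H _ (e j (ltn_ord j)).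
suff -> : block Y i k.+1 w = block Y i k.+1 w' by [].
by apply: eq_from_tnth => j; rewrite !tnth_mktuple; have [] := H _ (e j (ltn_ord j)).
Qed.

Let t0 : T := (b0, [tuple a0 | j < k.+1], [tuple b0 | j < k]).

Lemma empirical_remainder_bounds : exists2 L, 0 <= L & forall n w, (0 < n)%N ->
  `|mutual_info_remainder p (emp n w)| <= L * dist n w ^+ 2 /\
  `|2 * mutual_info_remainder p (emp n w) - chi2_remainder p (emp n w)|
    <= L * dist n w ^+ 3.
Proof.
have [L L0 HL] := mutual_info_remainder_bounds t0 (split_window_law_gt0 Qpos nu0).
exists L => // n w n0; apply: HL; first exact: split_empirical_ge0.
by rewrite sum_split_empirical1// sum_split_law1.
Qed.

Lemma plug_in_normal : exists sigma2 : R,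
  ((n%:R^-1)%:E * 'V_P[log_likelihood_ratio Q nu X Y n])%E
     @[n --> \oo] --> sigma2%:E /\
  cvg_in_distribution P
    (fun n w => Num.sqrt n%:R * (plug_in R k X Y n w - I))
    (centered_normal sigma2).
Proof.
pose psi z c := log_ratio z c - I.
have psi0 : window_mean Q nu psi = 0.
  rewrite (window_mean_split _ _ (fun t => ln (info_ratio p t.1.1 t.1.2 t.2) - I)).
  under eq_bigr do rewrite mulrBr.
  by rewrite sumrB -mulr_suml sum_split_law1// mul1r subrr.
have [g [G [v [gP GP]]]] := centered_correctors nu1 nu_inv nu_cvg psi0.
have v0 := correctors_var_ge0 mX mY PQ Qpos gP GP.
exists v; split.
  have -> : log_likelihood_ratio Q nu X Y = partial_sum X Y (fun z c => psi z c + I).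
    apply/funext => n; apply/funext => w; rewrite log_likelihood_ratioE.
    by apply: eq_bigr => i _; rewrite subrK.
  exact: (partial_sum_variance_cvg mX mY PQ Qpos I gP GP).
pose S n w := (Num.sqrt n%:R)^-1 * partial_sum X Y psi n w.
apply: (@cvg_in_distribution_normal _ _ _ P _ S v) => //.
- move=> n; exact: (simple_map (fun x => Num.sqrt n%:R * (x - I)) (simple_plug_in n)).
- by move=> n; exact/simpleZ/simple_partial_sum.
(* After scaling, the nonlinear part has mean at most [sqrt n * L * (M / n)], of order
   [n^(-1/2)]. *)
- have [L L0 HL] := empirical_remainder_bounds.
  have [M M0 HM] := empirical_dist_moment mX mY PQ Qpos nu1 nu_inv nu_cvg.
  apply: (@cvg_of_sqrt_bound R _ 0 (L * M)); first exact: mulr_ge0.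
  move=> n n0; rewrite subr0.
  have s0 : 0 < Num.sqrt (n%:R : R) by rewrite sqrtr_gt0 ltr0n.
  have nV : n%:R^-1 = (Num.sqrt (n%:R : R) ^+ 2)^-1 by rewrite sqr_sqrtr.
  have sV : simple_rv (fun w => `|Num.sqrt n%:R * (plug_in R k X Y n w - I) - S n w|).
    apply: (simple_map (fun x : R => `|x|)).
    apply: (simple_map2 (fun x y => Num.sqrt n%:R * (x - I) - y)) (simple_plug_in n) _.
    exact/simpleZ/simple_partial_sum.
  rewrite ger0_norm; last exact: mean_ge0.
  apply: (@le_trans _ _ (mean P (fun w => Num.sqrt n%:R * L * dist n w ^+ 2))).
    apply: le_mean => //.
      exact/simpleZ/(simple_map (fun x : R => x ^+ 2))/simple_empirical_dist.
    move=> w; rewrite plug_inE//.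
    have -> : Num.sqrt n%:R * (n%:R^-1 * partial_sum X Y psi n w +
        mutual_info_remainder p (emp n w)) - S n w =
        Num.sqrt n%:R * mutual_info_remainder p (emp n w).
      by rewrite /S nV; field; exact: lt0r_neq0.
    rewrite normrM (gtr0_norm s0) -mulrA; apply: (ler_wpM2l (ltW s0)).
    by case: (HL n w n0).
  rewrite meanZ; last exact/(simple_map (fun x : R => x ^+ 2))/simple_empirical_dist.
  apply: le_trans (ler_wpM2l _ (HM n n0)) _; first by rewrite mulr_ge0// ltW.
  rewrite le_eqVlt; apply/orP; left; apply/eqP.
  by rewrite nV; field; exact: lt0r_neq0.
- by move=> e x e0; exact: (partial_sum_Phi_cvg mX mY PQ Qpos gP GP e0).
Qed.

End PlugIn.

Lemma chi2_remainder_sum (R : realType) (U V W : finType) (p r : U * V * W -> R)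
    (D := fun u v w => r (u, v, w) - p (u, v, w)) :
  chi2_remainder p r =
  \sum_w (\sum_u \sum_v D u v w ^+ 2 / p (u, v, w)
    + (\sum_u \sum_v D u v w) ^+ 2 / margW p w
    - \sum_u (\sum_v D u v w) ^+ 2 / margUW p (u, w)
    - \sum_v (\sum_u D u v w) ^+ 2 / margVW p (v, w)).
Proof.
rewrite !sumrB big_split/= /chi2_remainder /chi2 sum_triple; congr (_ + _ - _ - _).
- apply: eq_bigr => w _; rewrite !margW_sum -sumrB; congr (_ ^+ 2 / _).
  by apply: eq_bigr => u _; rewrite sumrB.
- rewrite exchange_big pair_bigA/=; apply: eq_bigr => -[u w] _.
  by rewrite !margUW_sum -sumrB.
- rewrite exchange_big pair_bigA/=; apply: eq_bigr => -[v w] _.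
  by rewrite !margVW_sum -sumrB.
Qed.

(** The Lipschitz bound serves when the empirical law is close to [p], the bound by 1 on the rare
    event that it is not. *)
Lemma expR_opp_dist (R : realType) (x y : R) : 0 <= x -> 0 <= y ->
  `|expR (- x) - expR (- y)| <= `|x - y| /\ `|expR (- x) - expR (- y)| <= 1.
Proof.
wlog xy : x y / x <= y.
  move=> H x0 y0; case/orP: (le_total x y) => [|yx]; first by move=> xy; exact: H.
  by rewrite distrC (distrC x); exact: H.
move=> x0 y0.
rewrite ger0_norm; last by rewrite subr_ge0 ler_expR lerN2.
rewrite distrC ger0_norm ?subr_ge0//.
have ex : expR (- x) <= 1 by rewrite -[leRHS]expR0 ler_expR oppr_le0.
split; last by rewrite (le_trans _ ex)// gerBl expR_ge0.
have -> : expR (- y) = expR (- x) * expR (- (y - x)) by rewrite -expRD; congr expR; ring.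
have := expR_ge1Dx (- (y - x)); have := expR_ge0 (- x).
nra.
Qed.

(** * The chi-squared limit in the absence of causal influence *)

Section NoInfluence.
Context {d : measure_display} {Omega : measurableType d} {R : realType}.
Variables (P : probability Omega R) (A B : finType) (k : nat).
Variables (X : nat -> Omega -> A) (Y : nat -> Omega -> B).
Variable Q : k.-tuple A -> k.-tuple B -> A -> B -> R.

Local Notation Z := (k.-tuple A * k.-tuple B)%type.
Local Notation C := (A * B)%type.
Local Notation T := (B * k.+1.-tuple A * k.-tuple B)%type.
Local Notation q := (rate Q).
Local Notation s := (@step A B k).
Local Notation st := (state k X Y).
Local Notation sy := (symbol k X Y).

Hypothesis mX : forall n, finite_rv (X n).
Hypothesis mY : forall n, finite_rv (Y n).
Hypothesis PQ : markov_chain_with P Q X Y.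
Hypothesis Qpos : positive_transition_matrix Q.
Variables (a0 : A) (b0 : B).
Variable nu : Z -> R.
Hypothesis nu0 : forall z, 0 < nu z.
Hypothesis nu1 : \sum_z nu z = 1.
Hypothesis nu_inv : forall f,
  stationary_mean nu (transition q s f) = stationary_mean nu f.
Hypothesis nu_cvg : forall f z,
  (fun n => iter n (transition q s) f z) @ \oo --> stationary_mean nu f.

Local Notation p := (split_window_law Q nu).
Local Notation emp := (split_empirical (R := R) X Y).
Local Notation dist := (empirical_dist X Y Q nu).

Hypothesis autonomous : conditionally_autonomous Q.

Let v0 : k.+1.-tuple A := [tuple a0 | j < k.+1].
Local Notation J := (interaction_index (k.-tuple B) b0 v0).

(** The interaction basis is taken for [p] itself, a product given [w] since [Q] is autonomous. The
    first property holds at every state, not just on average under [nu], because [g] is also the law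
    of the new letter of [Y] given the past and the letter of [X]. *)
Lemma autonomous_basis : exists phi : J -> B -> k.+1.-tuple A -> k.-tuple B -> R,
  [/\ forall j z, \sum_c q z c * phi j c.2 (extend z.1 c.1) z.2 = 0,
      forall j l, \sum_t p t * (phi j t.1.1 t.1.2 t.2 * phi l t.1.1 t.1.2 t.2) =
        (j == l)%:R &
      forall n w, (0 < n)%N ->
        \sum_j ((Num.sqrt n%:R)^-1 *
          partial_sum X Y (fun z c => phi j c.2 (extend z.1 c.1) z.2) n w) ^+ 2 =
        n%:R * chi2_remainder p (emp n w)].
Proof.
have [g gP] := autonomous.
have p0 := split_window_law_gt0 Qpos nu0.
have p0' t : 0 <= p t by exact: ltW.
have g1 := autonomous_sum1 (rate_gt0 Qpos) b0 a0 gP.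
have [lawE margE] := autonomous_split_window_law b0 a0 nu gP.
have mW w : 0 < margW p w by have [] := marg_gt0 p0' (p0 (b0, v0, w)).
have mVW v w : 0 < margVW p (v, w) by have [] := marg_gt0 p0' (p0 (b0, v, w)).
have g0 w u : 0 < g w u.
  have [+ _ _] := marg_gt0 p0' (p0 (u, v0, w)).
  by rewrite margE pmulr_lgt0.
pose b w v := margVW p (v, w) / margW p w.
have bpos w v : 0 < b w v by exact: divr_gt0.
have b1 w : \sum_v b w v = 1.
  rewrite -mulr_suml (_ : \sum_v _ = margW p w) ?divff ?gt_eqF//.
  by rewrite margW_sum exchange_big; apply: eq_bigr => v _; rewrite margVW_sum.
have [phi [F1 F2 F3]] := interaction_basis b0 v0 mW g0 bpos g1 b1.
have pE u v w : p (u, v, w) = margW p w * g w u * b w v.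
  by rewrite lawE /b; field; rewrite gt_eqF.
have phi0 j z : \sum_c q z c * phi j c.2 (extend z.1 c.1) z.2 = 0.
  rewrite -(pair_bigA _ (fun a u => q z (a, u) * phi j u (extend z.1 a) z.2))/=.
  rewrite big1// => a _; under eq_bigr do rewrite gP mulrAC.
  by rewrite -mulr_suml F1 mul0r.
exists phi; split=> //.
- move=> j l; rewrite sum_triple -[RHS]F2; apply: eq_bigr => w _.
  by apply: eq_bigr => u _; apply: eq_bigr => v _; rewrite /= pE.
- move=> n w n0.
  have s0 : Num.sqrt (n%:R : R) != 0 by rewrite gt_eqF// sqrtr_gt0 ltr0n.
  have nV : n%:R^-1 = (Num.sqrt (n%:R : R) ^+ 2)^-1 by rewrite sqr_sqrtr.
  pose D u v w' := emp n w (u, v, w') - p (u, v, w').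
  have e j : (Num.sqrt n%:R)^-1 *
      partial_sum X Y (fun z c => phi j c.2 (extend z.1 c.1) z.2) n w =
      Num.sqrt n%:R * \sum_w' \sum_u \sum_v phi j u v w' * D u v w'.
    pose F (t : T) := phi j t.1.1 t.1.2 t.2.
    have -> : \sum_w' \sum_u \sum_v phi j u v w' * D u v w' =
        \sum_t emp n w t * F t - \sum_t p t * F t.
      rewrite -sumrB sum_triple; apply: eq_bigr => w' _.
      apply: eq_bigr => u _; apply: eq_bigr => v _.
      by rewrite /D /F /= -mulrBl mulrC.
    have -> : \sum_t p t * F t = 0.
      by rewrite sum_split_window_law big1// => z _; rewrite [X in _ * X](phi0 j z) mulr0.
    by rewrite (sum_split_empirical X Y n w F) nV subr0; field.
  under eq_bigr do rewrite e exprMn.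
  rewrite -mulr_sumr sqr_sqrtr// F3 chi2_remainder_sum; congr (_ * _).
  apply: eq_bigr => w' _; congr (_ + _ - _ - _).
  + by apply: eq_bigr => u _; apply: eq_bigr => v _; rewrite -pE.
  + by apply: eq_bigr => u _; congr (_ / _); rewrite margE mulrC.
  + by apply: eq_bigr => v _; congr (_ / _); rewrite /b mulrCA divff ?mulr1// gt_eqF.
Qed.

Lemma autonomous_remainder q' : mutual_info_remainder p q' = cond_mutual_info q'.
Proof.
rewrite /mutual_info_remainder big1 ?subr0// => t _.
by rewrite (info_ratio_autonomous (rate_gt0 Qpos))// ln1 mulr0.
Qed.

Lemma chi2_laplace_cvg c : 0 < c ->
  (fun n => mean P (fun w => expR (- (c * (n%:R * chi2_remainder p (emp n w))))))
    @ \oo --> (Num.sqrt (1 + 2 * c))^-1 ^+ #|J|.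
Proof.
move=> cpos; have [phi [F1 F2 F3]] := autonomous_basis.
pose psi j (z : Z) (c : C) := phi j c.2 (extend z.1 c.1) z.2.
pose S (jl : J * J) : R := (jl.1 == jl.2)%:R.
have corr jl : exists G : Z -> R, forall z,
    \sum_c q z c * (psi jl.1 z c * psi jl.2 z c / 2 + 0 * psi jl.2 z c + G (s z c)) =
    G z + S jl / 2.
  have [G GP] := poisson_corrector (fun z c => psi jl.1 z c * psi jl.2 z c / 2)
    nu1 nu_inv nu_cvg.
  exists G => z; under eq_bigr do rewrite mul0r addr0.
  rewrite GP; congr (_ + _).
  rewrite (window_mean_split _ _
    (fun t => phi jl.1 t.1.1 t.1.2 t.2 * phi jl.2 t.1.1 t.1.2 t.2 / 2)).
  by under eq_bigr do rewrite mulrA; rewrite -mulr_suml F2.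
have [G GP] := choice corr.
(* The summands are centered given the state, so the first corrector is 0 and the limiting
   covariance is their stationary one, the identity. *)
have gP j z : \sum_c q z c * (psi j z c + 0) = 0.
  by under eq_bigr do rewrite addr0; exact: F1.
(* With this variance the Gaussian at time 0 is [exp (- c |y|^2)], once its prefactor is cancelled.
   At time 1 the value at 0 is [(c0 / (c0 + 1)) ^ (#|J| / 2)], which is
   [(1 + 2 c) ^ (- #|J| / 2)]. *)
pose c0 := (2 * c)^-1.
have c00 : 0 < c0 by rewrite invr_gt0 mulr_gt0.
have sc0 : 0 < Num.sqrt c0 by rewrite sqrtr_gt0.
have clt := @functional_clt _ _ _ P A B k X Y Q mX mY PQ Qpos J psi S (fun _ _ => 0)
  G _ (fun=> 0) gP GP (heat_function_gaussian J c00).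
have -> : (Num.sqrt (1 + 2 * c))^-1 ^+ #|J| =
    Num.sqrt c0 ^+ #|J| *
    (inv_scale c0 1 1 ^+ #|J| * @gaussian R J c0 1 1 (fun=> 0)).
  rewrite /gaussian big1 => [|j _]; last by rewrite expr0n.
  rewrite mulr0 oppr0 expR0 mulr1 -exprMn /inv_scale mulr1; congr (_ ^+ _).
  have -> : 1 + 2 * c = (c0 + 1) / c0 by rewrite /c0; field; rewrite gt_eqF.
  rewrite sqrtrM ?addr_ge0 ?ltW// sqrtrV ?ltW// invfM invrK mulrC.
  by [].
have e n w : expR (- (c * (n.+1%:R * chi2_remainder p (emp n.+1 w)))) =
    Num.sqrt c0 ^+ #|J| * (inv_scale c0 1 0 ^+ #|J| *
      gaussian c0 1 0 (along (fun=> 0) (fun j => partial_sum X Y (psi j) n.+1 w)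
        (Num.sqrt n.+1%:R)^-1)).
  rewrite [RHS]mulrA -exprMn /inv_scale mulr0 addr0 divff ?gt_eqF// expr1n mul1r.
  rewrite -(F3 _ _ (ltn0Sn n)) /gaussian /inv_scale [1 * 0]mulr0 [c0 + 0]addr0.
  have -> : (Num.sqrt c0)^-1 ^+ 2 / 2 = c.
    by rewrite exprVn sqr_sqrtr ?ltW// /c0 invrK mulrAC divff// mul1r.
  by under [in RHS]eq_bigr do rewrite /along add0r.
rewrite -(cvg_shiftS (fun n => mean P _)).
under eq_fun => n.
  under eq_fun do rewrite e.
  rewrite meanZ; last first.
    exact: (simple_functional mX mY psi (fun _ y => inv_scale c0 1 0 ^+ #|J| *
      gaussian c0 1 0 (along (fun=> 0) y (Num.sqrt n.+1%:R)^-1))).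
  over.
apply: cvgMl_tmp.
by move: clt; rewrite -(cvg_shiftS (fun n => mean P _)).
Qed.

Lemma quartic_root_cvg0 :
  (fun n => Num.sqrt (Num.sqrt (n%:R : R))^-1) @ \oo --> (0 : R).
Proof.
rewrite -[X in _ --> X]sqrtr0.
apply: (@cvg_comp _ _ _ (fun n : nat => (Num.sqrt (n%:R : R))^-1)); last first.
  exact: sqrt_continuous.
apply: (@cvg_of_sqrt_bound R _ 0 1) => // n _.
by rewrite subr0 mul1r ger0_norm// invr_ge0.
Qed.

Let Vn n w : R := 2 * n%:R * plug_in R k X Y n w.
Let Wn n w : R := n%:R * chi2_remainder p (emp n w).

Let Vn_ge0 n w : 0 <= Vn n w.
Proof.
rewrite mulr_ge0 ?mulr_ge0//; apply: cond_mutual_info_ge0 => t.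
exact: split_empirical_ge0.
Qed.

(* For [h > 0], [min(1, a D^3) <= (a h + h^-2) D^2]; with [a] of order [n] and the mean
   of [D^2] of order [n^-1], the choice [h = n^(-1/4)] makes the bound tend to 0. *)
Lemma laplace_remainder_bound c : 0 <= c -> exists2 a, 0 <= a & forall n, (0 < n)%N ->
  `|mean P (fun w => expR (- (c * Vn n w))) - mean P (fun w => expR (- (c * Wn n w)))| <=
  a * Num.sqrt (Num.sqrt n%:R)^-1.
Proof.
move=> c_ge0; have [phi [_ _ F3]] := autonomous_basis.
have [L L0 HL] := empirical_remainder_bounds X Y Qpos a0 b0 nu0 nu1.
have [M M0 HM] := empirical_dist_moment mX mY PQ Qpos nu1 nu_inv nu_cvg.
exists ((c * L + 1) * M); first by rewrite mulr_ge0// addr_ge0// mulr_ge0.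
move=> n n0; set h := Num.sqrt _.
have nR : 0 < (n%:R : R) by rewrite ltr0n.
have s0 : 0 < Num.sqrt (n%:R : R) by rewrite sqrtr_gt0.
have s1 : 1 <= Num.sqrt (n%:R : R) by rewrite -[leLHS]sqrtr1 ler_wsqrtr// ler1n.
have h0 : 0 < h by rewrite sqrtr_gt0 invr_gt0.
have h2 : h ^+ 2 = (Num.sqrt n%:R)^-1 by rewrite sqr_sqrtr// invr_ge0 ltW.
have h1 : h <= 1 by rewrite -[leRHS]sqrtr1 ler_wsqrtr// invf_le1.
have nh : n%:R = (h ^+ 4)^-1 by rewrite (exprM _ 2 2) h2 exprVn invrK sqr_sqrtr.
(* The chi-square combination has negative terms; its sign is visible only as a sum of squares. *)
have W0 w : 0 <= Wn n w by rewrite /Wn -F3// sumr_ge0// => j _; exact: sqr_ge0.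
have sW : simple_rv (Wn n).
  have -> : Wn n = fun w => \sum_j ((Num.sqrt n%:R)^-1 *
      partial_sum X Y (fun z c => phi j c.2 (extend z.1 c.1) z.2) n w) ^+ 2.
    by apply/funext => w; rewrite F3.
  apply: simple_sum => j.
  apply: (simple_map (fun x : R => ((Num.sqrt n%:R)^-1 * x) ^+ 2)).
  exact: simple_partial_sum.
have sV : simple_rv (Vn n) by exact/simpleZ/simple_plug_in.
have sD : simple_rv (fun w => dist n w ^+ 2).
  exact/(simple_map (fun x : R => x ^+ 2))/simple_empirical_dist.
have sE (F : Omega -> R) : simple_rv F -> simple_rv (fun w => expR (- (c * F w))).
  by move=> sF; exact: (simple_map (fun x => expR (- (c * x))) sF).
pose b := c * L * h * n%:R + (h ^+ 2)^-1.
have pointwise w : `|expR (- (c * Vn n w)) - expR (- (c * Wn n w))| <= b * dist n w ^+ 2.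
  have [E1 E2] := expR_opp_dist (mulr_ge0 c_ge0 (Vn_ge0 n w)) (mulr_ge0 c_ge0 (W0 w)).
  have D0 : 0 <= dist n w by exact: empirical_dist_ge0.
  have [Dh|hD] := leP (dist n w) h.
    apply: le_trans E1 _.
    rewrite -mulrBr normrM (ger0_norm c_ge0).
    have -> : Vn n w - Wn n w = n%:R * (2 * mutual_info_remainder p (emp n w) -
        chi2_remainder p (emp n w)).
      by rewrite autonomous_remainder /Vn /Wn /plug_in /split_empirical; ring.
    rewrite normrM (ger0_norm (ltW nR)).
    have [_ H] := HL n w n0.
    have D3 : dist n w ^+ 3 <= h * dist n w ^+ 2 by rewrite exprS ler_wpM2r// sqr_ge0.
    apply: (@le_trans _ _ (c * (n%:R * (L * (h * dist n w ^+ 2))))).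
      rewrite ler_wpM2l// ler_wpM2l ?(ltW nR)//; apply: le_trans H _.
      by rewrite ler_wpM2l.
    rewrite (_ : c * _ = c * L * h * n%:R * dist n w ^+ 2); last by ring.
    by rewrite ler_wpM2r ?sqr_ge0// lerDl invr_ge0 sqr_ge0.
  apply: le_trans E2 _.
  apply: (@le_trans _ _ ((h ^+ 2)^-1 * dist n w ^+ 2)); last first.
    rewrite ler_wpM2r ?sqr_ge0// lerDr; apply: mulr_ge0 (ltW nR).
    by apply: mulr_ge0 (ltW h0); exact: mulr_ge0.
  rewrite mulrC ler_pdivlMr ?exprn_gt0// mul1r ler_pXn2r ?nnegrE//; exact: ltW.
have sF : simple_rv (fun w => expR (- (c * Vn n w)) - expR (- (c * Wn n w))).
  exact: (simple_map2 (fun x y : R => x - y) (sE _ sV) (sE _ sW)).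
have -> : mean P (fun w => expR (- (c * Vn n w))) -
    mean P (fun w => expR (- (c * Wn n w))) =
    mean P (fun w => expR (- (c * Vn n w)) - expR (- (c * Wn n w))).
  rewrite -[X in _ + X]mulN1r -meanZ; last exact: sE.
  rewrite -meanD; [|exact: sE|exact/simpleZ/sE].
  by congr (mean P _); apply/funext => w; rewrite mulN1r.
have [mean1 mean2] : mean P (fun w => expR (- (c * Vn n w)) - expR (- (c * Wn n w))) <=
      mean P (fun w => b * dist n w ^+ 2) /\
    mean P (fun w => (- b) * dist n w ^+ 2) <=
      mean P (fun w => expR (- (c * Vn n w)) - expR (- (c * Wn n w))).
  split; apply: le_mean => //; try exact: simpleZ.
    by move=> w; apply: le_trans (ler_norm _) (pointwise w).
  by move=> w; have := pointwise w; rewrite mulNr ler_norml => /andP[].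
have bE : b * (M * n%:R^-1) <= (c * L + 1) * M * h.
  rewrite /b nh (_ : _ * _ = c * L * M * h + M * h ^+ 2); last first.
    by field; rewrite gt_eqF.
  rewrite mulrDl mulrDl mul1r lerD2l ler_wpM2l// expr2 ler_piMl//; exact: ltW.
have b0' : 0 <= b.
  apply: addr_ge0; last by rewrite invr_ge0 sqr_ge0.
  by apply: mulr_ge0 (ltW nR); apply: mulr_ge0 (ltW h0); exact: mulr_ge0.
have mD : b * mean P (fun w => dist n w ^+ 2) <= (c * L + 1) * M * h.
  by apply: le_trans bE; rewrite ler_wpM2l// HM.
rewrite !meanZ// in mean1 mean2.
by rewrite ler_norml (le_trans mean1)// andbT (le_trans _ mean2)// mulNr lerN2.
Qed.

Lemma plug_in_chi_squared :
  cvg_in_distribution P Vn (chi_squared R #|J|).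
Proof.
apply: (@cvg_in_distribution_laplace _ _ (fun c => (Num.sqrt (1 + 2 * c))^-1 ^+ #|J|)).
- exact: chi_squared_lt0.
- by move=> c c0; exact: chi_squared_laplace.
- by move=> n; exact/simpleZ/simple_plug_in.
- exact: Vn_ge0.
- move=> c; rewrite le_eqVlt => /predU1P[<-|c0].
    (* The value [c = 0] is treated apart, since the Gaussian has variance [1 / (2 c)]. *)
    rewrite mulr0 addr0 sqrtr1 invr1 expr1n.
    under eq_fun => n do (under eq_fun do rewrite mul0r oppr0 expR0; rewrite mean_cst).
    exact: cvg_cst.
  have [a a_ge0 Ha] := laplace_remainder_bound (ltW c0).
  have diff0 : (fun n => mean P (fun w => expR (- (c * Vn n w))) -
      mean P (fun w => expR (- (c * Wn n w)))) @ \oo --> (0 : R).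
    apply/norm_cvg0P.
    apply: (@squeeze_cvgr _ _ _ _ (fun=> 0) (fun n => a * Num.sqrt (Num.sqrt n%:R)^-1)).
    - by near=> n; rewrite normr_ge0/= Ha//; near: n; exists 1%N.
    - exact: cvg_cst.
    - by rewrite -[X in _ --> X](mulr0 a); apply: cvgMl_tmp; exact: quartic_root_cvg0.
  rewrite -[X in _ --> X]add0r.
  have -> : (fun n => mean P (fun w => expR (- (c * Vn n w)))) =
      (fun n => mean P (fun w => expR (- (c * Vn n w))) -
        mean P (fun w => expR (- (c * Wn n w))) + mean P (fun w => expR (- (c * Wn n w)))).
    by apply/funext => n; rewrite subrK.
  exact: cvgD diff0 (chi2_laplace_cvg c0).
Unshelve. all: by end_near. Qed.

End NoInfluence.

(** * Assembly of the two limit theorems *)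

Theorem theorem3p2 (R : realType) (d : measure_display)
    (Omega : measurableType d) (P : probability Omega R)
    (A B : finType) (k : nat)
    (X : nat -> Omega -> A) (Y : nat -> Omega -> B)
    (Q : k.-tuple A -> k.-tuple B -> A -> B -> R) :
  (1 <= k)%N ->
  (forall n, finite_rv (X n)) ->
  (forall n, finite_rv (Y n)) ->
  positive_transition_matrix Q ->
  markov_chain_with P Q X Y ->
  markov_memory P k Y ->
  let DI := directed_info_rate P k X Y in
  let m := #|A| in
  let l := #|B| in
  [/\ cvgn (fun n => directed_info P k X Y n / n%:R : R),
      causal_influence P k X Y <-> 0 < DI,
      causal_influence P k X Y ->
        exists (nu : k.-tuple A * k.-tuple B -> R) (sigma2 : R),
          [/\ invariant_distribution Q nu,
              forall nu', invariant_distribution Q nu' -> nu' =1 nu,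
              ((n%:R^-1)%:E * 'V_P[log_likelihood_ratio Q nu X Y n])%E
                @[n --> \oo] --> sigma2%:E &
              cvg_in_distribution P
                (fun n w => Num.sqrt n%:R * (plug_in R k X Y n w - DI))
                (centered_normal sigma2)],
      no_causal_influence P k X Y <-> DI = 0 &
      no_causal_influence P k X Y ->
        cvg_in_distribution P
          (fun n w => 2 * n%:R * plug_in R k X Y n w)
          (chi_squared R (l ^ k * (m ^ k.+1 - 1) * (l - 1))%N)].
Proof.
move=> k0 mX mY Qpos PQ MY DI m l.
(* The alphabets are nonempty because the sample space is, its probability being 1. *)
have [[a0 b0]] : exists ab : A * B, True.
  have [w _] : exists w : Omega, True.
    apply: contrapT => noW; have := probability_setT P.
    rewrite (_ : setT = set0) ?measure0; last first.
      by apply/seteqP; split=> w // _; apply: noW; exists w.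
    by move=> /eqP; rewrite eqe eq_sym oner_eq0.
  by exists (X 0%N w, Y 0%N w).
move=> _.
have q0 := rate_gt0 Qpos.
have [nu [nu0 nu1 nu_inv nu_cvg]] := chain_ergodic q0 (rate_sum1 Qpos)
  (@shift_mixing A B k) ([tuple a0 | j < k], [tuple b0 | j < k]).
have DI_cvg := directed_info_rate_cvg mX mY PQ Qpos a0 b0 nu0 nu1 nu_cvg MY.
have DIE : DI = cond_mutual_info (split_window_law Q nu).
  exact: (cvg_lim (@norm_hausdorff _ _) DI_cvg).
have p0 := split_window_law_gt0 Qpos nu0.
have DI_ge0 : 0 <= DI by rewrite DIE cond_mutual_info_ge0// => t; exact: ltW.
have autoP := no_causal_influenceP mX mY PQ Qpos a0 b0.
have noneP : no_causal_influence P k X Y <-> DI = 0.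
  split=> [/autoP au|].
    by rewrite DIE; exact/cond_mutual_info_ratio1/(info_ratio_autonomous q0 b0 a0 nu0).
  rewrite DIE => I0; apply/autoP/(autonomous_of_info_ratio q0 nu0).
  exact: cond_mutual_info_eq0.
have inv : invariant_distribution Q nu.
  by apply/invariant_distributionP => // z; exact: ltW.
split=> //.
- exact: cvgP DI_cvg.
- rewrite /causal_influence lt0r DI_ge0 andbT; split=> [H|/eqP DI0 /noneP//].
  by apply/eqP => /noneP.
- move=> _; have [v [Hv clt]] := plug_in_normal mX mY PQ Qpos a0 b0 nu0 nu1 nu_inv nu_cvg.
  exists nu, v; split=> //; last by rewrite DIE.
  by move=> nu' inv'; exact: invariant_distribution_unique.
- move=> /autoP au; have := plug_in_chi_squared mX mY PQ Qpos
    (a0 := a0) (b0 := b0) nu0 nu1 nu_inv nu_cvg au.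
  by rewrite card_interaction_index !card_tuple.
Qed.
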